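(* Let $X=\mathbb C$, so that $E=\ell^2(\mathbb Z)$, let $\Sigma_\alpha,\Sigma_\beta,\Sigma_\gamma\subset\mathbb C$ be non-empty and compact, and let $A$ be pseudoergodic with respect to $\Sigma_\alpha$, $\Sigma_\beta$, and $\Sigma_\gamma$. Then the $\pi$ method does not suffer from spectral pollution for $A$ for any $t\in\mathbb T$. Further, the $\tau$ method does not suffer from spectral pollution for $A$ if either: (a) $\gamma_*\le\alpha^*$ and $\alpha_*\le\gamma^*$; or (b) $\mathcal E_\cap$ is empty. Moreover, as $n\to\infty$, $$\Gamma^n_{\varepsilon+\varepsilon''_n}(A)\overset{H}{\to}\mathrm{Spec}_\varepsilon A,\ \varepsilon\ge0,\quad\text{and}\quad\gamma^n_{\varepsilon+\varepsilon''_n}(A)\overset{H}{\to}\mathrm{spec}_\varepsilon A,\ \varepsilon>0;$$ if $t\in\mathbb T$, also $$\Pi^{n,t}_{\varepsilon+\varepsilon'_n}(A)\overset{H}{\to}\mathrm{Spec}_\varepsilon A,\ \varepsilon\ge0,\quad\text{and}\quad\pi^{n,t}_{\varepsilon+\varepsilon'_n}(A)\overset{H}{\to}\mathrm{spec}_\varepsilon A,\ \varepsilon>0.$$ Further, if (a) or (b) holds, also $$\Sigma^n_{\varepsilon+\varepsilon_n}(A)\overset{H}{\to}\mathrm{Spec}_\varepsilon A,\ \varepsilon\ge0,\quad\text{and}\quad\sigma^n_{\varepsilon+\varepsilon_n}(A)\overset{H}{\to}\mathrm{spec}_\varepsilon A,\ \varepsilon>0.$$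
   Context: $\mathbb T=\{z\in\mathbb C:|z|=1\}$. $A$ is a tridiagonal operator on $\ell^2(\mathbb Z)$: $(Ax)_i=\alpha_{i-1}x_{i-1}+\beta_ix_i+\gamma_{i+1}x_{i+1}$ (matrix entries $a_{j+1,j}=\alpha_j$, $a_{j,j}=\beta_j$, $a_{j-1,j}=\gamma_j$). $A_{n,k}:=[a_{i,j}]_{i,j=k+1}^{k+n}$. Pseudoergodic with respect to $\Sigma_\alpha,\Sigma_\beta,\Sigma_\gamma$: $\alpha_j\in\Sigma_\alpha$, $\beta_j\in\Sigma_\beta$, $\gamma_j\in\Sigma_\gamma$ for all $j$, and for all $\varepsilon>0$, $n\in\mathbb N$ and all tridiagonal $B_n\in\mathbb C^{n\times n}$ with subdiagonal entries in $\Sigma_\alpha$, diagonal entries in $\Sigma_\beta$, superdiagonal entries in $\Sigma_\gamma$, there is $k\in\mathbb Z$ with $\|A_{n,k}-B_n\|<\varepsilon$. $\alpha_*:=\min_{z\in\Sigma_\alpha}|z|$, $\alpha^*:=\max_{z\in\Sigma_\alpha}|z|$, $\gamma_*:=\min_{z\in\Sigma_\gamma}|z|$, $\gamma^*:=\max_{z\in\Sigma_\gamma}|z|$. $\mathcal E(\widehat\alpha,\widehat\beta,\widehat\gamma):=\{z\widehat\alpha+\widehat\beta+z^{-1}\widehat\gamma:z\in\mathbb T\}$, an ellipse (degenerating to a line segment if $|\widehat\alpha|=|\widehat\gamma|$). $\mathcal E_\cap$ is the set of $z\in\mathbb C$ lying in the interior of (i.e. enclosed by) the ellipse $\mathcal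 E(\widehat\alpha,\widehat\beta,\widehat\gamma)$ for every $\widehat\alpha\in\Sigma_\alpha$, $\widehat\beta\in\Sigma_\beta$, $\widehat\gamma\in\Sigma_\gamma$. $\mathrm{Spec}_\varepsilon B:=\{\lambda:1/\|(B-\lambda I)^{-1}\|\le\varepsilon\}$ ($\varepsilon>0$), $\mathrm{Spec}_0B:=\mathrm{Spec}\,B$, $\mathrm{spec}_\varepsilon B:=\{\lambda:1/\|(B-\lambda I)^{-1}\|<\varepsilon\}$ ($\varepsilon>0$), with $\|C^{-1}\|:=\infty$ for non-invertible $C$, $1/\infty:=0$. $A^{\mathrm{per},t}_{n,k}:=A_{n,k}+B^t_{n,k}$, where $B^t_{n,k}$ has $(i,j)$ entry $\delta_{i,1}\delta_{j,n}t\alpha_k+\delta_{i,n}\delta_{j,1}\bar t\gamma_{k+n+1}$ (Euclidean norms on $\mathbb C^n$). Define $\sigma^n_\varepsilon(A):=\bigcup_k\mathrm{spec}_\varepsilon A_{n,k}$, $\Sigma^n_\varepsilon(A):=\overline{\bigcup_k\mathrm{Spec}_\varepsilon A_{n,k}}$, $\pi^{n,t}_\varepsilon(A):=\bigcup_k\mathrm{spec}_\varepsilon A^{\mathrm{per},t}_{n,k}$, $\Pi^{n,t}_\varepsilon(A):=\overline{\bigcup_k\mathrm{Spec}_\varepsilon A^{\mathrm{per},t}_{n,k}}$ (unions over $k\in\mathbb Z$). With $\nu(B):=\inf_{\|x\|=1}\|Bx\|$, $A^*$ the transpose of $A$, and $E_{n,k}$ the sequences supported in $\{k+1,\dots,k+n\}$,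 $\mu_n(B):=\inf_{k\in\mathbb Z}\min(\nu(B|_{E_{n,k}}),\nu(B^*|_{E_{n,k}}))$, $\gamma^n_\varepsilon(A):=\{\lambda:\mu_n(A-\lambda I)<\varepsilon\}$, $\Gamma^n_\varepsilon(A):=\{\lambda:\mu_n(A-\lambda I)\le\varepsilon\}$. Penalty terms, with $\|\alpha\|_\infty=\sup_j|\alpha_j|$ etc.: $\varepsilon'_n:=2(\|\alpha\|_\infty+\|\gamma\|_\infty)\sin\frac{\pi}{2n}$, $\varepsilon''_n:=2(\|\alpha\|_\infty+\|\gamma\|_\infty)\sin\frac{\pi}{2(n+1)}$, and $\varepsilon_n:=2\inf_{0<\phi<1}\Big(\sqrt{\|\alpha\|_\infty^2/\phi+\|\gamma\|_\infty^2/(1-\phi)}\,\sin\frac{\theta_n(\phi)}2\Big)$, where $\theta_n(\phi)$ is the unique $t\in[\frac{\pi}{2n+1},\frac{\pi}{n+2}]$ with $2\sin\frac t2\cos((n+\frac12)t)+\phi(1-\phi)\sin((n-1)t)=0$. The $\tau$ method (the $\pi$ method for a given $t$) does not suffer from spectral pollution for $A$ if there is a positive null sequence $(\eta_n)$ such that, for every $\varepsilon>0$, $\mathrm{spec}_\varepsilon A_{n,k}\subset\mathrm{spec}_{\varepsilon+\eta_n}A$ (respectively $\mathrm{spec}_\varepsilon A^{\mathrm{per},t}_{n,k}\subset\mathrm{spec}_{\varepsilon+\eta_n}A$) for all $n\in\mathbb N$, $k\in\mathbb Z$. $S_n\overset{H}{\to}S$ means $d_H(S_n,S)\to0$, where $d_H(S,T):=\max(\sup_{s\in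 S}\mathrm{dist}(s,T),\sup_{t\in T}\mathrm{dist}(t,S))$ for bounded non-empty sets. *)

(* Defs.v *)
From HB Require Import structures.
From mathcomp Require Import all_boot all_order all_algebra.
From mathcomp Require Import complex.
From mathcomp Require Import all_classical all_reals all_analysis.

Set Implicit Arguments.
Unset Strict Implicit.
Unset Printing Implicit Defensive.

Import Order.TTheory GRing.Theory Num.Theory.
Import numFieldNormedType.Exports.

Local Open Scope classical_set_scope.
Local Open Scope ring_scope.

(* The complex numbers, packed as a numClosedFieldType so that the norm topology
   and the scaling of the complex numbers by themselves are inferred. The library
   gives the bare type R[i] no topology and makes it an lmodType over R. *)
Definition Cplx (R : realType) : numClosedFieldType := R[i].

(* The modulus as an element of R; the norm `|z| has values in R[i]. *)
Definition cabs (R : realType) (z : Cplx R) : R := ComplexField.Normc.normc z.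

(* A normed space is given by an lmodType V, a linear subspace D of V and a norm
   N on D. It is instantiated below with C^n and with l^2(Z). Operators are
   functions V -> V mapping D to D; their values outside D are irrelevant. *)
Section Pseudospectra.
Variables (R : realType) (V : lmodType (Cplx R)) (D : set V) (N : V -> R).

Definition opnorm (T : V -> V) : \bar R :=
  ereal_sup [set (N (T x))%:E | x in [set x | D x /\ N x <= 1]].

Definition bounded_linear (T : V -> V) : Prop :=
  [/\ forall x, D x -> D (T x),
      forall (c : Cplx R) x y, D x -> D y -> T (c *: x + y) = c *: T x + T y
    & (opnorm T < +oo)%E].

Definition is_inverse (T S : V -> V) : Prop :=
  bounded_linear S /\ forall x, D x -> S (T x) = x /\ T (S x) = x.

Definition invertible (T : V -> V) : Prop := exists S, is_inverse T S.

(* An inverse is unique on D, so this is the norm of the inverse if T is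
   invertible, and otherwise it is the infimum of the empty set, +oo. *)
Definition inv_opnorm (T : V -> V) : \bar R :=
  ereal_inf [set opnorm S | S in [set S | is_inverse T S]].

Definition subscalar (T : V -> V) (lam : Cplx R) : V -> V :=
  fun x => T x - lam *: x.

Definition Spec (T : V -> V) : set (Cplx R) :=
  [set lam | ~ invertible (subscalar T lam)].

(* In \bar R, +oo^-1 = 0. *)
Definition Spec_eps (eps : R) (T : V -> V) : set (Cplx R) :=
  if eps == 0 then Spec T
  else [set lam | ((inv_opnorm (subscalar T lam))^-1 <= eps%:E)%E].

Definition spec_eps (eps : R) (T : V -> V) : set (Cplx R) :=
  [set lam | ((inv_opnorm (subscalar T lam))^-1 < eps%:E)%E].

End Pseudospectra.

Section Matrices.
Variables (R : realType) (n : nat).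

Definition eucl (v : 'cV[Cplx R]_n) : R :=
  Num.sqrt (\sum_(i < n) cabs (v i 0) ^+ 2).

Definition mxnorm (M : 'M[Cplx R]_n) : \bar R := opnorm setT eucl (mulmx M).

Definition Spec_mx (eps : R) (M : 'M[Cplx R]_n) : set (Cplx R) :=
  Spec_eps setT eucl eps (mulmx M).

Definition spec_mx (eps : R) (M : 'M[Cplx R]_n) : set (Cplx R) :=
  spec_eps setT eucl eps (mulmx M).

End Matrices.

Section Tridiagonal.
Variable R : realType.
Local Notation C := (Cplx R).

Definition sumsq (x : int -> C) : \bar R :=
  (\esum_(i in [set: int]) (cabs (x i) ^+ 2)%:E)%E.

Definition ell2 : set (int -> C) := [set x | (sumsq x < +oo)%E].

Definition l2norm (x : int -> C) : R := Num.sqrt (fine (sumsq x)).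

(* Doubly infinite matrices, in row-column order. *)
Definition trimat (al be ga : int -> C) (i j : int) : C :=
  if i == j + 1 then al j
  else if i == j then be j
  else if i == j - 1 then ga j
  else 0.

(* The action of a matrix that vanishes off the three central diagonals. *)
Definition triop (a : int -> int -> C) (x : int -> C) : int -> C :=
  fun i => a i (i - 1) * x (i - 1) + a i i * x i + a i (i + 1) * x (i + 1).

Definition Spec_l2 (eps : R) (a : int -> int -> C) : set C :=
  Spec_eps ell2 l2norm eps (triop a).

Definition spec_l2 (eps : R) (a : int -> int -> C) : set C :=
  spec_eps ell2 l2norm eps (triop a).

(* A_{n,k}, with (0-based) index i standing for row or column k + 1 + i. *)
Definition finsec (a : int -> int -> C) (n : nat) (k : int) : 'M[C]_n :=
  \matrix_(i < n, j < n) a (k + 1 + i%:Z) (k + 1 + j%:Z).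

(* The corner entries coincide with other entries if n <= 2, whence the sums. *)
Definition corner (al ga : int -> C) (t : C) (n : nat) (k : int) : 'M[C]_n :=
  \matrix_(i < n, j < n)
    (((i == 0 :> nat) && (j.+1 == n))%:R * (t * al k)
     + ((i.+1 == n) && (j == 0 :> nat))%:R * (t^* * ga (k + n%:Z + 1))).

Definition persec (al be ga : int -> C) (t : C) (n : nat) (k : int) : 'M[C]_n :=
  finsec (trimat al be ga) n k + corner al ga t n k.

Definition tridiag_in (Sa Sb Sc : set C) (n : nat) (B : 'M[C]_n) : Prop :=
  forall i j : 'I_n,
    [/\ i = j.+1 :> nat -> Sa (B i j),
        i = j -> Sb (B i j),
        j = i.+1 :> nat -> Sc (B i j)
      & (i.+1 < j)%N || (j.+1 < i)%N -> B i j = 0].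

Definition pseudoergodic (Sa Sb Sc : set C) (al be ga : int -> C) : Prop :=
  (forall j, [/\ Sa (al j), Sb (be j) & Sc (ga j)]) /\
  forall (eps : R) (n : nat) (B : 'M[C]_n), 0 < eps -> (0 < n)%N ->
    tridiag_in Sa Sb Sc B ->
    exists k : int, (mxnorm (finsec (trimat al be ga) n k - B) < eps%:E)%E.

(* These two are the sets sigma, Sigma for M = finsec a n and the sets pi, Pi
   for M = persec al be ga t n. *)
Definition union_spec (n : nat) (M : int -> 'M[C]_n) (eps : R) : set C :=
  \bigcup_(k in [set: int]) spec_mx eps (M k).

Definition union_Spec (n : nat) (M : int -> 'M[C]_n) (eps : R) : set C :=
  closure (\bigcup_(k in [set: int]) Spec_mx eps (M k)).

Definition supported (n : nat) (k : int) : set (int -> C) :=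
  [set x | forall i, ~ (k + 1 <= i <= k + n%:Z) -> x i = 0].

Definition nu_on (E : set (int -> C)) (a : int -> int -> C) : R :=
  inf [set l2norm (triop a x) | x in [set x | E x /\ l2norm x = 1]].

Definition transp (a : int -> int -> C) : int -> int -> C := fun i j => a j i.

Definition mu (n : nat) (a : int -> int -> C) : R :=
  inf [set Num.min (nu_on (supported n k) a) (nu_on (supported n k) (transp a))
      | k in [set: int]].

Definition shiftmat (a : int -> int -> C) (lam : C) : int -> int -> C :=
  fun i j => a i j - (if i == j then lam else 0).

Definition gamma_set (n : nat) (a : int -> int -> C) (eps : R) : set C :=
  [set lam | mu n (shiftmat a lam) < eps].

Definition Gamma_set (n : nat) (a : int -> int -> C) (eps : R) : set C :=
  [set lam | mu n (shiftmat a lam) <= eps].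

Definition supnorm (u : int -> C) : R :=
  sup [set cabs (u j) | j in [set: int]].

Definition pen1 (al ga : int -> C) (n : nat) : R :=
  2 * (supnorm al + supnorm ga) * sin (pi / (2 * n%:R)).

Definition pen2 (al ga : int -> C) (n : nat) : R :=
  2 * (supnorm al + supnorm ga) * sin (pi / (2 * (n%:R + 1))).

(* The chosen element is the unique one of the set. *)
Definition theta (n : nat) (phi : R) : R :=
  xget 0 [set t : R | pi / (2 * n%:R + 1) <= t <= pi / (n%:R + 2) /\
    2 * sin (t / 2) * cos ((n%:R + 2^-1) * t)
      + phi * (1 - phi) * sin ((n%:R - 1) * t) = 0].

Definition pen (al ga : int -> C) (n : nat) : R :=
  2 * inf [set Num.sqrt (supnorm al ^+ 2 / phi + supnorm ga ^+ 2 / (1 - phi))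
               * sin (theta n phi / 2) | phi in [set phi : R | 0 < phi < 1]].

Definition no_pollution (M : forall n : nat, int -> 'M[C]_n)
    (a : int -> int -> C) : Prop :=
  exists eta : nat -> R,
    [/\ forall n, 0 < eta n,
        eta n @[n --> \oo] --> 0
      & forall eps : R, 0 < eps -> forall (n : nat) (k : int), (0 < n)%N ->
          spec_mx eps (M n k) `<=` spec_l2 (eps + eta n) a].

(* The minimum and the maximum of the modulus on a nonempty compact set. *)
Definition minabs (S : set C) : R := inf [set cabs z | z in S].
Definition maxabs (S : set C) : R := sup [set cabs z | z in S].

Definition ellipse (a b c : C) : set C :=
  [set z * a + b + z^-1 * c | z in [set z : C | cabs z = 1]].

(* The union of the bounded components of the complement; it is empty if the
   ellipse degenerates to a line segment or a point. *)
Definition enclosed (K : set C) : set C :=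
  [set w | ~ K w /\ bounded_set (connected_component (~` K) w)].

Definition ellipse_cap (Sa Sb Sc : set C) : set C :=
  [set w | forall a b c, Sa a -> Sb b -> Sc c -> enclosed (ellipse a b c) w].

Definition dist_to (z : C) (S : set C) : \bar R :=
  ereal_inf [set (cabs (z - s))%:E | s in S].

(* With values in \bar R: if T is bounded and nonempty, a finite distance to T
   forces S to be bounded and nonempty too. *)
Definition hausdorff_dist (S T : set C) : \bar R :=
  maxe (ereal_sup [set dist_to s T | s in S])
       (ereal_sup [set dist_to t S | t in T]).

Definition hausdorff_cvg (S : nat -> set C) (T : set C) : Prop :=
  hausdorff_dist (S n) T @[n --> \oo] --> 0%E.

End Tridiagonal.

(* Main.v *)
Require Import Defs.
From HB Require Import structures.
From mathcomp Require Import all_boot all_order all_algebra.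
From mathcomp Require Import complex.
From mathcomp Require Import all_classical all_reals all_analysis.
From mathcomp Require Import zify ring lra.
Import Order.TTheory GRing.Theory Num.Theory.
Import numFieldNormedType.Exports.
Set Implicit Arguments.
Unset Strict Implicit.
Unset Printing Implicit Defensive.
Local Open Scope classical_set_scope.
Local Open Scope ring_scope.

(* Call a tridiagonal matrix with entries in Sigma_alpha, Sigma_beta, Sigma_gamma
   admissible. Multiplying an approximate eigenvector by a slowly varying window
   and averaging over all translates of the window shows that some translate
   localizes it at a small cost. As A contains approximate copies of all finite
   admissible blocks, lambda lies in spec_eps A iff SOME admissible operator has
   an eps-approximate eigenvector.
   The same averaging, with the windows that are optimal for the respective
   boundary conditions, gives spec_eps A inside the n-th approximation with the
   penalties eps'_n, eps''_n and eps_n.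
   Conversely, a vector on a periodized section extends quasi-periodically to an
   approximate eigenvector of a periodic admissible operator. A vector on a plain
   section yields, by localization away from one of the two ends, an approximate
   eigenvector of an admissible half-line operator. If lambda lies on one of the
   ellipses, it belongs to the spectrum; otherwise (a) or (b) provides a symbol
   whose exponential solution decays, and a Coburn type alternative produces an
   approximate eigenvector on the opposite half-line as well, to be glued to the
   first one.
   Hausdorff convergence follows by compactness, and since the resolvent norm is
   not locally constant, so that spec_eps is dense in Spec_eps. *)

(* lia preprocesses every hypothesis, which is slow on the analytic ones. *)
Ltac ilia := repeat match goal with R : realType |- _ => clear dependent R end; lia.

(** The obstacle is the plain section: its vector has a controlled residual only in the rows of the
    section, localization frees it from just one of the two ends, and which one is not under
    control. Hence a symbol is needed for each orientation, and (a) or (b) serves only to supply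
    them. Gluing works because two half-lines leave a single row between them, which the ratio of
    the two vectors can cancel. The two directions need different constants. The inclusions of
    spec_eps A need the exact penalties, which come from the lowest eigenvector of a second
    difference under the boundary condition dictated by the method: zero values for eps' and eps'',
    a mixed condition for eps_n. Against pollution a cruder bound of order 1/n suffices. Strict
    inequalities provide the room: a vector at level eps is also one at some e < eps, and the
    difference pays for localization. That the resolvent norm is not locally constant is used
    uniformly over all sections of one size, since the section found depends on the level; level 0
    escapes this argument and is reached only by diagonal operators. *)

(** * The modulus, and sums over the integers *)

Section ComplexModulus.
Variable R : realType.
Local Notation C := (Cplx R).
Implicit Types z w : C.

Lemma cabsE z : `|z| = (cabs z)%:C%C.
Proof. by case: z. Qed.

Lemma cabs_ge0 z : 0 <= cabs z.
Proof. by case: z => a b; exact: sqrtr_ge0. Qed.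

Lemma cabsD z w : cabs (z + w) <= cabs z + cabs w.
Proof. exact: (@le_normcD R). Qed.

Lemma cabsM z w : cabs (z * w) = cabs z * cabs w.
Proof. exact: ComplexField.Normc.normcM. Qed.

Lemma cabsN z : cabs (- z) = cabs z.
Proof. exact: (@normcN R). Qed.

Lemma cabsB z w : cabs (z - w) <= cabs z + cabs w.
Proof. by rewrite -(cabsN w) cabsD. Qed.

Lemma cabs_distC z w : cabs (z - w) = cabs (w - z).
Proof. by rewrite -cabsN opprB. Qed.

Lemma cabsV z : cabs z^-1 = (cabs z)^-1.
Proof. exact: ComplexField.Normc.normcV. Qed.

Lemma cabs0 : cabs (0 : C) = 0.
Proof. exact: ComplexField.Normc.normc0. Qed.

Lemma cabs1 : cabs (1 : C) = 1.
Proof. exact: ComplexField.Normc.normc1. Qed.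

Lemma cabs_eq0 z : (cabs z == 0) = (z == 0).
Proof.
by apply/eqP/eqP => [/ComplexField.Normc.eq0_normc//|->]; rewrite cabs0.
Qed.

Lemma cabs_gt0 z : (0 < cabs z) = (z != 0).
Proof. by rewrite lt_neqAle eq_sym cabs_eq0 cabs_ge0 andbT. Qed.

Lemma cabsX z n : cabs (z ^+ n) = cabs z ^+ n.
Proof. by elim: n => [|n IH]; rewrite ?expr0 ?cabs1// !exprS cabsM IH. Qed.

Lemma cabs_conj z : cabs z^* = cabs z.
Proof.
have := norm_conjC z; rewrite !cabsE => /(congr1 (@complex.Re R)) /=; exact.
Qed.

Definition ofR (r : R) : C := r%:C%C.

Lemma cabs_ofR (r : R) : cabs (ofR r) = `|r|.
Proof. by rewrite /cabs /ofR/= expr0n/= addr0 sqrtr_sqr. Qed.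

Lemma ofRB r s : ofR (r - s) = ofR r - ofR s.
Proof. exact: (rmorphB (@real_complex R)). Qed.

Lemma ofR0 : ofR 0 = 0. Proof. by []. Qed.

Lemma ofR1 : ofR 1 = 1. Proof. by []. Qed.

Lemma mulconjE z : z * z^* = ofR (cabs z ^+ 2).
Proof. by rewrite -normCK cabsE /ofR rmorphXn. Qed.

Lemma cabs_sum I (r : seq I) (P : pred I) (F : I -> C) :
  cabs (\sum_(i <- r | P i) F i) <= \sum_(i <- r | P i) cabs (F i).
Proof.
elim/big_ind2: _ => //; first by rewrite cabs0.
by move=> z a w b za wb; apply: (le_trans (cabsD _ _)); exact: lerD.
Qed.

Lemma cabs_re z : `|complex.Re z| <= cabs z.
Proof.
case: z => a b; rewrite /cabs/= -sqrtr_sqr ler_sqrt ?lerDl ?sqr_ge0//.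
by rewrite addr_ge0 ?sqr_ge0.
Qed.

Lemma cabs_im z : `|complex.Im z| <= cabs z.
Proof.
case: z => a b; rewrite /cabs/= -sqrtr_sqr ler_sqrt ?lerDr ?sqr_ge0//.
by rewrite addr_ge0 ?sqr_ge0.
Qed.

Lemma cabs_sqrE z : cabs z ^+ 2 = complex.Re z ^+ 2 + complex.Im z ^+ 2.
Proof. by case: z => a b; rewrite /cabs/= sqr_sqrtr ?addr_ge0 ?sqr_ge0. Qed.

Lemma cabs_parallelogram z w :
  cabs (z + w) ^+ 2 + cabs (z - w) ^+ 2 = 2 * cabs z ^+ 2 + 2 * cabs w ^+ 2.
Proof. by rewrite !cabs_sqrE; case: z => a b; case: w => c d /=; ring. Qed.

End ComplexModulus.

Section IntegerSums.
Variable R : realType.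
Implicit Types f g : int -> R.

(* The pointwise form of the triangle inequality in a Hilbert norm: summing it
   and optimizing over the weights replaces Minkowski's inequality. *)
Lemma sqrD_weighted (a b p q : R) : 0 < p -> 0 < q ->
  (a + b) ^+ 2 <= (p + q) * (a ^+ 2 / p + b ^+ 2 / q).
Proof.
move=> p0 q0.
have -> : (p + q) * (a ^+ 2 / p + b ^+ 2 / q) =
   (a + b) ^+ 2 + (q * a - p * b) ^+ 2 / (p * q).
  by field; rewrite ?gt_eqF// mulr_gt0.
by rewrite lerDl divr_ge0 ?sqr_ge0// ltW// mulr_gt0.
Qed.

Definition zsum f : \bar R := (\esum_(i in [set: int]) (f i)%:E)%E.

Definition ssum (N : nat) f : R := \sum_(i < N.*2.+1) f (i%:Z - N%:Z).

Lemma zsum_ge0 f : (forall i, 0 <= f i) -> (0 <= zsum f)%E.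
Proof. by move=> f0; apply: esum_ge0 => i _; rewrite lee_fin. Qed.

Lemma le_zsum f g : (forall i, f i <= g i) -> (zsum f <= zsum g)%E.
Proof. by move=> fg; apply: le_esum => i _; rewrite lee_fin. Qed.

Lemma eq_zsum f g : f =1 g -> zsum f = zsum g.
Proof. by move=> /funext ->. Qed.

Lemma zsumD f g : (forall i, 0 <= f i) -> (forall i, 0 <= g i) ->
  zsum (fun i => f i + g i) = (zsum f + zsum g)%E.
Proof.
by move=> f0 g0; rewrite /zsum -esumD// => i _; rewrite lee_fin.
Qed.

Lemma zsum_sum (I : choiceType) (r : seq I) (F : I -> int -> R) :
  (forall j i, 0 <= F j i) ->
  zsum (fun i => \sum_(j <- r) F j i) = (\sum_(j <- r) zsum (F j))%E.
Proof.
move=> F0; have := @esum_sum R int I setT r xpredT (fun i j => (F j i)%:E).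
rewrite /zsum => <-; last by move=> i j _ _; rewrite lee_fin.
by apply: eq_esum => i _; rewrite sumEFin.
Qed.

Lemma zsumZ (c : R) f : 0 <= c -> (forall i, 0 <= f i) ->
  zsum (fun i => c * f i) = (c%:E * zsum f)%E.
Proof.
move=> c0 f0; have half (d : R) g : 0 <= d -> (forall i, 0 <= g i) ->
    (zsum (fun i => (d * g i)%R) <= d%:E * zsum g)%E.
  move=> d0 g0; rewrite ge_ereal_sup// => _ [X [finX XI]] <-.
  under eq_fsbigr do rewrite EFinM.
  rewrite -ge0_mule_fsumr; last by move=> i; rewrite lee_fin.
  by rewrite lee_wpmul2l ?lee_fin// esum_ge//; exists X.
apply/eqP; rewrite eq_le half//=.
have [->|cn0] := eqVneq c 0.
  by rewrite mul0e zsum_ge0// => i; rewrite mul0r.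
have {cn0}c0 : 0 < c by rewrite lt_neqAle eq_sym cn0.
(* The reverse inequality is [half] for the factor c^-1 and the function c f. *)
have := half c^-1 (fun i => c * f i).
rewrite (_ : (fun i => c^-1 * (c * f i)) = f); last first.
  by apply/funext => i; rewrite mulKf ?gt_eqF.
rewrite invr_ge0 (ltW c0) => /(_ isT (fun i => mulr_ge0 (ltW c0) (f0 i))) h.
by rewrite -lee_pdivlMl.
Qed.

Lemma zsum_reindex (e e' : int -> int) f : cancel e e' -> cancel e' e ->
  zsum (fun i => f (e i)) = zsum f.
Proof.
move=> ee' e'e; rewrite /zsum (@reindex_esum _ _ _ setT setT e (fun i => (f i)%:E))//.
split=> //; first by move=> x y _ _ /(can_inj ee').
by move=> y _; exists (e' y).
Qed.

Lemma zsum_shift (c : int) f : zsum (fun i => f (i + c)) = zsum f.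
Proof. by apply: (@zsum_reindex _ (fun i => i - c)) => i; lia. Qed.

Lemma zsum_reflect (c : int) f : zsum (fun i => f (c - i)) = zsum f.
Proof. by apply: (@zsum_reindex _ (fun i => c - i)) => i; lia. Qed.

Lemma zsum_single (c : int) (a : R) : 0 <= a ->
  zsum (fun i => if i == c then a else 0) = a%:E.
Proof.
move=> a0; rewrite -[RHS](@esum_set1 R int c (fun=> a%:E)) ?lee_fin//.
rewrite [RHS]esum_mkcond; apply: eq_esum => i _.
by rewrite in_set1; case: eqP.
Qed.

(** Decomposes f into point masses, so that [zsum] of a finitely supported function becomes a finite
    sum of one-point sums. *)
Lemma ssum_single (N : nat) f (i : int) : (`|i| <= N)%N ->
  f i = \sum_(k < N.*2.+1) (if i == k%:Z - N%:Z then f (k%:Z - N%:Z) else 0).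
Proof.
move=> iN; have kb : (absz (i + N%:Z)%R < N.*2.+1)%N by lia.
rewrite (bigD1 (Ordinal kb))//= big1 ?addr0.
  have -> : (absz (i + N%:Z)%R)%:Z - N%:Z = i by lia.
  by rewrite eqxx.
move=> k kn; case: eqP => // e; case/eqP: kn; apply: val_inj => /=; lia.
Qed.

Lemma zsum_ssum (N : nat) f : (forall i, 0 <= f i) ->
  (forall i, (N < `|i|)%N -> f i = 0) -> zsum f = (ssum N f)%:E.
Proof.
move=> f0 fN.
rewrite (@eq_zsum f (fun i => \sum_(k < N.*2.+1)
    (if i == k%:Z - N%:Z then f (k%:Z - N%:Z) else 0))); last first.
  move=> i; have [iN|Ni] := leqP `|i|%N N; first exact: ssum_single.
  rewrite fN// big1// => k _; case: eqP => // e.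
  by have := ltn_ord k; lia.
rewrite zsum_sum; last by move=> j i; case: eqP.
by rewrite /ssum -sumEFin; apply: eq_bigr => k _; rewrite zsum_single.
Qed.

Lemma ssum_le_zsum (N : nat) f : (forall i, 0 <= f i) ->
  ((ssum N f)%:E <= zsum f)%E.
Proof.
move=> f0; pose g i := if (`|i| <= N)%N then f i else 0.
have g0 i : 0 <= g i by rewrite /g; case: ifP.
have -> : ssum N f = ssum N g.
  apply: eq_bigr => k _; rewrite /g ifT//; have := ltn_ord k; lia.
rewrite -zsum_ssum//; last by move=> i iN; rewrite /g leqNgt iN.
by apply: le_zsum => i; rewrite /g; case: ifP.
Qed.

Lemma zsum_le_ssum f (B : \bar R) : (forall i, 0 <= f i) ->
  (forall N, ((ssum N f)%:E <= B)%E) -> (zsum f <= B)%E.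
Proof.
move=> f0 fB; rewrite ge_ereal_sup// => _ [X [finX XI]] <-.
have [N XN] : exists N : nat, forall i, X i -> (`|i| <= N)%N.
  have /finite_seqP[s ->] := finX.
  exists (\max_(i <- s) `|i|)%N => i /= si.
  by rewrite (big_rem i)//= leq_maxl.
rewrite -esum_fset//; last by move=> i _; rewrite lee_fin.
rewrite esum_mkcond; apply: le_trans (fB N).
rewrite (_ : esum _ _ = zsum (fun i => if i \in X then f i else 0)); last first.
  by apply: eq_esum => i _; case: ifP.
rewrite (@zsum_ssum N).
- by rewrite lee_fin ler_sum// => k _; case: ifP.
- by move=> i; case: ifP.
- by move=> i iN; rewrite ifF//; apply/negP => /set_mem /XN; lia.
Qed.

Lemma ge_zsum f i : (forall i, 0 <= f i) -> ((f i)%:E <= zsum f)%E.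
Proof.
move=> f0; rewrite -(@zsum_single i (f i))//; apply: le_zsum => j.
by case: eqP => [->|].
Qed.

(** The shifted window drops index -N and gains N + 1; f vanishes at both, so summation by parts has
    no boundary terms. *)
Lemma ssum_shift (N : nat) f : (forall i, (N <= `|i|)%N -> f i = 0) ->
  ssum N (fun i => f (i + 1)) = ssum N f.
Proof.
move=> fN; rewrite /ssum big_ord_recr/= big_ord_recl/= (fN (0 - N%:Z)); last lia.
rewrite (fN (_ + 1)); last lia.
by rewrite addr0 add0r; apply: eq_bigr => k _; congr f; rewrite /bump/=; lia.
Qed.

End IntegerSums.

(** * Pseudospectra and the resolvent norm *)

Section AbstractResolvent.
Variables (R : realType) (V : lmodType (Cplx R)) (D : set V) (N : V -> R).
Local Notation C := (Cplx R).

(** Collects what C^n and l^2 share. The parallelogram law stands in for an inner product; it drives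
    [inv_bounded_improve]. *)
Definition hilbertian : Prop :=
  [/\ D 0 /\ (forall (c : C) x y, D x -> D y -> D (c *: x + y)),
      forall x, 0 <= N x,
      (forall (c : C) x, D x -> N (c *: x) = cabs c * N x) /\
      (forall x, D x -> N x = 0 -> x = 0),
      forall x y, D x -> D y -> N (x + y) <= N x + N y
    & forall x y, D x -> D y ->
        N (x + y) ^+ 2 + N (x - y) ^+ 2 = 2 * N x ^+ 2 + 2 * N y ^+ 2].

Hypothesis H : hilbertian.

Let D0 : D 0. Proof. by case: H => [[]]. Qed.
Let DL (c : C) x y : D x -> D y -> D (c *: x + y).
Proof. by case: H => -[_ h] _ _ _ _; exact: h. Qed.
Let DZ (c : C) x : D x -> D (c *: x).
Proof. by move=> Dx; rewrite -[_ *: _]addr0; exact: DL. Qed.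
Let DA x y : D x -> D y -> D (x + y).
Proof. by move=> Dx Dy; rewrite -[x]scale1r; exact: DL. Qed.
Let DB x y : D x -> D y -> D (x - y).
Proof. by move=> Dx Dy; rewrite addrC -scaleN1r; exact: DL. Qed.
Let N_ge0 x : 0 <= N x. Proof. by case: H. Qed.
Let NZ (c : C) x : D x -> N (c *: x) = cabs c * N x.
Proof. by case: H => _ _ [h _] _ _; exact: h. Qed.
Let N_eq0 x : D x -> N x = 0 -> x = 0.
Proof. by case: H => _ _ [_ h] _ _; exact: h. Qed.
Let N0 : N 0 = 0.
Proof. by have := NZ 0 D0; rewrite scale0r cabs0 mul0r. Qed.
Let ND x y : D x -> D y -> N (x + y) <= N x + N y.
Proof. by case: H => _ _ _ h _; exact: h. Qed.
Let NN x : D x -> N (- x) = N x.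
Proof. by move=> Dx; rewrite -scaleN1r NZ// cabsN cabs1 mul1r. Qed.
Let NP x y : D x -> D y ->
  N (x + y) ^+ 2 + N (x - y) ^+ 2 = 2 * N x ^+ 2 + 2 * N y ^+ 2.
Proof. by case: H => _ _ _ _ h; exact: h. Qed.

Definition linear_on (T : V -> V) : Prop :=
  (forall x, D x -> D (T x)) /\
  forall (c : C) x y, D x -> D y -> T (c *: x + y) = c *: T x + T y.

(** The bound $\|T^{-1}\|\le 1/\eta$ in multiplied-out form, free of extended reals; pseudospectra
    are its failure. *)
Definition inv_bounded (eta : R) (T : V -> V) : Prop :=
  exists S, is_inverse D N T S /\ forall x, D x -> eta * N (S x) <= N x.

Lemma linear_on0 T : linear_on T -> T 0 = 0.
Proof.
move=> [_ TL]; have := TL (-1) 0 0 D0 D0.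
by rewrite scaler0 add0r scaleN1r addNr.
Qed.

Lemma linear_onZ T c x : linear_on T -> D x -> T (c *: x) = c *: T x.
Proof.
move=> HT Dx; have := HT.2 c x 0 Dx D0.
by rewrite (linear_on0 HT) !addr0.
Qed.

Lemma linear_onD T x y : linear_on T -> D x -> D y -> T (x + y) = T x + T y.
Proof. by move=> HT Dx Dy; have := HT.2 1 x y Dx Dy; rewrite !scale1r. Qed.

Lemma linear_onB T x y : linear_on T -> D x -> D y -> T (x - y) = T x - T y.
Proof.
move=> HT Dx Dy; have := HT.2 (-1) y x Dy Dx.
by rewrite !scaleN1r ![- _ + _]addrC.
Qed.

Lemma linear_on_subscalar T lam : linear_on T -> linear_on (subscalar T lam).
Proof.
move=> HT; split=> [x Dx|c x y Dx Dy]; rewrite /subscalar.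
  by apply: DB; [exact: HT.1|exact: DZ].
rewrite HT.2// scalerDr scalerBr !scalerA [lam * c]mulrC opprD addrACA.
by [].
Qed.

Lemma bounded_linear_on S : bounded_linear D N S -> linear_on S.
Proof. by case=> [h1 h2 _]. Qed.

Lemma opnorm_leP T (c : R) : linear_on T -> 0 <= c ->
  (opnorm D N T <= c%:E)%E <-> forall x, D x -> N (T x) <= c * N x.
Proof.
move=> HT c0; split=> [h x Dx|h]; last first.
  apply: ge_ereal_sup => _ [x [Dx Nx1] <-]; rewrite lee_fin.
  by apply: le_trans (h _ Dx) _; rewrite ler_piMr.
have [Nx|Nx] := eqVneq (N x) 0.
  by rewrite (N_eq0 Dx Nx) linear_on0// N0 mulr0.
have Nxp : 0 < N x by rewrite lt_neqAle eq_sym Nx N_ge0.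
have e : N ((ofR (N x)^-1) *: x) = 1.
  by rewrite NZ// cabs_ofR ger0_norm ?invr_ge0// mulVf.
have : ((N (T (ofR (N x)^-1 *: x)))%:E <= c%:E)%E.
  apply: le_trans h; apply: ereal_sup_ubound; exists (ofR (N x)^-1 *: x) => //.
  by split; [exact: DZ|rewrite e].
rewrite lee_fin linear_onZ// NZ ?HT.1//; last exact: HT.1.
by rewrite cabs_ofR ger0_norm ?invr_ge0// mulrC ler_pdivrMr.
Qed.

Lemma opnorm_ge0 T : (0 <= opnorm D N T)%E.
Proof.
apply: (@le_trans _ _ (N (T 0))%:E); first by rewrite lee_fin.
by apply: ereal_sup_ubound; exists 0 => //; split=> //; rewrite N0 ler01.
Qed.

Lemma is_inverse_opnorm T S : is_inverse D N T S ->
  inv_opnorm D N T = opnorm D N S.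
Proof.
move=> [bS TS]; apply/eqP; rewrite eq_le; apply/andP; split.
  by apply: ereal_inf_lbound; exists S.
apply: le_ereal_inf_tmp => _ [S' [bS' TS'] <-].
have e x : D x -> S x = S' x.
  move=> Dx; have [SD _ _] := bS.
  by have [<- _] := TS' _ (SD _ Dx); rewrite (TS _ Dx).2.
by apply: ge_ereal_sup => _ [x [Dx Nx] <-]; rewrite e//;
   apply: ereal_sup_ubound; exists x.
Qed.

Lemma inv_opnorm_ge0 T : (0 <= inv_opnorm D N T)%E.
Proof. by apply: le_ereal_inf_tmp => _ [S _ <-]; exact: opnorm_ge0. Qed.

Lemma inv_boundedP eta T : 0 < eta ->
  inv_bounded eta T <-> (inv_opnorm D N T <= eta^-1%:E)%E.
Proof.
move=> eta0; split=> [[S [TS hS]]|h].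
  rewrite (is_inverse_opnorm TS); apply/opnorm_leP; rewrite ?invr_ge0 ?ltW//.
    exact: bounded_linear_on TS.1.
  by move=> x Dx; rewrite mulrC ler_pdivlMr// mulrC hS.
have [S TS] : exists S, is_inverse D N T S.
  apply: contrapT => nS; move: h; rewrite /inv_opnorm (_ : [set _ | _ in _] = set0).
    by rewrite ereal_inf0 leye_eq.
  by apply/seteqP; split=> [y [S HS _]|//]; case: nS; exists S.
exists S; split=> // x Dx; move: h; rewrite (is_inverse_opnorm TS) => h.
have h2 : N (S x) <= eta^-1 * N x.
  by apply: (opnorm_leP (bounded_linear_on TS.1) _).1 => //; rewrite invr_ge0 ltW.
by rewrite mulrC -ler_pdivlMr// mulrC.
Qed.

Lemma spec_epsP eps T lam : 0 < eps ->
  spec_eps D N eps T lam <-> ~ inv_bounded eps (subscalar T lam).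
Proof.
move=> eps0; rewrite inv_boundedP// /spec_eps /=.
have i0 := inv_opnorm_ge0 (subscalar T lam).
have e0 : (0 <= eps^-1%:E)%E by rewrite lee_fin invr_ge0 ltW.
have -> : eps%:E = ((eps^-1)%:E^-1)%E :> \bar R.
  by rewrite inver invr_eq0 gt_eqF// invrK.
rewrite lte_pV2 ?inE// ltNge.
by split=> /negP.
Qed.

(** Treats all eps >= 0 alike: at eps = 0, a bounded inverse is already an [inv_bounded] one at some
    positive level. *)
Lemma Spec_epsP eps T lam : 0 <= eps ->
  Spec_eps D N eps T lam <->
  forall eps', eps < eps' -> ~ inv_bounded eps' (subscalar T lam).
Proof.
move=> eps0; rewrite /Spec_eps; have [->|en0] := eqVneq eps 0.
  split=> [h e' e'0 [S [TS _]]|h [S TS]]; first by apply: h; exists S.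
  have [_ _ Sfin] := TS.1.
  have Sp : opnorm D N S \is a fin_num.
    by rewrite ge0_fin_numE// opnorm_ge0.
  set c := fine (opnorm D N S).
  have c0 : 0 <= c by rewrite fine_ge0// opnorm_ge0.
  have hc : forall x, D x -> N (S x) <= c * N x.
    apply: (opnorm_leP (bounded_linear_on TS.1) c0).1.
    by rewrite /c fineK.
  (* The bound is enlarged to c + 1 because c = 0 when D is trivial. *)
  have c1 : 0 < c + 1 by rewrite ltr_wpDl.
  apply: (h (c + 1)^-1); first by rewrite invr_gt0.
  exists S; split=> // x Dx; rewrite mulrC ler_pdivrMr//.
  apply: le_trans (hc _ Dx) _; rewrite mulrC ler_wpM2l//.
  by rewrite lerDl.
have ep : 0 < eps by rewrite lt_neqAle eq_sym en0.
split=> [/= h e' ee'|h /=].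
  apply/spec_epsP; first exact: lt_trans ee'.
  by apply: le_lt_trans h _; rewrite lte_fin.
apply/lee_addgt0Pr => e e0.
have /(h _)/spec_epsP : eps < eps + e by rewrite ltrDl.
by rewrite addr_gt0// => /(_ isT)/ltW.
Qed.

Lemma inv_bounded_lower eta T : (forall x, D x -> D (T x)) -> inv_bounded eta T ->
  forall x, D x -> eta * N x <= N (T x).
Proof.
move=> TD [S [TS hS]] x Dx; have := hS _ (TD _ Dx).
by rewrite (TS.2 _ Dx).1.
Qed.

Lemma lower_inv_bounded eta T : 0 < eta -> linear_on T ->
  (forall x, D x -> eta * N x <= N (T x)) ->
  (forall f, D f -> exists2 u, D u & T u = f) -> inv_bounded eta T.
Proof.
move=> eta0 HT low surj.
have inj x y : D x -> D y -> T x = T y -> x = y.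
  move=> Dx Dy e; apply/eqP; rewrite -subr_eq0; apply/eqP.
  apply: N_eq0; first exact: DB.
  apply/eqP; rewrite eq_le N_ge0 andbT -(pmulr_rle0 _ eta0).
  by apply: le_trans (low _ (DB Dx Dy)) _; rewrite linear_onB// e subrr N0.
pose S f := xget 0 [set u | D u /\ T u = f].
have SP f : D f -> D (S f) /\ T (S f) = f.
  move=> Df; have [u Du Tu] := surj _ Df.
  by apply: (@xgetPex _ 0 [set u | D u /\ T u = f]); exists u.
have hS x : D x -> eta * N (S x) <= N x.
  by move=> Dx; have [DS TS] := SP _ Dx; rewrite -{2}TS low.
have SL : linear_on S.
  split=> [x /SP[]//|c x y Dx Dy].
  have [[DSx TSx] [DSy TSy]] := (SP _ Dx, SP _ Dy).
  apply: inj; [by have [] := SP _ (DL c Dx Dy)|exact: DL|].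
  by rewrite HT.2// TSx TSy; have [] := SP _ (DL c Dx Dy).
exists S; split=> //; split.
  split; [exact: SL.1|exact: SL.2|].
  apply: (@le_lt_trans _ _ (eta^-1)%:E); last by rewrite ltry.
  apply/opnorm_leP => //; first by rewrite invr_ge0 ltW.
  by move=> x Dx; rewrite mulrC ler_pdivlMr// mulrC hS.
move=> x Dx; split; last by have [] := SP _ Dx.
by apply: inj => //; have [] := SP _ (HT.1 _ Dx).
Qed.

Lemma lower_bound_shift eta delta T lam mu :
  linear_on T -> cabs (lam - mu) <= delta ->
  (forall x, D x -> eta * N x <= N (subscalar T lam x)) ->
  forall x, D x -> (eta - delta) * N x <= N (subscalar T mu x).
Proof.
move=> HT lm h x Dx.
have DTm := (linear_on_subscalar mu HT).1 _ Dx.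
have e : subscalar T lam x = subscalar T mu x + (mu - lam) *: x.
  by rewrite /subscalar scalerBl addrA subrK.
rewrite mulrBl lerBlDr; apply: le_trans (h _ Dx) _; rewrite e.
apply: le_trans (ND DTm (DZ _ Dx)) _; rewrite lerD2l NZ// cabs_distC.
by rewrite ler_wpM2r.
Qed.

(** u, v, w are successive images under the resolvent at lam, so the vector is a truncated Neumann
    series for lam + h: the intermediate terms telescope and only h^3 w is left over. *)
Lemma cubic_expansion T lam h u v w : linear_on T -> D u -> D v -> D w ->
  subscalar T lam v = u -> subscalar T lam w = v ->
  subscalar T (lam + h) (u + h *: v + h ^+ 2 *: w) =
  subscalar T lam u - h ^+ 3 *: w.
Proof.
move=> HT Du Dv Dw ev ew.
have HS := linear_on_subscalar lam HT.
have -> y : subscalar T (lam + h) y = subscalar T lam y - h *: y.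
  by rewrite /subscalar scalerDl opprD addrA.
have -> : subscalar T lam (u + h *: v + h ^+ 2 *: w) =
    subscalar T lam u + h *: u + h ^+ 2 *: v.
  rewrite (linear_onD HS (DA Du (DZ h Dv)) (DZ _ Dw)).
  by rewrite (linear_onD HS Du (DZ h Dv)) !(linear_onZ _ HS)// ev ew.
rewrite !scalerDr !scalerA -expr2 -exprS !opprD !addrA.
by rewrite [_ + _ - h *: u]addrAC addrK addrK.
Qed.

(* Averaging over the four directions h = +-r, +-ir isolates the quadratic term
   of the resolvent expansion, so that the resolvent norm cannot be locally
   constant. *)
Lemma inv_bounded_improve (eta r M : R) : 0 < eta -> 0 < r -> 0 < M ->
  exists eta', eta < eta' /\ forall T lam, linear_on T ->
    (forall x, D x -> N (subscalar T lam x) <= M * N x) ->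
    (forall mu, cabs (lam - mu) <= r -> inv_bounded eta (subscalar T mu)) ->
    inv_bounded eta' (subscalar T lam).
Proof.
move=> eta0 r0 M0.
(* rho <= r keeps lam + h in the disc, rho <= M gives s <= 1, and the third bound makes the cubic
   error rho^3 / eta^2 smaller than the gain eta s^2 / 3. *)
pose rho := Num.min r (Num.min M (eta ^+ 3 / (6 * M ^+ 2))).
have p0 : 0 < eta ^+ 3 / (6 * M ^+ 2).
  by rewrite divr_gt0 ?exprn_gt0// mulr_gt0 ?exprn_gt0.
have rho0 : 0 < rho by rewrite !lt_min r0 M0.
have rhor : rho <= r by rewrite ge_min lexx.
have rhoM : rho <= M by rewrite !ge_min lexx !orbT.
have rhop : rho <= eta ^+ 3 / (6 * M ^+ 2) by rewrite !ge_min lexx !orbT.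
pose s := rho / M.
have s0 : 0 < s by rewrite divr_gt0.
have s1 : s <= 1 by rewrite ler_pdivrMr// mul1r.
(* The factor 1/3 is small enough for c^2 <= 1 + s^2 when s <= 1. *)
pose c := 1 + s ^+ 2 / 3.
exists (eta * c - rho ^+ 3 / eta ^+ 2); split.
  rewrite /c mulrDr mulr1 -addrA ltrDl subr_gt0 ltr_pdivrMr ?exprn_gt0//.
  apply: (@le_lt_trans _ _ (rho ^+ 2 * (eta ^+ 3 / (6 * M ^+ 2)))).
    by rewrite exprSr ler_wpM2l// sqr_ge0.
  have -> : eta * (s ^+ 2 / 3) * eta ^+ 2 =
      2 * (rho ^+ 2 * (eta ^+ 3 / (6 * M ^+ 2))).
    by rewrite /s; field; rewrite gt_eqF.
  by rewrite ltr_pMl ?ltr1n// mulr_gt0// exprn_gt0.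
move=> T lam HT hM hgood.
have HS := linear_on_subscalar lam HT.
have [S [TS hS]] : inv_bounded eta (subscalar T lam).
  by apply: hgood; rewrite subrr cabs0 ltW.
have SL := bounded_linear_on TS.1.
suff low u : D u ->
    (eta * c - rho ^+ 3 / eta ^+ 2) * N u <= N (subscalar T lam u).
  exists S; split=> // x Dx.
  by have := low _ (SL.1 _ Dx); rewrite (TS.2 _ Dx).2.
move=> Du; set v := S u; set w := S v; set x := subscalar T lam u.
have Dv : D v by exact: SL.1.
have Dw : D w by exact: SL.1.
have Dx : D x by exact: HS.1.
have ev : subscalar T lam v = u by rewrite (TS.2 _ _).2.
have ew : subscalar T lam w = v by rewrite (TS.2 _ _).2.
have nv : eta * N v <= N u by exact: hS.
have nw : eta * N w <= N v by exact: hS.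
have nu : N u <= M * N v by rewrite -{1}ev hM.
pose B := N x + rho ^+ 3 / eta ^+ 2 * N u.
have B0 : 0 <= B by rewrite addr_ge0// mulr_ge0// divr_ge0 ?exprn_ge0// ltW.
have nwu : N w <= N u / eta ^+ 2.
  rewrite ler_pdivlMr ?exprn_gt0// mulrC expr2 -mulrA.
  by apply: le_trans nv; rewrite ler_wpM2l// ltW.
have key (h : C) : cabs h = rho ->
    (eta * N (u + h *: v + h ^+ 2 *: w)) ^+ 2 <= B ^+ 2.
  move=> hr.
  have Dy : D (u + h *: v + h ^+ 2 *: w).
    by apply: DA; [apply: DA => //; exact: DZ|exact: DZ].
  rewrite ler_sqr ?nnegrE//; last by rewrite mulr_ge0// ltW.
  have HTm := linear_on_subscalar (lam + h) HT.
  have : inv_bounded eta (subscalar T (lam + h)).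
    by apply: hgood; rewrite opprD addNKr cabsN hr.
  move=> /(inv_bounded_lower HTm.1)/(_ _ Dy)/le_trans; apply.
  rewrite cubic_expansion// -/x; apply: le_trans (ND Dx _) _.
    by rewrite -scaleNr; exact: DZ.
  rewrite lerD2l NN; last exact: DZ.
  rewrite NZ// cabsX hr -mulrA ler_wpM2l ?exprn_ge0//; last by rewrite mulrC.
  exact: ltW.
have ci : cabs ('i : C) = 1.
  apply/eqP; rewrite -(@eqrXn2 _ 2) ?cabs_ge0// expr1n -cabsX sqrCi cabsN cabs1.
  by [].
have arho : cabs (ofR rho) = rho by rewrite cabs_ofR gtr0_norm.
pose a1 := u + ofR rho ^+ 2 *: w; pose a2 := u - ofR rho ^+ 2 *: w.
have Da1 : D a1 by apply: DA => //; exact: DZ.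
have Da2 : D a2 by apply: DB => //; exact: DZ.
(* By three parallelogram identities the squared norms in the four directions add up to 4 (N u^2 +
   rho^2 N v^2 + rho^4 N w^2). As (i rho)^2 = - rho^2, the imaginary directions go with a2. *)
have := NP Da1 (DZ (ofR rho) Dv); have := NP Da2 (DZ ('i * ofR rho) Dv).
have := NP Du (DZ (ofR rho ^+ 2) Dw); rewrite -/a1 -/a2.
have := key (ofR rho) arho; have := key (- ofR rho).
rewrite cabsN => /(_ arho).
have := key ('i * ofR rho); rewrite cabsM ci mul1r => /(_ arho).
have := key (- ('i * ofR rho)); rewrite cabsN cabsM ci mul1r => /(_ arho).
rewrite !sqrrN [('i * _) ^+ 2]exprMn sqrCi mulN1r.
rewrite (_ : u + - ('i * ofR rho) *: v + - ofR rho ^+ 2 *: w =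
   a2 - ('i * ofR rho) *: v); last by rewrite /a2 !scaleNr addrAC.
rewrite (_ : u + ('i * ofR rho) *: v + - ofR rho ^+ 2 *: w =
   a2 + ('i * ofR rho) *: v); last by rewrite /a2 !scaleNr addrAC.
rewrite (_ : u + - ofR rho *: v + ofR rho ^+ 2 *: w =
   a1 - ofR rho *: v); last by rewrite /a1 !scaleNr addrAC.
rewrite (_ : u + ofR rho *: v + ofR rho ^+ 2 *: w =
   a1 + ofR rho *: v); last by rewrite /a1 addrAC.
rewrite !NZ// cabsX cabsM ci mul1r arho.
rewrite !exprMn => k1 k2 k3 k4 e1 e2 e3.
(* N u <= M N v turns the middle term into a gain proportional to N u^2. *)
have nu2 : N u ^+ 2 * s ^+ 2 <= rho ^+ 2 * N v ^+ 2.
  have h1 : N u * s <= rho * N v.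
    have -> : N u * s = rho * N u / M by rewrite /s; ring.
    by rewrite ler_pdivrMr// -mulrA ler_pM2l// [N v * M]mulrC.
  have h0 : 0 <= N u * s by rewrite mulr_ge0//; exact: ltW.
  by rewrite -!exprMn ler_sqr ?nnegrE//; exact: le_trans h1.
suff : (eta * c * N u) ^+ 2 <= B ^+ 2.
  rewrite ler_sqr ?nnegrE//; last first.
    have c0 : 0 <= c by rewrite /c addr_ge0// divr_ge0// sqr_ge0.
    by apply: mulr_ge0 => //; apply: mulr_ge0 => //; exact: ltW.
  by rewrite mulrBl lerBlDr.
have cc : c ^+ 2 <= 1 + s ^+ 2.
  have : s ^+ 2 <= 1 by rewrite expr_le1//; exact: ltW.
  by rewrite /c; have := sqr_ge0 s; nra.
have e2p : 0 <= eta ^+ 2 by exact: sqr_ge0.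
have step : 4 * (eta ^+ 2 * (N u ^+ 2 * (1 + s ^+ 2))) <= 4 * B ^+ 2.
  have w0 : 0 <= (rho ^+ 2) ^+ 2 * N w ^+ 2 by rewrite mulr_ge0 ?sqr_ge0.
  have tot : N (a1 + ofR rho *: v) ^+ 2 + N (a1 - ofR rho *: v) ^+ 2 +
    (N (a2 + ('i * ofR rho) *: v) ^+ 2 + N (a2 - ('i * ofR rho) *: v) ^+ 2) >=
    4 * (N u ^+ 2 * (1 + s ^+ 2)) by lra.
  have := ler_wpM2l e2p tot; lra.
have last_step : eta ^+ 2 * (N u ^+ 2 * c ^+ 2) <=
    eta ^+ 2 * (N u ^+ 2 * (1 + s ^+ 2)).
  by apply: ler_wpM2l => //; apply: ler_wpM2l => //; exact: sqr_ge0.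
by rewrite 2!exprMn; lra.
Qed.

End AbstractResolvent.

(** * Tridiagonal operators on square summable sequences *)

Section SquareSummable.
Variable R : realType.
Local Notation C := (Cplx R).
Implicit Types x y z : int -> C.

Definition nsq x (i : int) : R := cabs (x i) ^+ 2.
Definition qnorm x : R := fine (sumsq x).

Lemma nsq_ge0 x i : 0 <= nsq x i. Proof. exact: sqr_ge0. Qed.
#[local] Hint Resolve nsq_ge0 : core.

Lemma sumsq_ge0 x : (0 <= sumsq x)%E.
Proof. exact: (@zsum_ge0 R (nsq x) (nsq_ge0 x)). Qed.

Lemma sumsqE x : ell2 x -> sumsq x = (qnorm x)%:E.
Proof. by move=> Dx; rewrite fineK// ge0_fin_numE// sumsq_ge0. Qed.

Lemma qnorm_ge0 x : 0 <= qnorm x.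
Proof. by rewrite fine_ge0// sumsq_ge0. Qed.

Lemma zsum_nsq x : ell2 x -> zsum (nsq x) = (qnorm x)%:E.
Proof. exact: sumsqE. Qed.

Lemma ell2_le_qnorm z (B : R) : (zsum (nsq z) <= B%:E)%E ->
  ell2 z /\ qnorm z <= B.
Proof.
move=> h; have Dz : ell2 z by exact: le_lt_trans h (ltry _).
by split=> //; rewrite -lee_fin -sumsqE.
Qed.

Lemma qnorm_comb2 z x y (a b : R) : ell2 x -> ell2 y -> 0 <= a -> 0 <= b ->
  (forall i, nsq z i <= a * nsq x i + b * nsq y i) ->
  ell2 z /\ qnorm z <= a * qnorm x + b * qnorm y.
Proof.
move=> Dx Dy a0 b0 h; apply: ell2_le_qnorm; apply: le_trans (le_zsum h) _.
rewrite zsumD; [|by move=> i; rewrite mulr_ge0..].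
by rewrite !zsumZ// !zsum_nsq// -!EFinM -EFinD.
Qed.

Lemma qnorm_le z x (a : R) : ell2 x -> 0 <= a ->
  (forall i, nsq z i <= a * nsq x i) -> ell2 z /\ qnorm z <= a * qnorm x.
Proof.
move=> Dx a0 h; have := @qnorm_comb2 z x x a 0 Dx Dx a0 (lexx 0).
by rewrite mul0r addr0; apply => i; rewrite mul0r addr0.
Qed.

Lemma ell2_0 : ell2 (0 : int -> C).
Proof.
rewrite /ell2/= /sumsq (_ : esum _ _ = 0%E) ?ltry//.
apply: esum1 => i _; have -> : cabs ((0 : int -> C) i) = 0 by exact: cabs0.
by rewrite expr0n.
Qed.

Lemma ell2_lin (c : C) x y : ell2 x -> ell2 y -> ell2 (c *: x + y).
Proof.
move=> Dx Dy.
apply: (@qnorm_comb2 _ x y (2 * cabs c ^+ 2) 2 Dx Dy _ _ _).1 => //.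
  by rewrite mulr_ge0// sqr_ge0.
move=> i; have := @sqrD_weighted R (cabs (c * x i)) (cabs (y i)) 1 1 ltr01 ltr01.
rewrite !divr1 cabsM exprMn -/(nsq x i) -/(nsq y i) => h.
have h2 : nsq (c *: x + y) i <= (cabs c * cabs (x i) + cabs (y i)) ^+ 2.
  rewrite /nsq ler_sqr ?nnegrE ?cabs_ge0 ?addr_ge0 ?mulr_ge0 ?cabs_ge0//.
  by rewrite -cabsM; exact: cabsD.
by apply: le_trans h2 _; apply: le_trans h _; rewrite /nsq; lra.
Qed.

Lemma l2norm_sqr x : l2norm x ^+ 2 = qnorm x.
Proof. by rewrite /l2norm sqr_sqrtr// qnorm_ge0. Qed.

Lemma l2norm_ge0 x : 0 <= l2norm x. Proof. exact: sqrtr_ge0. Qed.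

Lemma l2norm_le x (c : R) : 0 <= c -> qnorm x <= c ^+ 2 -> l2norm x <= c.
Proof.
by move=> c0; rewrite -l2norm_sqr ler_sqr ?nnegrE ?l2norm_ge0.
Qed.

Lemma nsq_le_qnorm x i : ell2 x -> nsq x i <= qnorm x.
Proof. by move=> Dx; rewrite -lee_fin -zsum_nsq//; exact: ge_zsum. Qed.

Lemma cabs_le_l2norm x i : ell2 x -> cabs (x i) <= l2norm x.
Proof.
move=> Dx; rewrite -[leLHS]ger0_norm ?cabs_ge0// -sqrtr_sqr.
by rewrite /l2norm ler_wsqrtr// nsq_le_qnorm.
Qed.

Lemma qnormD_weighted x y (p r : R) : ell2 x -> ell2 y -> 0 < p -> 0 < r ->
  qnorm (x + y) <= (p + r) * (qnorm x / p + qnorm y / r).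
Proof.
move=> Dx Dy p0 r0; have pr := addr_gt0 p0 r0.
rewrite mulrDr ![_ * (qnorm _ / _)]mulrCA ![qnorm _ * _]mulrC.
apply: (@qnorm_comb2 (x + y) x y _ _ Dx Dy _ _ _).2.
- by rewrite divr_ge0// ltW.
- by rewrite divr_ge0// ltW.
move=> i; apply: (@le_trans _ _ ((cabs (x i) + cabs (y i)) ^+ 2)).
  by rewrite /nsq ler_sqr ?nnegrE ?cabs_ge0 ?addr_ge0 ?cabs_ge0//; exact: cabsD.
apply: le_trans (sqrD_weighted _ _ p0 r0) _.
by rewrite le_eqVlt; apply/orP; left; apply/eqP; rewrite /nsq; ring.
Qed.

Lemma l2normD x y : ell2 x -> ell2 y -> l2norm (x + y) <= l2norm x + l2norm y.
Proof.
move=> Dx Dy; apply/ler_addgt0Pr => e e0.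
have [nx ny] := (l2norm_ge0 x, l2norm_ge0 y).
have e2 : 0 < e / 2 by rewrite divr_gt0.
set p := l2norm x + e / 2; set r := l2norm y + e / 2.
have p0 : 0 < p by rewrite ltr_wpDl.
have r0 : 0 < r by rewrite ltr_wpDl.
have -> : l2norm x + l2norm y + e = p + r by rewrite /p /r; lra.
apply: l2norm_le; first by rewrite addr_ge0// ltW.
apply: le_trans (qnormD_weighted Dx Dy p0 r0) _.
have part (v s : R) : 0 <= v -> v <= s -> 0 < s -> v ^+ 2 / s <= s.
  by move=> v0 vs s0; rewrite ler_pdivrMr// -expr2 ler_sqr ?nnegrE// ltW.
rewrite expr2; apply: ler_wpM2l; first by rewrite ltW// addr_gt0.
rewrite -!l2norm_sqr; apply: lerD; apply: part => //.
  by rewrite lerDl ltW.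
by rewrite lerDl ltW.
Qed.

Lemma qnormZ (c : C) x : ell2 x -> qnorm (c *: x) = cabs c ^+ 2 * qnorm x.
Proof.
move=> Dx; apply: EFin_inj.
have Dcx : ell2 (c *: x).
  by have := ell2_lin c Dx ell2_0; rewrite addr0.
rewrite EFinM -!zsum_nsq// -zsumZ ?sqr_ge0//.
by apply: eq_zsum => i; rewrite /nsq cabsM exprMn.
Qed.

Lemma hilbertian_ell2 : hilbertian (@ell2 R) (@l2norm R).
Proof.
have DD x y : ell2 x -> ell2 y -> ell2 (x + y).
  by move=> Dx Dy; have := ell2_lin 1 Dx Dy; rewrite scale1r.
have DB x y : ell2 x -> ell2 y -> ell2 (x - y).
  by move=> Dx Dy; have := ell2_lin (-1) Dy Dx; rewrite scaleN1r addrC.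
split; [split; [exact: ell2_0|exact: ell2_lin]|exact: l2norm_ge0| | |].
- split=> [c x Dx|x Dx e].
    by rewrite /l2norm -/(qnorm _) qnormZ// sqrtrM ?sqr_ge0// sqrtr_sqr
      ger0_norm// cabs_ge0.
  have q0 : qnorm x = 0 by rewrite -l2norm_sqr e expr0n.
  apply/funext => i; apply/eqP; rewrite -cabs_eq0 -[_ == 0](@expf_eq0 _ _ 2).
  by rewrite eq_le sqr_ge0 andbT -[leRHS]q0; exact: nsq_le_qnorm.
- exact: l2normD.
- move=> x y Dx Dy; rewrite !l2norm_sqr; apply: EFin_inj.
  rewrite !EFinD !EFinM -!zsum_nsq//; [|exact: DB|exact: DD].
  rewrite -zsumD// -!zsumZ// -zsumD//; [|by move=> i; rewrite mulr_ge0//..].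
  by apply: eq_zsum => i; exact: cabs_parallelogram.
Qed.

Definition cutto (W : int -> bool) x : int -> C := fun i => if W i then x i else 0.

Lemma nsq_cutto W x i : nsq (cutto W x) i = if W i then nsq x i else 0.
Proof. by rewrite /nsq /cutto; case: ifP => // _; rewrite cabs0 expr0n. Qed.

Lemma qnorm_cutto W x : ell2 x -> ell2 (cutto W x) /\ qnorm (cutto W x) <= qnorm x.
Proof.
move=> Dx; have := @qnorm_le (cutto W x) x 1 Dx ler01; rewrite mul1r; apply => i.
by rewrite mul1r nsq_cutto; case: ifP.
Qed.

Lemma ssum_le_qnorm N x : ell2 x -> ssum N (nsq x) <= qnorm x.
Proof. by move=> Dx; rewrite -lee_fin -zsum_nsq// ssum_le_zsum. Qed.

Lemma qnorm_le_ssum x (B : R) : (forall N, ssum N (nsq x) <= B) ->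
  ell2 x /\ qnorm x <= B.
Proof.
by move=> h; apply: ell2_le_qnorm; apply: zsum_le_ssum => // N; rewrite lee_fin.
Qed.

Lemma qnorm_finsupp N x : (forall i, (N < `|i|)%N -> x i = 0) ->
  ell2 x /\ qnorm x = ssum N (nsq x).
Proof.
move=> xN; have e : zsum (nsq x) = (ssum N (nsq x))%:E.
  by apply: zsum_ssum => // i /xN; rewrite /nsq => ->; rewrite cabs0 expr0n.
have Dx : ell2 x by rewrite /ell2/= /sumsq -/(nsq x) -/(zsum _) e ltry.
by split=> //; apply: EFin_inj; rewrite -e zsum_nsq.
Qed.

Lemma qnorm_shift (c : int) x : qnorm (fun i => x (i + c)) = qnorm x.
Proof. by rewrite /qnorm; congr fine; exact: (zsum_shift c (nsq x)). Qed.

Lemma ell2_shift (c : int) x : ell2 (fun i => x (i + c)) <-> ell2 x.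
Proof.
by rewrite /ell2/= (_ : sumsq _ = sumsq x)//; exact: (zsum_shift c (nsq x)).
Qed.

Lemma qnorm_reflect (c : int) x : qnorm (fun i => x (c - i)) = qnorm x.
Proof. by rewrite /qnorm; congr fine; exact: (zsum_reflect c (nsq x)). Qed.

Lemma ell2_reflect (c : int) x : ell2 (fun i => x (c - i)) <-> ell2 x.
Proof.
by rewrite /ell2/= (_ : sumsq _ = sumsq x)//; exact: (zsum_reflect c (nsq x)).
Qed.

End SquareSummable.
#[export] Hint Resolve nsq_ge0 : core.

Lemma conjC_D (F : numClosedFieldType) (a b : F) : (a + b)^* = a^* + b^*.
Proof. exact: rmorphD. Qed.

Lemma conjC_M (F : numClosedFieldType) (a b : F) : (a * b)^* = a^* * b^*.
Proof. exact: rmorphM. Qed.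

Section TridiagonalOperators.
Variable R : realType.
Local Notation C := (Cplx R).
Implicit Types (x y z : int -> C) (m : int -> int -> C).

Definition band_bound (K : R) m : Prop := forall i,
  [/\ cabs (m i (i - 1)) <= K, cabs (m i i) <= K & cabs (m i (i + 1)) <= K].

Lemma band_bound_ge0 K m : band_bound K m -> 0 <= K.
Proof. by move=> /(_ 0)[_ h _]; apply: le_trans h; exact: cabs_ge0. Qed.

Lemma subscalar_triop m (lam : C) :
  subscalar (triop m) lam = triop (shiftmat m lam).
Proof.
apply/funext => x; apply/funext => i.
rewrite /subscalar /triop /shiftmat eqxx.
have /negbTE -> : i != i - 1 by lia.
have /negbTE -> : i != i + 1 by lia.
rewrite !subr0.
change (m i (i - 1) * x (i - 1) + m i i * x i + m i (i + 1) * x (i + 1)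
  - lam * x i = m i (i - 1) * x (i - 1) + (m i i - lam) * x i
  + m i (i + 1) * x (i + 1)).
by ring.
Qed.

Lemma band_bound_shift K m (lam : C) : band_bound K m ->
  band_bound (K + cabs lam) (shiftmat m lam).
Proof.
move=> hm i; have [h1 h2 h3] := hm i; rewrite /shiftmat eqxx.
have /negbTE -> : i != i - 1 by lia.
have /negbTE -> : i != i + 1 by lia.
rewrite !subr0; have l0 := cabs_ge0 lam; split; [lra| |lra].
by apply: le_trans (cabsB _ _) _; rewrite lerD2r.
Qed.

Lemma transp_shiftmat m lam : transp (shiftmat m lam) = shiftmat (transp m) lam.
Proof.
apply/funext => i; apply/funext => j; rewrite /transp /shiftmat.
by rewrite eq_sym; case: eqP.
Qed.

Lemma band_bound_transp K m : band_bound K m -> band_bound K (transp m).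
Proof.
move=> hm i; rewrite /transp.
have [_ h2 _] := hm i; have [h1 _ _] := hm (i + 1); have [_ _ h3] := hm (i - 1).
by split=> //; [move: h3; rewrite subrK|move: h1; rewrite addrK].
Qed.

Lemma triop_lin m (c : C) x y : triop m (c *: x + y) = c *: triop m x + triop m y.
Proof.
apply/funext => i; rewrite /triop.
change (m i (i - 1) * (c * x (i - 1) + y (i - 1)) + m i i * (c * x i + y i)
  + m i (i + 1) * (c * x (i + 1) + y (i + 1)) =
  c * (m i (i - 1) * x (i - 1) + m i i * x i + m i (i + 1) * x (i + 1))
  + (m i (i - 1) * y (i - 1) + m i i * y i + m i (i + 1) * y (i + 1))).
by ring.
Qed.

Lemma nsq_triop K m x i : band_bound K m ->
  nsq (triop m x) i <= 3 * K ^+ 2 * (nsq x (i - 1) + nsq x i + nsq x (i + 1)).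
Proof.
move=> hm; have K0 := band_bound_ge0 hm; have [h1 h2 h3] := hm i.
have b : cabs (triop m x i) <=
    K * cabs (x (i - 1)) + K * cabs (x i) + K * cabs (x (i + 1)).
  apply: le_trans (cabsD _ _) _; apply: lerD.
    by apply: le_trans (cabsD _ _) _; apply: lerD; rewrite cabsM ler_wpM2r ?cabs_ge0.
  by rewrite cabsM ler_wpM2r ?cabs_ge0.
apply: (@le_trans _ _ ((K * cabs (x (i - 1)) + K * cabs (x i) + K * cabs (x (i + 1))) ^+ 2)).
  by rewrite /nsq ler_sqr ?nnegrE ?cabs_ge0 ?addr_ge0 ?mulr_ge0 ?cabs_ge0.
rewrite /nsq; move: (cabs _) (cabs _) (cabs _) => u v w.
have := mulr_ge0 (sqr_ge0 K) (addr_ge0 (sqr_ge0 (u - v))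
  (addr_ge0 (sqr_ge0 (u - w)) (sqr_ge0 (v - w)))).
by lra.
Qed.

Lemma triop_qnorm K m x : band_bound K m -> ell2 x ->
  ell2 (triop m x) /\ qnorm (triop m x) <= (3 * K) ^+ 2 * qnorm x.
Proof.
move=> hm Dx; apply: ell2_le_qnorm.
apply: le_trans (le_zsum (fun i => nsq_triop x i hm)) _.
have c0 : 0 <= 3 * K ^+ 2 by rewrite mulr_ge0// sqr_ge0.
rewrite zsumZ//; last by move=> i; rewrite !addr_ge0 ?nsq_ge0.
rewrite zsumD; [|by move=> i; rewrite addr_ge0 ?nsq_ge0|by move=> i; exact: nsq_ge0].
rewrite zsumD; [|by move=> i; exact: nsq_ge0..].
rewrite !(zsum_shift _ (nsq x)) zsum_nsq//.
by rewrite -!EFinD -EFinM lee_fin; lra.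
Qed.

Lemma triop_l2norm K m x : band_bound K m -> ell2 x ->
  l2norm (triop m x) <= 3 * K * l2norm x.
Proof.
move=> hm Dx; have K0 := band_bound_ge0 hm.
apply: l2norm_le; first by rewrite !mulr_ge0// l2norm_ge0.
by rewrite exprMn l2norm_sqr; exact: (triop_qnorm hm Dx).2.
Qed.

Lemma linear_on_triop K m : band_bound K m -> linear_on (@ell2 R) (triop m).
Proof.
move=> hm; split=> [x Dx|c x y _ _]; first exact: (triop_qnorm hm Dx).1.
exact: triop_lin.
Qed.

Lemma l2norm_conj x : l2norm (fun i => (x i)^*) = l2norm x.
Proof.
rewrite /l2norm -/(qnorm _) /qnorm; congr (Num.sqrt (fine _)).
by apply: eq_zsum => i /=; rewrite cabs_conj.
Qed.

Lemma ell2_conj x : ell2 x -> ell2 (fun i => (x i)^*).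
Proof.
by rewrite /ell2/= (_ : sumsq (fun i => (x i)^*) = sumsq x)//;
   apply: eq_zsum => i /=; rewrite cabs_conj.
Qed.

Definition adj m : int -> int -> C := fun i j => (m j i)^*.

Lemma band_bound_adj K m : band_bound K m -> band_bound K (adj m).
Proof.
by move=> /band_bound_transp hm i; rewrite /adj !cabs_conj; exact: hm.
Qed.

Lemma triop_adj m x i :
  triop (adj m) x i = (triop (transp m) (fun i => (x i)^*) i)^*.
Proof. by rewrite /triop /adj /transp !(conjC_D, conjC_M) !conjCK. Qed.

(** The real inner product of the plane. Summed over the sites it is the real part of the l^2 inner
    product, which is all that expanding a squared norm involves. *)
Definition ip (a b : C) : R := complex.Re (a * b^*).

Lemma ipDl a b c : ip (a + b) c = ip a c + ip b c.
Proof. by rewrite /ip mulrDl; case: (a * _) => ? ?; case: (b * _). Qed.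

Lemma ipDr a b c : ip c (a + b) = ip c a + ip c b.
Proof. by rewrite /ip conjC_D mulrDr; case: (_ * a^*) => ? ?; case: (_ * b^*). Qed.

Lemma ipMl (k a b : C) : ip (k * a) b = ip a (k^* * b).
Proof. by rewrite /ip conjC_M conjCK; congr complex.Re; ring. Qed.

Lemma ip0l a : ip 0 a = 0. Proof. by rewrite /ip mul0r. Qed.

Lemma ip0r a : ip a 0 = 0. Proof. by rewrite /ip conjC0 mulr0. Qed.

Lemma ipxx a : ip a a = cabs a ^+ 2.
Proof. by rewrite /ip mulconjE. Qed.

Lemma cabsB_ip (a b : C) (s : R) :
  cabs (a - ofR s * b) ^+ 2 = cabs a ^+ 2 - 2 * s * ip a b + s ^+ 2 * cabs b ^+ 2.
Proof.
have conjE (c d : R) : ((c +i* d)%C : C)^* = (c -i* d)%C by [].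
rewrite /ip; case: a => a1 a2; case: b => b1 b2; rewrite conjE !cabs_sqrE /=; ring.
Qed.

Lemma ssumD (N : nat) (f g : int -> R) :
  ssum N (fun i => f i + g i) = ssum N f + ssum N g.
Proof. by rewrite /ssum big_split. Qed.

Lemma ssumZ (N : nat) (c : R) (f : int -> R) :
  ssum N (fun i => c * f i) = c * ssum N f.
Proof. by rewrite /ssum mulr_sumr. Qed.

(** The diagonal terms agree site by site, the off-diagonal ones after a shift by one site, which is
    free of charge for finite supports. *)
Lemma adjoint_identity N m x z : (forall i, (N <= `|i|)%N -> x i = 0) ->
  (forall i, (N <= `|i|)%N -> z i = 0) ->
  ssum N (fun i => ip (triop m x i) (z i)) =
  ssum N (fun i => ip (x i) (triop (adj m) z i)).
Proof.
move=> xN zN.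
pose f1 i := ip (m i (i - 1) * x (i - 1)) (z i).
pose f2 i := ip (m i i * x i) (z i).
pose g3 i := ip (m (i - 1) i * x i) (z (i - 1)).
have -> : (fun i => ip (triop m x i) (z i)) =
    (fun i => (f1 i + f2 i) + g3 (i + 1)).
  by apply/funext => i; rewrite /triop !ipDl /f1 /f2 /g3 addrK.
have -> : (fun i => ip (x i) (triop (adj m) z i)) =
    (fun i => (f1 (i + 1) + f2 i) + g3 i).
  apply/funext => i; rewrite /triop !ipDr /adj -!ipMl /f1 /f2 /g3 addrK.
  by rewrite addrC addrA addrAC.
rewrite !ssumD (@ssum_shift _ N f1) ?(@ssum_shift _ N g3)//.
- by move=> i iN; rewrite /g3 xN// mulr0 ip0l.
- by move=> i iN; rewrite /f1 zN// ip0r.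
Qed.

Lemma triop_finsupp N m x : (forall i, (N <= `|i|)%N -> x i = 0) ->
  forall i, (N.+1 <= `|i|)%N -> triop m x i = 0.
Proof.
by move=> xN i iN; rewrite /triop !xN; [rewrite !mulr0 !addr0|lia|lia|lia].
Qed.

End TridiagonalOperators.

Lemma expr_small (R : realType) (tau e : R) : 0 <= tau -> tau < 1 -> 0 < e ->
  exists n, tau ^+ n < e.
Proof.
move=> t0 t1 e0; have : tau ^+ n @[n --> \oo] --> (0 : R).
  by apply: cvg_expr; rewrite ger0_norm.
move=> /cvgrPdist_lt/(_ _ e0)[n _ /(_ n)] /=.
rewrite leqnn sub0r normrN ger0_norm ?exprn_ge0// => /(_ isT) h.
by exists n.
Qed.

(* The limit is the supremum of the increasing sequence a n - G tau^n/(1-tau). *)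
Lemma geometric_limit (R : realType) (tau G : R) (a : nat -> R) :
  0 <= tau -> tau < 1 -> 0 <= G ->
  (forall n, `|a n.+1 - a n| <= G * tau ^+ n) ->
  exists l, forall n, `|a n - l| <= G * tau ^+ n / (1 - tau).
Proof.
move=> t0 t1 G0 h; have t1' : 0 < 1 - tau by rewrite subr_gt0.
pose d n := G * tau ^+ n / (1 - tau).
have d0 n : 0 <= d n by rewrite divr_ge0 ?(ltW t1')// mulr_ge0// exprn_ge0.
have dS n : d n - d n.+1 = G * tau ^+ n.
  by rewrite /d exprS; field; rewrite gt_eqF.
have up n k : a n - d n <= a (n + k)%N - d (n + k)%N.
  elim: k => [|k IH]; first by rewrite addn0.
  apply: le_trans IH _; rewrite addnS.
  by have := h (n + k)%N; rewrite -dS ler_norml => /andP[h1 _]; lra.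
have down n k : a (n + k)%N + d (n + k)%N <= a n + d n.
  elim: k => [|k IH]; first by rewrite addn0.
  apply: le_trans IH; rewrite addnS.
  by have := h (n + k)%N; rewrite -dS ler_norml => /andP[_ h1]; lra.
have cross n k : a n - d n <= a k + d k.
  apply: (@le_trans _ _ (a (n + k)%N - d (n + k)%N)); first exact: up.
  have := down k n; rewrite addnC => /(le_trans _); apply.
  by have := d0 (n + k)%N; lra.
pose S := [set a n - d n | n in [set: nat]].
have S0 : S !=set0 by exists (a 0 - d 0); exists 0.
have Sub : has_ubound S by exists (a 0%N + d 0%N) => _ [n _ <-].
exists (sup S) => n; rewrite -/(d n).
have h1 : a n - d n <= sup S by apply: ub_le_sup => //; exists n.
have h2 : sup S <= a n + d n by apply: ge_sup => // _ [k _ <-].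
by rewrite ler_norml; apply/andP; split; lra.
Qed.

Lemma cabs_le_reim (R : realType) (z : Cplx R) :
  cabs z <= `|complex.Re z| + `|complex.Im z|.
Proof.
rewrite -ler_sqr ?nnegrE ?cabs_ge0 ?addr_ge0//.
rewrite cabs_sqrE sqrrD !real_normK ?num_real//.
by rewrite addrAC lerDl mulrn_wge0// mulr_ge0.
Qed.

Lemma l2norm0 (R : realType) : l2norm (0 : int -> Cplx R) = 0.
Proof.
case: (hilbertian_ell2 R) => _ _ [hZ _] _ _; have := hZ 0 0 (ell2_0 R).
by rewrite scale0r cabs0 mul0r.
Qed.

(** * Surjectivity from lower bounds, by Richardson iteration on the normal equations *)

Section Surjectivity.
Variable R : realType.
Local Notation C := (Cplx R).
Implicit Types (x y z : int -> C) (m : int -> int -> C).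

Variables (m : int -> int -> C) (K eta : R).
Hypotheses (hm : band_bound K m) (K0 : 0 < K) (eta0 : 0 < eta).
Hypothesis etaM : eta <= 3 * K.
Hypothesis low : forall x, ell2 x -> eta * l2norm x <= l2norm (triop m x).
Hypothesis low_adj :
  forall x, ell2 x -> eta * l2norm x <= l2norm (triop (adj m) x).

Let hma := band_bound_adj hm.
Let M := 3 * K.
Let M0 : 0 < M. Proof. by rewrite mulr_gt0. Qed.
Let s := (M ^+ 2)^-1.
Let s0 : 0 < s. Proof. by rewrite invr_gt0 exprn_gt0. Qed.
(** The Richardson step I - s T^* T, with s = 1 / M^2 and M = 3 K a bound for the norm of T; [theta]
    is the factor by which it reduces the squared norm. *)
Let B y : int -> C := fun i => y i - ofR s * triop (adj m) (triop m y) i.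
Let theta := 1 - s * eta ^+ 2.
Let theta0 : 0 <= theta.
Proof.
rewrite /theta subr_ge0 mulrC ler_pdivrMr ?exprn_gt0// mul1r.
by rewrite ler_sqr ?nnegrE// ltW.
Qed.
Let theta1 : theta < 1.
Proof. by rewrite /theta ltrBlDr ltrDl mulr_gt0// exprn_gt0. Qed.

(** Expanding the square gives |y|^2 - 2 s |T y|^2 + s^2 |T^* T y|^2. The last term is at most s |T
    y|^2 by the choice of s, and |T y| >= eta |y|. *)
Lemma richardson_finsupp N y : (forall i, (N <= `|i|)%N -> y i = 0) ->
  qnorm (B y) <= theta * qnorm y.
Proof.
move=> yN.
have TN := @triop_finsupp R N m y yN.
have aTN := @triop_finsupp R N.+1 (adj m) _ TN.
have yN2 i : (N.+2 < `|i|)%N -> y i = 0 by move=> h; rewrite yN//; lia.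
have TN2 i : (N.+2 < `|i|)%N -> triop m y i = 0 by move=> h; rewrite TN//; lia.
have aTN2 i : (N.+2 < `|i|)%N -> triop (adj m) (triop m y) i = 0.
  by move=> h; rewrite aTN//; lia.
have BN i : (N.+2 < `|i|)%N -> B y i = 0.
  by move=> h; rewrite /B yN2// aTN2// mulr0 subr0.
have [Dy qy] := qnorm_finsupp yN2.
have [DT qT] := qnorm_finsupp TN2.
have [DaT qaT] := qnorm_finsupp aTN2.
have [_ ->] := qnorm_finsupp BN.
have -> : ssum N.+2 (nsq (B y)) =
    qnorm y - 2 * s * qnorm (triop m y) +
    s ^+ 2 * qnorm (triop (adj m) (triop m y)).
  rewrite qy qT qaT.
  have -> : ssum N.+2 (nsq (triop m y)) =
      ssum N.+2 (fun i => ip (y i) (triop (adj m) (triop m y) i)).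
    rewrite -(@adjoint_identity R N.+2 m y (triop m y)).
    - by apply: eq_bigr => i _; rewrite ipxx.
    - by move=> i h; rewrite yN//; lia.
    - by move=> i h; rewrite TN//; lia.
  rewrite -mulNr -!ssumZ -!ssumD; apply: eq_bigr => i _.
  by rewrite /nsq /B cabsB_ip; ring.
have h1 : qnorm (triop (adj m) (triop m y)) <= M ^+ 2 * qnorm (triop m y).
  exact: (triop_qnorm hma DT).2.
have h2 : eta ^+ 2 * qnorm y <= qnorm (triop m y).
  rewrite -!l2norm_sqr -exprMn ler_sqr ?nnegrE ?l2norm_ge0//; first exact: low.
  by rewrite mulr_ge0 ?l2norm_ge0// ltW.
have h3 : s ^+ 2 * qnorm (triop (adj m) (triop m y)) <= s * qnorm (triop m y).
  apply: le_trans (ler_wpM2l (sqr_ge0 s) h1) _.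
  by rewrite mulrA expr2 -(mulrA s) /s mulVf ?mulr1// gt_eqF// exprn_gt0.
have h4 := ler_wpM2l (ltW s0) h2.
by rewrite /theta; lra.
Qed.

Let DB y : ell2 y -> ell2 (B y).
Proof.
move=> Dy; have Da := (triop_qnorm hma (triop_qnorm hm Dy).1).1.
have -> : B y = - ofR s *: triop (adj m) (triop m y) + y.
  apply/funext => i.
  change (y i - ofR s * triop (adj m) (triop m y) i =
          - ofR s * triop (adj m) (triop m y) i + y i).
  by ring.
exact: ell2_lin.
Qed.

Lemma richardson_contraction y : ell2 y ->
  l2norm (B y) <= Num.sqrt theta * l2norm y.
Proof.
move=> Dy; apply: l2norm_le; first by rewrite mulr_ge0 ?sqrtr_ge0// l2norm_ge0.
rewrite exprMn sqr_sqrtr// l2norm_sqr; apply: (qnorm_le_ssum _).2 => N.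
(* Entries of B y with |i| <= N depend on y only up to distance 2, hence a cut that keeps |i| <= N +
   2. *)
pose W (i : int) := (`|i| < N.+3)%N.
have [Dc qc] := qnorm_cutto W Dy.
have -> : ssum N (nsq (B y)) = ssum N (nsq (B (cutto W y))).
  apply: eq_bigr => k _; rewrite /nsq; congr (cabs _ ^+ 2).
  have := ltn_ord k; set i := k%:Z - N%:Z => kN.
  have e j : (`|j - i| <= 2)%N -> cutto W y j = y j.
    by move=> hj; rewrite /cutto ifT// /W; lia.
  by rewrite /B /triop !e//; lia.
apply: le_trans (ssum_le_qnorm N (DB Dc)) _.
apply: (@le_trans _ _ (theta * qnorm (cutto W y))); last by rewrite ler_wpM2l.
apply: (@richardson_finsupp N.+3) => i iN.
by rewrite /cutto ifF// /W ltnNge iN.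
Qed.

Lemma B_linear (c : C) x y : B (c *: x + y) = c *: B x + B y.
Proof.
apply/funext => i; rewrite /B !triop_lin.
change (c * x i + y i - ofR s * (c * triop (adj m) (triop m x) i +
  triop (adj m) (triop m y) i) = c * (x i - ofR s * triop (adj m) (triop m x) i)
  + (y i - ofR s * triop (adj m) (triop m y) i)).
by ring.
Qed.

Lemma cabs_triop_le (m' : int -> int -> C) x i (d : R) : band_bound K m' ->
  (forall j, cabs (x j) <= d) -> cabs (triop m' x i) <= 3 * K * d.
Proof.
move=> hm' xd; have [h1 h2 h3] := hm' i.
have b a j : cabs a <= K -> cabs (a * x j) <= K * d.
  by move=> aK; rewrite cabsM; apply: ler_pM; rewrite ?cabs_ge0.
apply: le_trans (cabsD _ _) _.
have := cabsD (m' i (i - 1) * x (i - 1)) (m' i i * x i).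
have := b _ (i - 1) h1; have := b _ i h2; have := b _ (i + 1) h3.
by lra.
Qed.

(** A fixed point of u = B u + g makes the adjoint vanish at T u - f, and the lower bound for the
    adjoint then gives T u = f. The limit is taken entry by entry; the norm bound on the iterates
    puts it back into [ell2]. *)
Lemma triop_surjective f : ell2 f -> exists2 u, ell2 u & triop m u = f.
Proof.
move=> Df; pose tau := Num.sqrt theta.
have t0 : 0 <= tau by exact: sqrtr_ge0.
have t1 : tau < 1 by rewrite -sqrtr1 ltr_sqrt.
have t1' : 0 < 1 - tau by rewrite subr_gt0.
pose g : int -> C := ofR s *: triop (adj m) f.
have Dg : ell2 g.
  by have := ell2_lin (ofR s) (triop_qnorm hma Df).1 (ell2_0 R); rewrite addr0.
pose p := fix p (n : nat) : int -> C := if n is n'.+1 then B (p n') + g else 0.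
have HH := hilbertian_ell2 R.
have DD x y : ell2 x -> ell2 y -> ell2 (x + y).
  by move=> Dx Dy; have := ell2_lin 1 Dx Dy; rewrite scale1r.
have Dp n : ell2 (p n) by elim: n => [|n IH]; [exact: ell2_0|apply: DD => //; exact: DB].
pose G := l2norm g.
have G0 : 0 <= G by exact: l2norm_ge0.
have pn n : l2norm (p n) <= G / (1 - tau).
  elim: n => [|n IH].
    by rewrite [p 0%N]/(0) l2norm0 divr_ge0// ltW.
  apply: le_trans (l2normD (DB (Dp n)) Dg) _.
  apply: le_trans (lerD (richardson_contraction (Dp n)) (lexx _)) _.
  rewrite -/tau -/G; have h := ler_wpM2l t0 IH.
  have -> : G / (1 - tau) = tau * (G / (1 - tau)) + G by field; rewrite gt_eqF.
  by rewrite lerD2r.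
have BB (x y : int -> C) : B x - B y = B (x - y).
  have -> : x - y = -1 *: y + x by rewrite scaleN1r addrC.
  by rewrite B_linear scaleN1r addrC.
have tele (x y z : int -> C) : (x + z) - (y + z) = x - y.
  by rewrite opprD addrACA subrr addr0.
have dn n : p n.+1 - p n = iter n B g.
  elim: n => [|n IH].
    rewrite /= subr0 (_ : B 0 = 0) ?add0r//.
    by have := B_linear (-1) 0 0; rewrite scaler0 add0r scaleN1r addNr.
  have -> : p n.+2 - p n.+1 = (B (p n.+1) + g) - (B (p n) + g) by [].
  by rewrite tele BB IH.
have Ddn n : ell2 (iter n B g) /\ l2norm (iter n B g) <= G * tau ^+ n.
  elim: n => [|n [IH1 IH2]]; first by rewrite expr0 mulr1.
  split; first exact: DB.
  apply: le_trans (richardson_contraction IH1) _.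
  by rewrite exprS mulrCA ler_wpM2l.
have ci n i : cabs (p n.+1 i - p n i) <= G * tau ^+ n.
  rewrite -[_ - _]/((p n.+1 - p n) i) dn.
  by have [h1 h2] := Ddn n; apply: le_trans h2; exact: cabs_le_l2norm.
have [u hu] : exists u : int -> C, forall n i,
    cabs (p n i - u i) <= 2 * (G * tau ^+ n / (1 - tau)).
  have hre i : exists l : R, forall n,
      `|complex.Re (p n i) - l| <= G * tau ^+ n / (1 - tau).
    apply: geometric_limit => // n; apply: le_trans (ci n i).
    by have := cabs_re (p n.+1 i - p n i); case: (p n.+1 i) => ? ?; case: (p n i).
  have him i : exists l : R, forall n,
      `|complex.Im (p n i) - l| <= G * tau ^+ n / (1 - tau).
    apply: geometric_limit => // n; apply: le_trans (ci n i).
    by have := cabs_im (p n.+1 i - p n i); case: (p n.+1 i) => ? ?; case: (p n i).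
  have [re re_p] := choice hre; have [im im_p] := choice him.
  exists (fun i => (re i +i* im i)%C : C) => n i.
  have := re_p i n; have := im_p i n.
  case: (p n i) => a b h1 h2.
  by apply: le_trans (cabs_le_reim _) _; move: h1 h2 => /=; lra.
have small (e : R) : 0 < e -> exists n, forall i, cabs (p n i - u i) < e /\
    cabs (p n.+1 i - u i) < e.
  move=> e0.
  have c0 : 0 < e * (1 - tau) / (2 * (G + 1)).
    by rewrite !mulr_gt0// invr_gt0 mulr_gt0// ltr_wpDl.
  have [n hn] := expr_small t0 t1 c0.
  have small1 k i : (n <= k)%N -> cabs (p k i - u i) < e.
    move=> nk; apply: le_lt_trans (hu k i) _.
    have tk : tau ^+ k < e * (1 - tau) / (2 * (G + 1)).
      apply: le_lt_trans hn; rewrite -(subnK nk) exprD ler_piMl ?exprn_ge0//.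
      by rewrite exprn_ile1// ltW.
    rewrite mulrA ltr_pdivrMr//.
    apply: (@le_lt_trans _ _ (2 * ((G + 1) * tau ^+ k))).
      by rewrite ler_wpM2l// ler_wpM2r ?exprn_ge0// lerDl.
    rewrite mulrA mulrC -ltr_pdivlMr//.
    by rewrite mulr_gt0// ltr_wpDl.
  by exists n => i; split; apply: small1.
have Du : ell2 u.
  apply: (@qnorm_le_ssum _ _ (2 * (G / (1 - tau)) ^+ 2 + 2) _).1 => N.
  (* Squared errors of at most 1 / (2 N + 1) per entry add up to at most 1 over the window. *)
  have [n hn] : exists n, forall i, nsq (fun i => p n i - u i) i <= (N.*2.+1%:R)^-1.
    have [|n hn] := small (N.*2.+1%:R)^-1; first by rewrite invr_gt0.
    exists n => i; have [h _] := hn i; rewrite /nsq expr2.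
    apply: le_trans (_ : cabs (p n i - u i) * 1 <= _); last by rewrite mulr1 ltW.
    rewrite ler_wpM2l ?cabs_ge0// ltW// (lt_le_trans h)// invf_le1//.
    by rewrite ler1n.
  apply: (@le_trans _ _ (ssum N (fun i => 2 * nsq (p n) i +
      2 * nsq (fun i => p n i - u i) i))).
    apply: ler_sum => k _; set i := (_ - _).
    have e : u i = p n i - (p n i - u i) by rewrite opprB addrCA subrr addr0.
    have := @sqrD_weighted R (cabs (p n i)) (cabs (p n i - u i)) 1 1 ltr01 ltr01.
    rewrite !divr1 => h; apply: le_trans (_ : (cabs (p n i) + cabs (p n i - u i)) ^+ 2 <= _).
      rewrite /nsq ler_sqr ?nnegrE ?cabs_ge0 ?addr_ge0 ?cabs_ge0//.
      by rewrite {1}e; exact: cabsB.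
    by apply: le_trans h _; rewrite /nsq; lra.
  have q1 : ssum N (nsq (p n)) <= (G / (1 - tau)) ^+ 2.
    apply: le_trans (ssum_le_qnorm N (Dp n)) _; rewrite -l2norm_sqr.
    by rewrite ler_sqr ?nnegrE ?l2norm_ge0// divr_ge0// ltW.
  have q2 : ssum N (nsq (fun i => p n i - u i)) <= 1.
    apply: le_trans (ler_sum _ (fun k _ => hn _)) _.
    by rewrite sumr_const card_ord -[leLHS]mulr_natr mulVf.
  by rewrite ssumD !ssumZ; lra.
exists u => //.
have fixp i : u i = B u i + g i.
  apply/eqP; rewrite -subr_eq0 -cabs_eq0 eq_le cabs_ge0 andbT.
  apply/ler_addgt0Pr => e e0; rewrite add0r.
  (* Three errors enter: that of p (n + 1), and both terms of B applied to p n - u. *)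
  have c0 : 0 < 2 + s * (3 * K * (3 * K)) by rewrite addr_gt0// !mulr_gt0.
  have [|n hn] := small (e / (2 + s * (3 * K * (3 * K)))); first by rewrite divr_gt0.
  set d := e / _ in hn.
  pose v : int -> C := fun j => p n j - u j.
  have vd j : cabs (v j) <= d by have [h _] := hn j; exact: ltW.
  have -> : u i - (B u i + g i) = - (p n.+1 i - u i) + B v i.
    have -> : B v = -1 *: B u + B (p n).
      by rewrite -B_linear; congr B; apply/funext => j;
         rewrite scaleN1r [X in _ = X j]addrC.
    change (u i - (B u i + g i) = - (B (p n) i + g i - u i) + (-1 * B u i + B (p n) i)).
    by ring.
  apply: le_trans (cabsD _ _) _; rewrite cabsN.
  have h1 : cabs (p n.+1 i - u i) <= d by have [_ h] := hn i; exact: ltW.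
  have h2 : cabs (B v i) <= d + s * (3 * K * (3 * K * d)).
    apply: le_trans (cabsB _ _) _; apply: lerD => //.
    rewrite cabsM cabs_ofR gtr0_norm// ler_pM2l//.
    by apply: cabs_triop_le => // j; exact: cabs_triop_le.
  apply: le_trans (lerD h1 h2) _.
  have -> : e = d * (2 + s * (3 * K * (3 * K))) by rewrite /d divfK// gt_eqF.
  by lra.
have DTu := (triop_qnorm hm Du).1.
have Dr : ell2 (triop m u - f).
  by have := ell2_lin (-1) Df DTu; rewrite scaleN1r addrC.
apply/eqP; rewrite -subr_eq0; apply/eqP.
case: HH => _ _ [_ hdef] _ _; apply: hdef => //.
apply/eqP; rewrite eq_le l2norm_ge0 andbT -(pmulr_rle0 _ eta0).
apply: le_trans (low_adj Dr) _.
have -> : triop (adj m) (triop m u - f) = 0.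
  apply/funext => i; have e := fixp i.
  have -> : triop m u - f = -1 *: f + triop m u by rewrite scaleN1r addrC.
  rewrite triop_lin; change (-1 * triop (adj m) f i + triop (adj m) (triop m u) i = 0).
  have sC : ofR s != 0 :> C by rewrite -cabs_eq0 cabs_ofR normr_eq0 gt_eqF.
  apply: (mulfI sC); rewrite mulr0.
  move: e; rewrite /B; change (g i) with (ofR s * triop (adj m) f i) => e.
  have key (w a b : C) : w = w - a + b -> a - b = 0.
    move=> h; have -> : a - b = w - (w - a + b) by ring.
    by rewrite -h subrr.
  rewrite -[RHS](key _ _ _ e); ring.
by rewrite l2norm0.
Qed.

End Surjectivity.

Section ApproximateEigenvectors.
Variable R : realType.
Local Notation C := (Cplx R).
Implicit Types (x y z : int -> C) (m : int -> int -> C).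

Lemma band_bound_le K K' m : K <= K' -> band_bound K m -> band_bound K' m.
Proof.
by move=> KK hm i; have [h1 h2 h3] := hm i; split; apply: le_trans KK.
Qed.

Lemma lt_l2norm x y (eps : R) : 0 < eps -> 
  (qnorm x < eps ^+ 2 * qnorm y) = (l2norm x < eps * l2norm y).
Proof.
move=> e0; rewrite -!l2norm_sqr -exprMn ltr_sqr// nnegrE ?l2norm_ge0//.
by rewrite mulr_ge0 ?l2norm_ge0// ltW.
Qed.

Definition almost_eigen (m : int -> int -> C) (lam : C) (eps : R) x : Prop :=
  ell2 x /\ qnorm (subscalar (triop m) lam x) < eps ^+ 2 * qnorm x.

Lemma linear_on_sub K m lam : band_bound K m ->
  linear_on (@ell2 R) (subscalar (triop m) lam).
Proof.
move=> hm; apply: linear_on_subscalar; first exact: hilbertian_ell2.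
exact: linear_on_triop hm.
Qed.

Lemma almost_eigen_spec K m lam eps x : band_bound K m -> 0 < eps ->
  almost_eigen m lam eps x -> spec_l2 eps m lam.
Proof.
move=> hm e0 [Dx hx]; apply/spec_epsP => //; first exact: hilbertian_ell2.
move=> g; move: hx; rewrite lt_l2norm//; apply/negP; rewrite -leNgt.
by apply: (inv_bounded_lower (linear_on_sub lam hm).1 g).
Qed.

(** If both alternatives failed, m - lam and its adjoint would be bounded below by eps, which gives
    a bounded inverse. Entrywise conjugation trades the adjoint for the transpose and keeps lam
    unconjugated. *)
Lemma spec_almost_eigen K m lam eps : band_bound K m -> 0 < eps ->
  spec_l2 eps m lam ->
  (exists x, almost_eigen m lam eps x) \/ exists x, almost_eigen (transp m) lam eps x.
Proof.
move=> hm e0; move/spec_epsP => h; apply: contrapT => /not_orP[h1 h2].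
apply: (h (hilbertian_ell2 R) e0).
have hS := band_bound_shift lam hm.
(* Enlarged so that K2 > 0 and eps <= 3 K2, as the Richardson step demands. *)
set K1 := K + cabs lam in hS; set K2 := K1 + eps + 1.
have K10 := band_bound_ge0 hS.
have hS2 : band_bound K2 (shiftmat m lam).
  by apply: band_bound_le hS; rewrite /K2 -addrA lerDl addr_ge0// ltW.
have K20 : 0 < K2 by rewrite ltr_wpDl// addr_ge0// ltW.
have eK2 : eps <= 3 * K2 by rewrite /K2; lra.
have low x : ell2 x -> eps * l2norm x <= l2norm (subscalar (triop m) lam x).
  move=> Dx; rewrite leNgt -lt_l2norm//; apply/negP => hx.
  by apply: h1; exists x.
have low_t x : ell2 x ->
    eps * l2norm x <= l2norm (subscalar (triop (transp m)) lam x).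
  move=> Dx; rewrite leNgt -lt_l2norm//; apply/negP => hx.
  by apply: h2; exists x.
apply: lower_inv_bounded => //; [exact: hilbertian_ell2|exact: linear_on_sub hm|].
move=> f Df; rewrite subscalar_triop.
apply: (@triop_surjective R (shiftmat m lam) K2 eps) => //.
  by move=> x Dx; rewrite -subscalar_triop; exact: low.
move=> x Dx.
rewrite (_ : triop _ x = (fun i => (triop (transp (shiftmat m lam)) (fun i => (x i)^*) i)^*)).
  rewrite l2norm_conj -(l2norm_conj x) transp_shiftmat -subscalar_triop.
  by apply: low_t; exact: ell2_conj.
by apply/funext => i; rewrite triop_adj.
Qed.

End ApproximateEigenvectors.

(** * Windows and localization *)

Section Windows.
Variable R : realType.

Lemma zsum_window (k : int) (N : nat) (f : int -> R) : (forall i, 0 <= f i) ->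
  (forall i, ~~ (k <= i < k + N%:Z) -> f i = 0) ->
  zsum f = (\sum_(j < N) f (k + j%:Z))%:E.
Proof.
move=> f0 fN.
rewrite (@eq_zsum R f (fun i => \sum_(j < N)
    (if i == k + j%:Z then f (k + j%:Z) else 0))); last first.
  move=> i; have [iN|Ni] := boolP (k <= i < k + N%:Z).
    have jb : (absz (i - k)%R < N)%N by lia.
    rewrite (bigD1 (Ordinal jb))//= big1 ?addr0.
      have -> : k + (absz (i - k)%R)%:Z = i by lia.
      by rewrite eqxx.
    move=> j jn; case: eqP => // e; case/eqP: jn; apply: val_inj => /=; lia.
  rewrite fN// big1// => j _; case: eqP => // e.
  by have := ltn_ord j; lia.
rewrite zsum_sum; last by move=> j i; case: eqP.
by rewrite -sumEFin; apply: eq_bigr => j _; rewrite zsum_single.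
Qed.

Lemma zsum_weighted_shifts (n : nat) (c : 'I_n -> R) (s : 'I_n -> int)
    (f : int -> R) (F : R) :
  (forall j, 0 <= c j) -> (forall i, 0 <= f i) -> zsum f = F%:E ->
  zsum (fun k => \sum_(j < n) c j * f (k + s j)) = ((\sum_(j < n) c j) * F)%:E.
Proof.
move=> c0 f0 fF; rewrite zsum_sum; last by move=> j i; rewrite mulr_ge0.
rewrite mulr_suml -sumEFin; apply: eq_bigr => j _.
by rewrite zsumZ// zsum_shift fF EFinM.
Qed.

(* Summed over all translates k, the weighted squares on both sides become
   multiples of the l2 norms of g and h, so some translate does no worse than
   the average. *)
Lemma window_average (n : nat) (w d e : 'I_n -> R) (s0 s1 s2 : 'I_n -> int)
    (g h : int -> R) (rho : int -> 'I_n -> R) (Ma Mc U V eps p G H : R) :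
  0 < eps -> 0 < p ->
  (forall k j, 0 <= rho k j <= `|w j| * g (k + s0 j) +
     (Ma * `|d j| * h (k + s1 j) + Mc * `|e j| * h (k + s2 j))) ->
  0 <= U -> 0 <= V ->
  (forall u v, (Ma * u + Mc * v) ^+ 2 <= U * u ^+ 2 + V * v ^+ 2) ->
  U * (\sum_(j < n) d j ^+ 2) + V * (\sum_(j < n) e j ^+ 2) <=
    p ^+ 2 * \sum_(j < n) w j ^+ 2 ->
  0 < \sum_(j < n) w j ^+ 2 ->
  (forall i, 0 <= g i) -> (forall i, 0 <= h i) ->
  zsum (fun i => g i ^+ 2) = G%:E -> zsum (fun i => h i ^+ 2) = H%:E ->
  G < eps ^+ 2 * H ->
  exists k, \sum_(j < n) rho k j ^+ 2 <
    (eps + p) ^+ 2 * \sum_(j < n) w j ^+ 2 * h (k + s0 j) ^+ 2.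
Proof.
move=> e0 p0 hrho U0 V0 hUV hpen; set S := \sum_(j < n) w j ^+ 2 => S0 g0 h0 gG hH GH.
(* Otherwise the reverse inequality holds for every translate k; summed over k it contradicts G <
   eps^2 H. *)
apply: contrapT => /forallNP nk.
have ep0 : 0 < eps + p by rewrite addr_gt0.
pose A k := \sum_(j < n) w j ^+ 2 * g (k + s0 j) ^+ 2.
pose B1 k := \sum_(j < n) d j ^+ 2 * h (k + s1 j) ^+ 2.
pose B2 k := \sum_(j < n) e j ^+ 2 * h (k + s2 j) ^+ 2.
pose L k := \sum_(j < n) w j ^+ 2 * h (k + s0 j) ^+ 2.
have zw (c : 'I_n -> R) (sh : 'I_n -> int) (f : int -> R) (F : R) :
    zsum (fun i => f i ^+ 2) = F%:E ->
    zsum (fun k => \sum_(j < n) c j ^+ 2 * f (k + sh j) ^+ 2) =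
    ((\sum_(j < n) c j ^+ 2) * F)%:E.
  by apply: (@zsum_weighted_shifts n _ sh (fun i => f i ^+ 2)) => i; exact: sqr_ge0.
have zA : zsum A = (S * G)%:E by exact: zw.
have zL : zsum L = (S * H)%:E by exact: zw.
have zB1 : zsum B1 = ((\sum_(j < n) d j ^+ 2) * H)%:E by exact: zw.
have zB2 : zsum B2 = ((\sum_(j < n) e j ^+ 2) * H)%:E by exact: zw.
have sum_ge0 (c : 'I_n -> R) (f : int -> R) (s : 'I_n -> int) k :
    0 <= \sum_(j < n) c j ^+ 2 * f (k + s j) ^+ 2.
  by apply: sumr_ge0 => j _; rewrite mulr_ge0// sqr_ge0.
have pt k : (eps + p) ^+ 2 * L k <=
    (eps + p) * (eps^-1 * A k + (p^-1 * U * B1 k + p^-1 * V * B2 k)).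
  apply: (@le_trans _ _ (\sum_(j < n) rho k j ^+ 2)).
    by rewrite leNgt; apply/negP; exact: nk.
  rewrite /A /B1 /B2 !mulr_sumr -!big_split/= mulr_sumr; apply: ler_sum => j _.
  have /andP[r0 r1] := hrho k j.
  apply: le_trans (_ : (`|w j| * g (k + s0 j) + (Ma * `|d j| * h (k + s1 j) +
      Mc * `|e j| * h (k + s2 j))) ^+ 2 <= _).
    by rewrite ler_sqr// nnegrE//; exact: le_trans r1.
  (* The weights eps and p are the sizes of the two summands, so the average comes out as (eps +
     p)^2. *)
  apply: le_trans (sqrD_weighted _ _ e0 p0) _.
  rewrite ler_pM2l// exprMn real_normK ?num_real// [_ / eps]mulrC lerD2l.
  have -> : p^-1 * U * (d j ^+ 2 * h (k + s1 j) ^+ 2) +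
     p^-1 * V * (e j ^+ 2 * h (k + s2 j) ^+ 2) =
     (U * (`|d j| * h (k + s1 j)) ^+ 2 + V * (`|e j| * h (k + s2 j)) ^+ 2) / p.
    by rewrite !exprMn !real_normK ?num_real//; ring.
  rewrite ler_pM2r ?invr_gt0// -!mulrA; exact: hUV.
have i0 : 0 <= p^-1 by rewrite invr_ge0 ltW.
have pU : 0 <= p^-1 * U by rewrite mulr_ge0.
have pV : 0 <= p^-1 * V by rewrite mulr_ge0.
have ie0 : 0 <= eps^-1 by rewrite invr_ge0 ltW.
have A0 k : 0 <= A k by exact: sum_ge0.
have B10 k : 0 <= B1 k by exact: sum_ge0.
have B20 k : 0 <= B2 k by exact: sum_ge0.
have L0 k : 0 <= L k by exact: sum_ge0.
have zl : zsum (fun k => (eps + p) ^+ 2 * L k) = ((eps + p) ^+ 2 * (S * H))%:E.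
  by rewrite zsumZ ?sqr_ge0// zL.
have zr : zsum (fun k => (eps + p) * (eps^-1 * A k +
      (p^-1 * U * B1 k + p^-1 * V * B2 k))) =
    ((eps + p) * (eps^-1 * (S * G) + (p^-1 * U * ((\sum_(j < n) d j ^+ 2) * H) +
       p^-1 * V * ((\sum_(j < n) e j ^+ 2) * H))))%:E.
  have T1 k : 0 <= eps^-1 * A k by exact: mulr_ge0.
  have T2 k : 0 <= p^-1 * U * B1 k by exact: mulr_ge0.
  have T3 k : 0 <= p^-1 * V * B2 k by exact: mulr_ge0.
  have T4 k : 0 <= p^-1 * U * B1 k + p^-1 * V * B2 k by exact: addr_ge0.
  rewrite zsumZ ?(ltW ep0)//; last by move=> k; exact: addr_ge0.
  by rewrite !zsumD// !zsumZ// zA zB1 zB2.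
have := le_zsum pt; rewrite zl zr lee_fin; apply/negP; rewrite -ltNge.
have -> : (eps + p) ^+ 2 * (S * H) = (eps + p) * ((eps + p) * (S * H)) by ring.
rewrite ltr_pM2l//.
have H0 : 0 < H.
  rewrite -(pmulr_rgt0 _ (_ : 0 < eps ^+ 2)) ?exprn_gt0//.
  apply: le_lt_trans GH; rewrite -lee_fin -gG; apply: zsum_ge0 => i; exact: sqr_ge0.
have h1 : eps^-1 * (S * G) < eps * (S * H).
  rewrite mulrC ltr_pdivrMr//.
  have := GH; rewrite -(ltr_pM2l S0); lra.
have h2 : p^-1 * U * ((\sum_(j < n) d j ^+ 2) * H) +
    p^-1 * V * ((\sum_(j < n) e j ^+ 2) * H) <= p * (S * H).
  have -> : p^-1 * U * ((\sum_(j < n) d j ^+ 2) * H) +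
    p^-1 * V * ((\sum_(j < n) e j ^+ 2) * H) =
    (U * (\sum_(j < n) d j ^+ 2) + V * (\sum_(j < n) e j ^+ 2)) * H / p by ring.
  rewrite ler_pdivrMr//; have := ler_wpM2r (ltW H0) hpen; rewrite -/S; lra.
by rewrite mulrDl; lra.
Qed.

(** Discrete Green formula for an eigenvector of the second difference. The boundary terms are kept
    because the windows obey different boundary conditions. *)
Lemma sum_by_parts (n : nat) (v : nat -> R) (kap : R) :
  (forall j, (j < n)%N -> v j + v j.+2 = (2 - kap) * v j.+1) ->
  \sum_(j < n.+1) (v j.+1 - v j) ^+ 2 =
  kap * (\sum_(j < n) v j.+1 ^+ 2) + v n.+1 * (v n.+1 - v n) - v 0%N * (v 1%N - v 0%N).
Proof.
elim: n => [|n IH] hv; first by rewrite big_ord1 big_ord0; ring.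
rewrite big_ord_recr IH/=; last by move=> j jn; apply: hv; rewrite ltnW.
rewrite [in RHS]big_ord_recr/=; have := hv n (ltnSn n).
move: (\sum_(j < n) _) (v n) (v n.+1) (v n.+2) (v 0%N) (v 1%N) => s a b c v0 v1 e.
have -> : c = (2 - kap) * b - a by rewrite -e; ring.
by ring.
Qed.

End Windows.

Section SineWindows.
Variable R : realType.

Lemma sin_addB (a b : R) : sin (a - b) + sin (a + b) = (2 * cos b) * sin a.
Proof. rewrite sinB sinD; ring. Qed.

Lemma cos_half (a : R) : 2 * cos a = 2 - 4 * sin (a / 2) ^+ 2.
Proof.
have {1}-> : a = a / 2 + a / 2 by lra.
by rewrite cosD; have := cos2Dsin2 (a / 2); rewrite !expr2; lra.
Qed.

Variable n : nat.
(** The lowest eigenvector of the second difference on 1..n with zero boundary values. Its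
    eigenvalue 4 sin^2 (pi / (2 (n + 1))) is the origin of [pen2]. *)
Definition sinw (j : nat) : R := sin (j%:R * (pi / n.+1%:R)).
Definition swin (z : int) : R := if 0 <= z <= n.+1%:Z then sinw `|z|%N else 0.

Lemma sinw0 : sinw 0 = 0. Proof. by rewrite /sinw mul0r sin0. Qed.

Lemma sinwS : sinw n.+1 = 0.
Proof. by rewrite /sinw mulrC divfK ?sinpi// pnatr_eq0. Qed.

Lemma sinw_rec j : sinw j + sinw j.+2 =
  (2 - 4 * sin (pi / (2 * (n%:R + 1))) ^+ 2) * sinw j.+1.
Proof.
rewrite /sinw; set t := pi / n.+1%:R.
have -> : pi / (2 * (n%:R + 1)) = t / 2 :> R.
  by rewrite /t natr1 invfM [2^-1 * _]mulrC mulrA.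
rewrite -cos_half -sin_addB; congr (sin _ + sin _).
  by rewrite -!natr1; ring.
by rewrite -!natr1; ring.
Qed.

Lemma swinE (j : nat) : (j <= n.+1)%N -> swin j%:Z = sinw j.
Proof. by move=> h; rewrite /swin ifT//; ilia. Qed.

Lemma swin_out (z : int) : ~~ (1 <= z <= n%:Z) -> swin z = 0.
Proof.
rewrite /swin; case: ifP => // h1 h2.
have [->|->] : z = 0 \/ z = n.+1%:Z by ilia.
  exact: sinw0.
exact: sinwS.
Qed.

Lemma sum_swin : \sum_(j < n.+2) swin j%:Z ^+ 2 = \sum_(j < n) sinw j.+1 ^+ 2.
Proof.
rewrite big_ord_recl big_ord_recr /= (swinE (leq0n _)) sinw0.
rewrite /bump /= add1n swinE// sinwS expr0n /= add0r addr0.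
by apply: eq_bigr => j _; rewrite /bump /= add1n swinE// ltnS ltnW.
Qed.

(** The range 0..n+1 includes the two outer rows that a windowed vector reaches, so each one-sided
    sum counts all n + 1 increments exactly once. *)
Lemma sum_swin_diff :
  \sum_(j < n.+2) (swin (j%:Z - 1) - swin j%:Z) ^+ 2 =
    4 * sin (pi / (2 * (n%:R + 1))) ^+ 2 * \sum_(j < n.+2) swin j%:Z ^+ 2 /\
  \sum_(j < n.+2) (swin (j%:Z + 1) - swin j%:Z) ^+ 2 =
    4 * sin (pi / (2 * (n%:R + 1))) ^+ 2 * \sum_(j < n.+2) swin j%:Z ^+ 2.
Proof.
have e := @sum_by_parts R n sinw _ (fun j _ => sinw_rec j).
rewrite sinwS sinw0 !mul0r addr0 subr0 in e.
rewrite sum_swin -{}e; split.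
  rewrite big_ord_recl /= (@swin_out (0 - 1)); last by ilia.
  rewrite (@swin_out 0); last by ilia.
  rewrite subrr expr0n /= add0r; apply: eq_bigr => j _.
  have -> : (bump 0 j)%:Z - 1 = j%:Z by rewrite /bump /=; ilia.
  rewrite /bump /= add1n !swinE; [|by rewrite ltnS -ltnS ltn_ord|by rewrite ltnW// ltn_ord].
  by rewrite -sqrrN opprB.
rewrite big_ord_recr /= (@swin_out (n.+1%:Z + 1)); last by ilia.
rewrite swinE// sinwS subrr expr0n /= addr0; apply: eq_bigr => j _.
have -> : (j%:Z + 1) = j.+1%:Z by ilia.
by rewrite !swinE// ltnW.
Qed.

Lemma sum_swin_gt0 : (0 < n)%N -> 0 < \sum_(j < n.+2) swin j%:Z ^+ 2.
Proof.
move=> n0; rewrite sum_swin (bigD1 (Ordinal n0))//= ltr_pwDl//; last first.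
  by apply: sumr_ge0 => j _; exact: sqr_ge0.
rewrite exprn_gt0// /sinw mul1r sin_gt0_pi//.
by rewrite divr_gt0 ?pi_gt0//= ltr_pdivrMr// ltr_pMr ?pi_gt0// ltr1n.
Qed.

End SineWindows.
Arguments swin {R} n z.
Arguments sinw {R} n j.

Section TridiagonalClasses.
Variable R : realType.
Local Notation C := (Cplx R).
Implicit Types (x y z : int -> C) (m : int -> int -> C) (Sa Sb Sc : set C).

(** Indexed by column, so that matrices can be spliced column by column without leaving the
    class. *)
Definition tri_class Sa Sb Sc m : Prop := forall j : int,
  [/\ Sa (m (j + 1) j), Sb (m j j) & Sc (m (j - 1) j)].

(** Vector and rows are both restricted to W, which may be the line, a half-line or a section.
    Quantifying over the matrix is what allows pieces of different operators to be combined. *)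
Definition approx_on (W : int -> bool) Sa Sb Sc (eps : R) (lam : C) : Prop :=
  exists m x, [/\ tri_class Sa Sb Sc m, ell2 x, (forall i, ~~ W i -> x i = 0)
    & qnorm (cutto W (subscalar (triop m) lam x)) < eps ^+ 2 * qnorm x].

Lemma subscalar_at (T : (int -> C) -> int -> C) lam x i :
  subscalar T lam x i = T x i - lam * x i.
Proof. by []. Qed.

Lemma cutto_true x : cutto (fun=> true) x = x.
Proof. by []. Qed.

Lemma tri_class_transp Sa Sb Sc m :
  tri_class Sa Sb Sc m -> tri_class Sc Sb Sa (transp m).
Proof.
move=> hm j; rewrite /transp; split; last 1 first.
- by have [h _ _] := hm (j - 1); move: h; rewrite subrK.
- by have [_ _ h] := hm (j + 1); move: h; rewrite addrK.
- by have [] := hm j.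
Qed.

Lemma tri_class_reflect (c : int) Sa Sb Sc m :
  tri_class Sa Sb Sc m -> tri_class Sc Sb Sa (fun i j => m (c - i) (c - j)).
Proof.
move=> hm j; have [h1 h2 h3] := hm (c - j); split=> //.
  by rewrite (_ : c - (j + 1) = c - j - 1)//; ilia.
by rewrite (_ : c - (j - 1) = c - j + 1)//; ilia.
Qed.

Lemma tri_class_shift (c : int) Sa Sb Sc m :
  tri_class Sa Sb Sc m -> tri_class Sa Sb Sc (fun i j => m (i + c) (j + c)).
Proof.
move=> hm j; have [h1 h2 h3] := hm (j + c); split=> //.
  by rewrite (_ : j + 1 + c = j + c + 1)//; ilia.
by rewrite (_ : j - 1 + c = j + c - 1)//; ilia.
Qed.

Lemma triop_reflect (c : int) m x i :
  triop (fun i j => m (c - i) (c - j)) (fun i => x (c - i)) i = triop m x (c - i).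
Proof.
rewrite /triop (_ : c - (i - 1) = c - i + 1); last by ilia.
rewrite (_ : c - (i + 1) = c - i - 1); last by ilia.
by ring.
Qed.

Lemma triop_shift (c : int) m x i :
  triop (fun i j => m (i + c) (j + c)) (fun i => x (i + c)) i = triop m x (i + c).
Proof.
rewrite /triop (_ : i - 1 + c = i + c - 1); last by ilia.
by rewrite (_ : i + 1 + c = i + c + 1)//; ilia.
Qed.

Lemma approx_on_reflect (c : int) W Sa Sb Sc eps lam :
  approx_on W Sa Sb Sc eps lam ->
  approx_on (fun i => W (c - i)) Sc Sb Sa eps lam.
Proof.
move=> [m [x [hm Dx xW hx]]].
exists (fun i j => m (c - i) (c - j)), (fun i => x (c - i)); split.
- exact: tri_class_reflect.
- by apply/ell2_reflect.
- by move=> i /xW.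
rewrite qnorm_reflect.
rewrite (_ : cutto _ _ = fun i => cutto W (subscalar (triop m) lam x) (c - i)).
  by rewrite qnorm_reflect.
apply/funext => i; rewrite /cutto; case: ifP => // _.
by rewrite !subscalar_at triop_reflect.
Qed.

Lemma approx_on_le W Sa Sb Sc eps eps' lam : 0 <= eps -> eps <= eps' ->
  approx_on W Sa Sb Sc eps lam -> approx_on W Sa Sb Sc eps' lam.
Proof.
move=> e0 ee [m [x [hm Dx xW hx]]]; exists m, x; split=> //.
apply: lt_le_trans hx _; rewrite ler_wpM2r ?qnorm_ge0//.
by rewrite ler_sqr ?nnegrE//; exact: le_trans ee.
Qed.

Lemma tri_class_band_bound (K : R) Sa Sb Sc m :
  (forall a : C, (Sa `|` Sb `|` Sc) a -> cabs a <= K) ->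
  tri_class Sa Sb Sc m -> band_bound K m.
Proof.
move=> hK hm i; split; apply: hK.
- by left; left; have [h _ _] := hm (i - 1); move: h; rewrite subrK.
- by left; right; have [] := hm i.
- by right; have [_ _ h] := hm (i + 1); move: h; rewrite addrK.
Qed.

Lemma subscalarE m lam x i : subscalar (triop m) lam x i =
  m i (i - 1) * x (i - 1) + m i i * x i + m i (i + 1) * x (i + 1) - lam * x i.
Proof. by []. Qed.

(** The room below eps is later spent on localization. *)
Lemma sqr_gap (a b eps : R) : 0 < eps -> 0 <= b -> a < eps ^+ 2 * b ->
  exists2 e, 0 < e < eps & a < e ^+ 2 * b.
Proof.
move=> e0 b0 h.
have c0 : 0 < eps ^+ 2 * b - a by rewrite subr_gt0.
pose d := Num.min (eps / 2) ((eps ^+ 2 * b - a) / (2 * eps * (b + 1))).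
have d0 : 0 < d.
  by rewrite lt_min divr_gt0//= divr_gt0// mulr_gt0 ?mulr_gt0// ltr_wpDl.
have d1 : d <= eps / 2 by rewrite ge_min lexx.
have d2 : d * (2 * eps * (b + 1)) <= eps ^+ 2 * b - a.
  rewrite -ler_pdivlMr; first by rewrite ge_min lexx orbT.
  by rewrite mulr_gt0 ?mulr_gt0// ltr_wpDl.
exists (eps - d); first by apply/andP; split; lra.
have p1 : 0 < d * eps by rewrite mulr_gt0.
have p2 : 0 <= d ^+ 2 * b by rewrite mulr_ge0// sqr_ge0.
lra.
Qed.

(** The window only multiplies x, so zeros of x survive and multiplication by it commutes with
    restricting rows to W; one statement thus serves line, half-line and section. *)
Lemma localize (Ma Mc p eps : R) (n : nat) m W x lam :
  (0 < n)%N -> 0 < eps -> 0 < p ->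
  (forall i, cabs (m i (i - 1)) <= Ma) -> (forall i, cabs (m i (i + 1)) <= Mc) ->
  2 * (Ma + Mc) * sin (pi / (2 * (n%:R + 1))) <= p ->
  (forall i, ~~ W i -> x i = 0) -> ell2 x ->
  ell2 (subscalar (triop m) lam x) ->
  qnorm (cutto W (subscalar (triop m) lam x)) < eps ^+ 2 * qnorm x ->
  exists k y, [/\ forall i, ~~ (k + 1 <= i <= k + n%:Z) -> y i = 0,
    forall i, x i = 0 -> y i = 0, ell2 y &
    qnorm (cutto W (subscalar (triop m) lam y)) < (eps + p) ^+ 2 * qnorm y].
Proof.
move=> n0 e0 p0 hMa hMc hp xW Dx Dr hx.
have Ma0 : 0 <= Ma by apply: le_trans (hMa 0); exact: cabs_ge0.
have Mc0 : 0 <= Mc by apply: le_trans (hMc 0); exact: cabs_ge0.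
pose yk (k : int) : int -> C := fun i => ofR (swin n (i - k)) * x i.
pose res := subscalar (triop m) lam.
pose rho (k : int) (j : 'I_n.+2) := cabs (cutto W (res (yk k)) (k + j%:Z)).
pose w (j : 'I_n.+2) : R := swin n j%:Z.
pose d (j : 'I_n.+2) : R := swin n (j%:Z - 1) - swin n j%:Z.
pose e (j : 'I_n.+2) : R := swin n (j%:Z + 1) - swin n j%:Z.
have [sd se] := sum_swin_diff R n.
have sin0 : 0 <= sin (pi / (2 * (n%:R + 1))) :> R.
  have N1 : 0 < n%:R + 1 :> R by rewrite ltr_wpDl.
  apply: ltW; apply: sin_gt0_pi; rewrite divr_gt0 ?pi_gt0 ?mulr_gt0//=.
  by rewrite ltr_pdivrMr ?mulr_gt0// ltr_pMr ?pi_gt0//; have : 0 <= n%:R :> R by []; lra.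
have [k hk] : exists k, \sum_(j < n.+2) rho k j ^+ 2 <
    (eps + p) ^+ 2 * \sum_(j < n.+2) w j ^+ 2 * cabs (x (k + j%:Z)) ^+ 2.
  apply: (@window_average R n.+2 w d e (fun j => j%:Z)
    (fun j => j%:Z - 1) (fun j => j%:Z + 1)
    (fun i => cabs (cutto W (res x) i)) (fun i => cabs (x i)) rho Ma Mc
    ((Ma + Mc) * Ma) ((Ma + Mc) * Mc) eps p
    (qnorm (cutto W (res x))) (qnorm x)) => //.
  - move=> k j; rewrite cabs_ge0/=; set i := k + j%:Z.
    rewrite {1}/rho -/i /cutto; case: ifP => Wi; last first.
      by rewrite cabs0 mulr0 add0r addr_ge0// mulr_ge0 ?cabs_ge0// mulr_ge0.
    rewrite (_ : k + (j%:Z - 1) = i - 1); last by rewrite /i; ilia.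
    rewrite (_ : k + (j%:Z + 1) = i + 1); last by rewrite /i; ilia.
    (* The windowed residual plus a commutator, in which only increments of the window occur. *)
    have -> : res (yk k) i = ofR (w j) * res x i +
       (m i (i - 1) * ofR (d j) * x (i - 1) + m i (i + 1) * ofR (e j) * x (i + 1)).
      rewrite /res !subscalarE /yk /w /d /e !ofRB.
      rewrite (_ : i - 1 - k = j%:Z - 1); last by rewrite /i; ilia.
      rewrite (_ : i + 1 - k = j%:Z + 1); last by rewrite /i; ilia.
      rewrite (_ : i - k = j%:Z); last by rewrite /i; ilia.
      by ring.
    apply: le_trans (cabsD _ _) _; rewrite cabsM cabs_ofR lerD2l.
    apply: le_trans (cabsD _ _) _; rewrite !cabsM !cabs_ofR.
    by apply: lerD; rewrite ler_wpM2r ?cabs_ge0// ler_wpM2r.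
  - by rewrite mulr_ge0// addr_ge0.
  - by rewrite mulr_ge0// addr_ge0.
  (* Cauchy-Schwarz: (Ma + Mc) (Ma u^2 + Mc v^2) exceeds (Ma u + Mc v)^2 by Ma Mc (u - v)^2. *)
  - move=> u v; have := mulr_ge0 (mulr_ge0 Ma0 Mc0) (sqr_ge0 (u - v)).
    by rewrite !expr2; lra.
  - rewrite /d /e sd se /w; set S := \sum_(j < n.+2) _.
    set s := sin _; have S0 : 0 <= S by apply: sumr_ge0 => j _; exact: sqr_ge0.
    have h : (2 * (Ma + Mc) * s) ^+ 2 <= p ^+ 2.
      rewrite ler_sqr ?nnegrE ?(ltW p0)// mulr_ge0// mulr_ge0// addr_ge0//.
    have := ler_wpM2r S0 h; lra.
  - exact: sum_swin_gt0.
  - by move=> i; exact: cabs_ge0.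
  - by move=> i; exact: cabs_ge0.
  - exact: zsum_nsq (qnorm_cutto W Dr).1.
  - exact: zsum_nsq.
exists k, (yk k).
have y_out i : ~~ (k + 1 <= i <= k + n%:Z) -> yk k i = 0.
  by move=> hi; rewrite /yk swin_out ?mul0r//; ilia.
have Dy : ell2 (yk k) /\ qnorm (yk k) =
    \sum_(j < n.+2) w j ^+ 2 * cabs (x (k + j%:Z)) ^+ 2.
  have zy : zsum (nsq (yk k)) = (\sum_(j < n.+2) nsq (yk k) (k + j%:Z))%:E.
    apply: zsum_window; first by move=> i; exact: nsq_ge0.
    by move=> i hi; rewrite /nsq y_out ?cabs0 ?expr0n//; ilia.
  have D : ell2 (yk k) by rewrite /ell2/= -[sumsq _]/(zsum (nsq _)) zy ltry.
  split=> //; apply: EFin_inj; rewrite -zsum_nsq// zy; congr (_%:E).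
  apply: eq_bigr => j _; rewrite /nsq /yk cabsM cabs_ofR exprMn.
  by rewrite real_normK ?num_real// (_ : k + j%:Z - k = j%:Z)//; ilia.
have qr : qnorm (cutto W (res (yk k))) = \sum_(j < n.+2) rho k j ^+ 2.
  have zr : zsum (nsq (cutto W (res (yk k)))) =
      (\sum_(j < n.+2) nsq (cutto W (res (yk k))) (k + j%:Z))%:E.
    apply: zsum_window; first by move=> i; exact: nsq_ge0.
    move=> i hi; rewrite nsq_cutto; case: ifP => // _.
    rewrite /nsq /res subscalarE !y_out ?mulr0 ?addr0 ?subr0 ?cabs0 ?expr0n//; ilia.
  apply: EFin_inj; rewrite -[RHS]zr /qnorm fineK//.
  by rewrite ge0_fin_numE ?sumsq_ge0// -[sumsq _]/(zsum (nsq _)) zr ltry.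
split=> //; first by move=> i xi; rewrite /yk xi mulr0.
  exact: Dy.1.
by rewrite -/res qr Dy.2.
Qed.

End TridiagonalClasses.

(** * Half-line operators *)

Section Gluing.
Variable R : realType.
Local Notation C := (Cplx R).
Implicit Types (x y z : int -> C) (m : int -> int -> C) (Sa Sb Sc : set C).

Lemma tri_class_ell2 (K : R) Sa Sb Sc m x lam :
  (forall a : C, (Sa `|` Sb `|` Sc) a -> cabs a <= K) ->
  tri_class Sa Sb Sc m -> ell2 x -> ell2 (subscalar (triop m) lam x).
Proof.
by move=> hK hm Dx; apply: (linear_on_sub lam (tri_class_band_bound hK hm)).1.
Qed.

(* Two half-line vectors meet at the site 0 between them, where their
   contributions to the residual cancel for a suitable linear combination. *)
Lemma glue_half_lines (K : R) Sa Sb Sc eps lam :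
  (forall a : C, (Sa `|` Sb `|` Sc) a -> cabs a <= K) ->
  approx_on (fun i => 1 <= i) Sa Sb Sc eps lam ->
  approx_on (fun i => 1 <= i) Sc Sb Sa eps lam ->
  approx_on (fun=> true) Sa Sb Sc eps lam.
Proof.
move=> hK [m1 [x1 [hm1 Dx1 x1W hx1]]] /(approx_on_reflect 0).
move=> [m2 [x2 [hm2 Dx2 x2W hx2]]].
(* Spliced by columns; column 0 meets the zero entry of x. *)
pose m i j := if (0 < j :> int) then m1 i j else m2 i j.
pose u := m1 0 1 * x1 1; pose v := m2 0 (-1) * x2 (-1).
(* A u + B v is the residual of the combination in row 0. *)
have [A [B [AB AB0]]] : exists A B : C, A * u + B * v = 0 /\ (A != 0 \/ B != 0).
  have [v0|v0] := eqVneq v 0.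
    by exists 0, 1; rewrite v0 mul0r mulr0 addr0; split=> //; right; exact: oner_neq0.
  by exists v, (- u); split; [ring|left].
have AB2 : 0 < cabs A ^+ 2 \/ 0 < cabs B ^+ 2.
  by case: AB0 => h; [left|right]; rewrite exprn_gt0// cabs_gt0.
pose x : int -> C := fun i => A * x1 i + B * x2 i.
have x10 i : i <= 0 -> x1 i = 0 by move=> h; rewrite x1W//; ilia.
have x20 i : 0 <= i -> x2 i = 0 by move=> h; rewrite x2W//; ilia.
have sA := sqr_ge0 (cabs A); have sB := sqr_ge0 (cabs B).
have zx : zsum (nsq x) = (cabs A ^+ 2 * qnorm x1 + cabs B ^+ 2 * qnorm x2)%:E.
  rewrite (@eq_zsum R _ (fun i => cabs A ^+ 2 * nsq x1 i + cabs B ^+ 2 * nsq x2 i)).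
    rewrite zsumD ?zsumZ ?zsum_nsq//; [by move=> i; rewrite mulr_ge0 ?nsq_ge0..].
  move=> i; rewrite /nsq /x; have [i0|i0] := ltP 0 i.
    by rewrite x20 ?(ltW i0)// mulr0 addr0 cabsM cabs0 exprMn expr0n/= mulr0 addr0.
  by rewrite x10// mulr0 add0r cabsM cabs0 exprMn expr0n/= mulr0 add0r.
have Dx : ell2 x by rewrite /ell2/= -[sumsq _]/(zsum (nsq _)) zx ltry.
have qx : qnorm x = cabs A ^+ 2 * qnorm x1 + cabs B ^+ 2 * qnorm x2.
  by apply: EFin_inj; rewrite -zsum_nsq.
exists m, x; split=> //.
  by move=> j; rewrite /m; case: ifP => _; [exact: hm1|exact: hm2].
rewrite cutto_true.
set r1 := cutto _ _ in hx1; set r2 := cutto _ _ in hx2.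
have mx i j : m i j * x j = A * (m1 i j * x1 j) + B * (m2 i j * x2 j).
  rewrite /m /x; case: ifP => j0; first by rewrite x20 ?(ltW j0)//; ring.
  by rewrite x10; [ring|ilia].
have resE i : subscalar (triop m) lam x i =
    A * subscalar (triop m1) lam x1 i + B * subscalar (triop m2) lam x2 i.
  by rewrite !subscalarE !mx /x; ring.
have res1 i : i < 0 -> subscalar (triop m1) lam x1 i = 0.
  by move=> i0; rewrite subscalarE !x10; [ring|ilia|ilia|ilia].
have res2 i : 0 < i -> subscalar (triop m2) lam x2 i = 0.
  by move=> i0; rewrite subscalarE !x20; [ring|ilia|ilia|ilia].
have res0 : subscalar (triop m) lam x 0 = 0.
  rewrite resE !subscalarE (x10 0)// (x20 0)// (x10 (0 - 1))// (x20 (0 + 1))//.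
  have -> : (0 + 1 : int) = 1 by []. have -> : (0 - 1 : int) = -1 by [].
  by rewrite -[RHS]AB /u /v; ring.
have Dr1 : ell2 r1 by exact: (qnorm_cutto _ (tri_class_ell2 _ hK hm1 Dx1)).1.
have Dr2 : ell2 r2 by exact: (qnorm_cutto _ (tri_class_ell2 _ hK hm2 Dx2)).1.
have zr : zsum (nsq (subscalar (triop m) lam x)) =
    (cabs A ^+ 2 * qnorm r1 + cabs B ^+ 2 * qnorm r2)%:E.
  rewrite (@eq_zsum R _ (fun i => cabs A ^+ 2 * nsq r1 i + cabs B ^+ 2 * nsq r2 i)).
    rewrite zsumD ?zsumZ ?zsum_nsq//; [by move=> i; rewrite mulr_ge0 ?nsq_ge0..].
  move=> i; rewrite !nsq_cutto /nsq; have [i0|i0|->] := ltgtP i 0.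
  - rewrite resE res1// mulr0 add0r cabsM exprMn ifF ?mulr0 ?add0r; last by ilia.
    by rewrite ifT//; ilia.
  - rewrite resE res2// mulr0 addr0 cabsM exprMn ifT; last by ilia.
    by rewrite ifF ?mulr0 ?addr0//; ilia.
  by rewrite res0 cabs0 expr0n /= !mulr0 addr0.
have -> : qnorm (subscalar (triop m) lam x) =
    cabs A ^+ 2 * qnorm r1 + cabs B ^+ 2 * qnorm r2.
  by rewrite /qnorm -[sumsq _]/(zsum (nsq _)) zr.
rewrite qx mulrDr ![eps ^+ 2 * _]mulrCA.
case: AB2 => h.
  by apply: ltr_leD; [rewrite ltr_pM2l|rewrite ler_wpM2l// ltW].
by apply: ler_ltD; [rewrite ler_wpM2l// ltW|rewrite ltr_pM2l].
Qed.

End Gluing.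

Section HalfLines.
Variable R : realType.
Local Notation C := (Cplx R).
Implicit Types (x y z : int -> C) (m : int -> int -> C) (Sa Sb Sc : set C).

Lemma approx_on_ext (W W' : int -> bool) Sa Sb Sc eps lam : W =1 W' ->
  approx_on W Sa Sb Sc eps lam -> approx_on W' Sa Sb Sc eps lam.
Proof. by move=> /funext ->. Qed.

Lemma approx_on_localize (K p eps : R) (n : nat) W Sa Sb Sc lam :
  (forall a : C, (Sa `|` Sb `|` Sc) a -> cabs a <= K) ->
  (0 < n)%N -> 0 < eps -> 0 < p ->
  4 * K * sin (pi / (2 * (n%:R + 1))) <= p ->
  approx_on W Sa Sb Sc eps lam ->
  exists k m y, [/\ tri_class Sa Sb Sc m,
    forall i, ~~ (k + 1 <= i <= k + n%:Z) -> y i = 0,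
    forall i, ~~ W i -> y i = 0, ell2 y &
    qnorm (cutto W (subscalar (triop m) lam y)) < (eps + p) ^+ 2 * qnorm y].
Proof.
move=> hK n0 e0 p0 hp [m [x [hm Dx xW hx]]].
have hb := tri_class_band_bound hK hm.
have hK1 i : cabs (m i (i - 1)) <= K by have [] := hb i.
have hK2 i : cabs (m i (i + 1)) <= K by have [] := hb i.
have hp2 : 2 * (K + K) * sin (pi / (2 * (n%:R + 1))) <= p.
  by apply: le_trans hp; rewrite le_eqVlt; apply/orP; left; apply/eqP; ring.
have [k [y [h1 h2 h3 h4]]] := localize n0 e0 p0 hK1 hK2 hp2 xW Dx
  (tri_class_ell2 lam hK hm Dx) hx.
by exists k, m, y; split=> // i /xW; exact: h2.
Qed.

(** A window of length N inside 1..N+1 misses an end site. If y vanishes at N + 1, row N + 2 has no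
    residual and the right end may be opened; otherwise y vanishes at 1 and the left end is opened,
    then reflected. *)
Lemma half_line (K p eps : R) (N : nat) Sa Sb Sc lam :
  (forall a : C, (Sa `|` Sb `|` Sc) a -> cabs a <= K) ->
  (0 < N)%N -> 0 < eps -> 0 < p -> 4 * K * sin (pi / (2 * (N%:R + 1))) <= p ->
  approx_on (fun i => 1 <= i <= N.+1%:Z) Sa Sb Sc eps lam ->
  approx_on (fun i => 1 <= i) Sa Sb Sc (eps + p) lam \/
  approx_on (fun i => 1 <= i) Sc Sb Sa (eps + p) lam.
Proof.
move=> hK N0 e0 p0 hp /(approx_on_localize hK N0 e0 p0 hp).
move=> [k [m [y [hm yk yW Dy hy]]]].
have [yN|yN] := eqVneq (y N.+1%:Z) 0; [left|right].
  exists m, y; split=> //; first by move=> i Wi; rewrite yW//; ilia.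
  rewrite (_ : cutto _ _ = cutto (fun i => 1 <= i <= N.+1%:Z)
    (subscalar (triop m) lam y))//.
  apply/funext => i; rewrite /cutto; case: (leP 1 i) => //= i1.
  case: leP => // iN; rewrite subscalarE.
  rewrite (yW i); last by ilia.
  rewrite (yW (i + 1)); last by ilia.
  have [->|iN2] := eqVneq i (N.+1%:Z + 1).
    by rewrite addrK yN; ring.
  by rewrite (yW (i - 1)); [ring|ilia].
have kN : k + 1 <= N.+1%:Z <= k + N%:Z.
  by apply/negPn/negP => h; move: yN; rewrite yk// eqxx.
have y1 : y 1 = 0 by rewrite yk//; ilia.
apply: (@approx_on_ext (fun i => N.+2%:Z - i <= N.+1%:Z)).
  by move=> i; ilia.
apply: (approx_on_reflect N.+2%:Z (W := fun i => i <= N.+1%:Z)).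
exists m, y; split=> //; first by move=> i Wi; rewrite yW//; ilia.
rewrite (_ : cutto _ _ = cutto (fun i => 1 <= i <= N.+1%:Z)
  (subscalar (triop m) lam y))//.
apply/funext => i; rewrite /cutto andbC; case: (leP i N.+1%:Z) => //= iN.
case: leP => // i1; rewrite subscalarE.
rewrite (yW i); last by ilia.
rewrite (yW (i - 1)); last by ilia.
have [->|i2] := eqVneq i 0.
  by rewrite add0r y1; ring.
by rewrite (yW (i + 1)); [ring|ilia].
Qed.

Lemma big_periodic (f : nat -> R) (n N : nat) :
  (forall j, f (j + n)%N = f j) ->
  \sum_(0 <= j < N * n) f j = N%:R * \sum_(0 <= j < n) f j.
Proof.
move=> fn; elim: N => [|N IH]; first by rewrite mul0n big_geq// mul0r.
have fN j : f (j + N * n)%N = f j.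
  elim: N {IH} => [|N IH]; first by rewrite mul0n addn0.
  by rewrite mulSn [(n + _)%N]addnC addnA fn.
rewrite (@big_cat_nat _ _ _ (N * n)%N)//=; last by rewrite leq_mul2r leqnSn orbT.
rewrite IH mulSn -{1}[(N * n)%N]add0n big_addn addnK -natr1 mulrDl mul1r.
by congr (_ + _); apply: eq_bigr => j _; rewrite fN.
Qed.

(* Truncating X to N periods leaves a residual at the ends that is bounded
   independently of N. *)
Lemma periodic_approx (K D eps : R) (n : nat) Sa Sb Sc m (X : int -> C) lam :
  (forall a : C, (Sa `|` Sb `|` Sc) a -> cabs a <= K) ->
  tri_class Sa Sb Sc m -> 0 < eps -> (forall i, cabs (X i) <= D) ->
  (forall i, cabs (X (i + n%:Z)) = cabs (X i)) ->
  (forall i, cabs (subscalar (triop m) lam X (i + n%:Z)) =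
             cabs (subscalar (triop m) lam X i)) ->
  \sum_(0 <= j < n) cabs (subscalar (triop m) lam X j%:Z) ^+ 2 <
    eps ^+ 2 * \sum_(0 <= j < n) cabs (X j%:Z) ^+ 2 ->
  approx_on (fun=> true) Sa Sb Sc eps lam.
Proof.
move=> hK hm e0 hD Xn rn; set r := \sum_(0 <= j < n) _.
set s := \sum_(0 <= j < n) _ => rs.
have hS := band_bound_shift lam (tri_class_band_bound hK hm).
set K1 := K + cabs lam in hS; pose B := (3 * K1 * D) ^+ 2.
have D0 : 0 <= D by apply: le_trans (hD 0); exact: cabs_ge0.
have B0 : 0 <= B by exact: sqr_ge0.
have gap : 0 < eps ^+ 2 * s - r by rewrite subr_gt0.
(* The gain of N periods has to exceed the boundary cost 4 B. *)
have [N hN] : exists N : nat, 4 * B < N%:R * (eps ^+ 2 * s - r).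
  exists (Num.truncn (4 * B / (eps ^+ 2 * s - r))).+1.
  by rewrite -ltr_pdivrMr// truncnS_gt.
pose y := cutto (fun i => 0 <= i < (N * n)%N%:Z) X.
have bsum (f : int -> R) (M : nat) :
    \sum_(j < M) f j%:Z = \sum_(0 <= j < M) f j%:Z.
  by rewrite big_mkord.
have zy : zsum (nsq y) = (N%:R * s)%:E.
  rewrite (@zsum_window R 0 (N * n)); last first.
  - by move=> i hi; rewrite nsq_cutto ifF//; ilia.
  - by move=> i; exact: nsq_ge0.
  congr (_%:E); rewrite -(@big_periodic (fun j => cabs (X j%:Z) ^+ 2)).
    rewrite big_mkord; apply: eq_bigr => j _; rewrite nsq_cutto ifT.
      by rewrite add0r.
    by have := ltn_ord j; ilia.
  by move=> j; rewrite PoszD Xn.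
have Dy : ell2 y by rewrite /ell2/= -[sumsq _]/(zsum (nsq _)) zy ltry.
have qy : qnorm y = N%:R * s by apply: EFin_inj; rewrite -zsum_nsq.
exists m, y; split=> //; rewrite cutto_true qy.
pose rX := cutto (fun i => 0 <= i < (N * n)%N%:Z) (subscalar (triop m) lam X).
have zr : zsum (nsq rX) = (N%:R * r)%:E.
  rewrite (@zsum_window R 0 (N * n)); last first.
  - by move=> i hi; rewrite nsq_cutto ifF//; ilia.
  - by move=> i; exact: nsq_ge0.
  congr (_%:E).
  rewrite -(@big_periodic (fun j => cabs (subscalar (triop m) lam X j%:Z) ^+ 2)).
    rewrite big_mkord; apply: eq_bigr => j _; rewrite nsq_cutto ifT.
      by rewrite add0r.
    by have := ltn_ord j; ilia.
  by move=> j; rewrite PoszD rn.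
have y_le i : cabs (y i) <= D.
  by rewrite /y /cutto; case: ifP => // _; rewrite cabs0.
have res_le i : nsq (subscalar (triop m) lam y) i <= B.
  have h : cabs (subscalar (triop m) lam y i) <= 3 * K1 * D.
    by rewrite subscalar_triop; exact: cabs_triop_le.
  by rewrite /nsq /B ler_sqr ?nnegrE ?cabs_ge0//; apply: le_trans h; exact: cabs_ge0.
(* Only the rows -1, 0, M - 1 and M notice the truncation; each is charged B. *)
pose pt (c i : int) : R := if i == c then B else 0.
have pt0 c i : 0 <= pt c i by rewrite /pt; case: ifP.
pose M := (N * n)%N%:Z.
have hres i : nsq (subscalar (triop m) lam y) i <=
    nsq rX i + (pt (-1) i + pt 0 i + pt (M - 1) i + pt M i).
  have [|nb] := boolP ((i == -1) || (i == 0) || (i == M - 1) || (i == M)).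
    have q c : i = c -> pt c i = B by move=> ->; rewrite /pt eqxx.
    have h0 := nsq_ge0 rX i; have h := res_le i.
    have p1 := pt0 (-1) i; have p2 := pt0 0 i.
    have p3 := pt0 (M - 1) i; have p4 := pt0 M i.
    by move=> /orP[/orP[/orP[/eqP/q e|/eqP/q e]|/eqP/q e]|/eqP/q e]; lra.
  apply: (@le_trans _ _ (nsq rX i)); last first.
    by rewrite lerDl !addr_ge0.
  rewrite nsq_cutto; case: ifP => hi.
    rewrite /nsq !subscalarE /y /cutto !ifT//; ilia.
  by rewrite /nsq subscalarE /y /cutto !ifF; [rewrite !mulr0 !addr0 subr0 cabs0 expr0n|ilia..].
have zpt c : zsum (pt c) = B%:E by exact: zsum_single.
have : (zsum (nsq (subscalar (triop m) lam y)) <= (N%:R * r + 4 * B)%:E)%E.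
  apply: le_trans (le_zsum hres) _.
  have t2 i : 0 <= pt (-1) i + pt 0 i by exact: addr_ge0.
  have t3 i : 0 <= pt (-1) i + pt 0 i + pt (M - 1) i by exact: addr_ge0.
  have t4 i : 0 <= pt (-1) i + pt 0 i + pt (M - 1) i + pt M i by exact: addr_ge0.
  have t0 i : 0 <= nsq rX i by exact: nsq_ge0.
  rewrite (zsumD t0 t4) (zsumD t3 (pt0 M)) (zsumD t2 (pt0 (M - 1))).
  by rewrite (zsumD (pt0 (-1)) (pt0 0)) !zpt zr -!EFinD lee_fin; lra.
move=> /ell2_le_qnorm[_ h]; apply: le_lt_trans h _.
by move: hN; lra.
Qed.

End HalfLines.

Lemma linear_alternative (F : fieldType) (N : nat) (f : 'rV[F]_N -> 'rV[F]_N) :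
  (forall c u v, f (c *: u + v) = c *: f u + f v) ->
  (exists2 v, v != 0 & f v = 0) \/ forall w, exists v, f v = w.
Proof.
move=> fL.
pose G : 'M[F]_N := \matrix_(i, j) f (delta_mx 0 i) 0 j.
have f0 : f 0 = 0.
  by have := fL (-1) 0 0; rewrite scaler0 add0r scaleN1r addNr.
have fG v : f v = v *m G.
  rewrite {1}(row_sum_delta v).
  have fsum (r : seq 'I_N) : f (\sum_(i <- r) v 0 i *: delta_mx 0 i) =
      \sum_(i <- r) v 0 i *: f (delta_mx 0 i).
    elim: r => [|i r IH]; first by rewrite !big_nil.
    by rewrite !big_cons fL IH.
  rewrite fsum; apply/rowP => j; rewrite summxE mxE.
  by apply: eq_bigr => i _; rewrite !mxE.
have [Gu|Gs] := boolP (G \in unitmx); [right=> w|left].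
  by exists (w *m invmx G); rewrite fG mulmxKV.
have : kermx G != 0 by rewrite kermx_eq0 row_free_unit.
move=> /rowV0Pn[v vG v0]; exists v => //.
by rewrite fG; apply/sub_kermxP.
Qed.

Lemma geometric_ell2 (R : realType) (zeta : Cplx R) (N : int) : cabs zeta < 1 ->
  ell2 (fun i : int => if (N < i) then zeta ^+ (absz (i - N)%R) else 0).
Proof.
move=> z1; set x := (fun i : int => _).
pose r := cabs zeta ^+ 2.
have r0 : 0 <= r by exact: sqr_ge0.
have r1 : r < 1 by rewrite expr_lt1// cabs_ge0.
have r1' : 0 < 1 - r by rewrite subr_gt0.
(* (F i - F (i + 1)) / (1 - r) dominates the squared entries, with equality on the tail, and
   telescopes. *)
pose F (i : int) : R := if N < i then r ^+ (absz (i - N)%R) else 1.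
have F0 i : 0 <= F i by rewrite /F; case: ifP => // _; rewrite exprn_ge0.
have F1 i : F i <= 1 by rewrite /F; case: ifP => // _; rewrite exprn_ile1// ltW.
apply: (@qnorm_le_ssum _ _ (1 - r)^-1 _).1 => M.
have pt i : nsq x i <= (1 - r)^-1 * (F i - F (i + 1)).
  rewrite /nsq /x /F; case: ifP => Ni.
    rewrite ifT; last by ilia.
    have -> : (absz (i + 1 - N)%R) = (absz (i - N)%R).+1 by ilia.
    have -> : cabs (zeta ^+ absz (i - N)%R) ^+ 2 = r ^+ absz (i - N)%R.
      by rewrite cabsX -!exprM mulnC.
    rewrite [r ^+ _.+1]exprS le_eqVlt; apply/orP; left; apply/eqP.
    by field; rewrite gt_eqF.
  rewrite cabs0 expr0n/=; case: ifP => _; rewrite ?subrr ?mulr0//.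
  by rewrite mulr_ge0 ?invr_ge0 ?(ltW r1')// subr_ge0 exprn_ile1// ltW.
apply: (@le_trans _ _ (ssum M (fun i => (1 - r)^-1 * (F i - F (i + 1))))).
  by apply: ler_sum => k _; exact: pt.
rewrite ssumZ ler_piMr ?invr_ge0 ?(ltW r1')// /ssum.
rewrite (eq_bigr (fun k : 'I_M.*2.+1 => - (F ((k : nat).+1%:Z - M%:Z) -
    F ((k : nat)%:Z - M%:Z)))); last first.
  by move=> k _; rewrite opprB; congr (_ - F _); ilia.
rewrite sumrN -(big_mkord xpredT (fun k => F (k.+1%:Z - M%:Z) - F (k%:Z - M%:Z))).
rewrite telescope_sumr// opprB; apply: le_trans (F1 (0%N%:Z - M%:Z)).
by rewrite lerBlDr lerDl.
Qed.

Lemma sin_le_id (R : realType) (t : R) : 0 <= t -> sin t <= t.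
Proof.
move=> t0; have [||c _] := @MVT_segment R (@sin R) (@cos R) 0 t.
- exact: t0.
- by apply: continuous_subspaceT => x; exact: continuous_sin.
rewrite sin0 !subr0 => ->; rewrite ler_piMl//; exact: cos_le1.
Qed.

Lemma pen_small (R : realType) (K p : R) : 0 <= K -> 0 < p ->
  exists2 n, (0 < n)%N & 4 * K * sin (pi / (2 * (n%:R + 1))) <= p.
Proof.
move=> K0 p0; pose n := (Num.truncn (2 * K * pi / p)).+1.
have hn : 2 * K * pi / p < n%:R by exact: truncnS_gt.
exists n => //; have n0 : 0 < n%:R + 1 :> R by rewrite ltr_wpDl.
have t0 : 0 <= pi / (2 * (n%:R + 1)) :> R.
  by rewrite divr_ge0 ?pi_ge0// mulr_ge0// ltW.
apply: le_trans (_ : 4 * K * (pi / (2 * (n%:R + 1))) <= _).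
  by rewrite ler_wpM2l ?mulr_ge0// sin_le_id.
have -> : 4 * K * (pi / (2 * (n%:R + 1))) = 2 * K * pi / (n%:R + 1) :> R.
  by field; rewrite gt_eqF.
by rewrite ler_pdivrMr//; move: hn; rewrite ltr_pdivrMr//; lra.
Qed.

(** * A Coburn type alternative on the half-line *)

Section Coburn.
Variable R : realType.
Local Notation C := (Cplx R).
Implicit Types (x y z : int -> C) (m : int -> int -> C) (Sa Sb Sc : set C).

(* The matrix of x is continued to the right of supp x by the Laurent matrix
   (a, b, c). The transposed half-line equation then reduces to an N x N system
   with geometric tail zeta^j, which either has a kernel or can be solved with
   right-hand side conj x; in both cases its solution u is an approximate
   eigenvector of the transposed half-line operator. *)
Lemma half_line_reflect (K eps eps' : R) Sa Sb Sc lam (a b c zeta : C) :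
  (forall a : C, (Sa `|` Sb `|` Sc) a -> cabs a <= K) ->
  Sa a -> Sb b -> Sc c -> cabs zeta < 1 ->
  a * zeta ^+ 2 + (b - lam) * zeta + c = 0 ->
  0 < eps -> eps < eps' ->
  approx_on (fun i => 1 <= i) Sa Sb Sc eps lam ->
  approx_on (fun i => 1 <= i) Sc Sb Sa eps' lam.
Proof.
move=> hK Saa Sbb Scc z1 root e0 ee happ.
have K0 : 0 <= K by apply: le_trans (hK a _); [exact: cabs_ge0|left; left].
have p0 : 0 < eps' - eps by rewrite subr_gt0.
have [n n0 hn] : exists2 n, (0 < n)%N &
    4 * K * sin (pi / (2 * (n%:R + 1))) <= eps' - eps.
  exact: pen_small.
have [k [m0 [y [hm0 yk yW Dy hy]]]] := approx_on_localize hK n0 e0 p0 hn happ.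
rewrite [eps + _]addrC subrK in hy.
have e'0 : 0 < eps' by exact: lt_trans ee.
have [N yN] : exists N : nat, forall i, ~~ (1 <= i <= N.+1%:Z) -> y i = 0.
  exists (absz (k + n%:Z)%R) => i hi; have [i1|i1] := leP 1 i; last by rewrite yW//; ilia.
  by rewrite yk//; ilia.
pose L (i j : int) : C := if i == j + 1 then a else if i == j then b else c.
(* Columns beyond N + 1 meet zeros of y, so replacing them by the Laurent symbol leaves the residual
   of y unchanged. *)
pose m (i j : int) : C := if j <= N.+1%:Z then m0 i j else L i j.
have hm : tri_class Sa Sb Sc m.
  move=> j; rewrite /m /L; case: ifP => _; first exact: hm0.
  rewrite !eqxx; have /negbTE -> : j != j + 1 by ilia.
  have /negbTE -> : j - 1 != j + 1 by ilia.
  have /negbTE -> : j - 1 != j by ilia.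
  by split.
have my i j : m i j * y j = m0 i j * y j.
  by rewrite /m; case: ifP => // jN; rewrite yN ?mulr0//; ilia.
have hry : subscalar (triop m) lam y = subscalar (triop m0) lam y.
  by apply/funext => i; rewrite !subscalarE !my.
rewrite -hry in hy.
(* N + 1 free values followed by a geometric tail that starts at the last of them, so no matching
   condition is left. *)
pose ext (v : 'rV[C]_N.+1) : int -> C := fun i =>
  if i <= 0 then 0 else if i <= N.+1%:Z then v 0 (inord `|i|%N.-1)
  else v 0 ord_max * zeta ^+ (absz (i - N.+1%:Z)%R).
have extL s v w : ext (s *: v + w) = fun i => s * ext v i + ext w i.
  apply/funext => i; rewrite /ext; case: ifP => _; first by rewrite mulr0 addr0.
  by case: ifP => _; rewrite !mxE//; ring.
pose T := subscalar (triop (transp m)) lam.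
pose f (v : 'rV[C]_N.+1) : 'rV[C]_N.+1 := \row_j T (ext v) (j%:Z + 1).
have fL s v w : f (s *: v + w) = s *: f v + f w.
  apply/rowP => j; rewrite !mxE /T extL !subscalarE; ring.
have ext_ell2 v : ell2 (ext v).
  pose u1 : int -> C := cutto (fun i => i <= N.+1%:Z) (ext v).
  have Du1 : ell2 u1.
    apply: (@qnorm_finsupp _ N.+1 _ _).1 => i iN; rewrite /u1 /cutto /ext.
    by case: ifP => // h1; case: ifP => // h2; ilia.
  have -> : ext v = v 0 ord_max *:
      (fun i : int => if (N.+1%:Z < i) then zeta ^+ absz (i - N.+1%:Z)%R else 0)
      + u1.
    apply/funext => i; change (ext v i = v 0 ord_max *
      (if (N.+1%:Z < i) then zeta ^+ absz (i - N.+1%:Z)%R else 0) + u1 i).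
    rewrite /u1 /cutto /ext; case: (leP i N.+1%:Z) => h; first by rewrite mulr0 add0r.
    by rewrite addr0 ifF//; ilia.
  by apply: ell2_lin => //; exact: geometric_ell2.
(* Beyond N + 1 the transposed rows read c, b - lam, a, and the equation for zeta makes the tail an
   exact solution. *)
have Text v i : N.+1%:Z < i -> T (ext v) i = 0.
  move=> iN; rewrite /T subscalarE /transp.
  have iN' : i <= N.+1%:Z = false by ilia.
  pose e := absz (i - 1 - N.+1%:Z)%R.
  have -> : m (i - 1) i = c.
    rewrite /m /L iN'.
    have /negbTE -> : i - 1 != i + 1 by ilia.
    by have /negbTE -> : i - 1 != i by ilia.
  have -> : m i i = b.
    by rewrite /m /L iN' eqxx; have /negbTE -> : i != i + 1 by ilia.
  have -> : m (i + 1) i = a by rewrite /m /L iN' eqxx.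
  have -> : ext v (i - 1) = v 0 ord_max * zeta ^+ e.
    rewrite /ext ifF; last by ilia.
    case: ifP => // h; rewrite (_ : inord _ = ord_max).
      by rewrite /e (_ : absz _ = 0%N) ?expr0 ?mulr1//; ilia.
    by apply: val_inj => /=; rewrite inordK; ilia.
  have -> : ext v i = v 0 ord_max * zeta ^+ e.+1.
    rewrite /ext ifF; last by ilia.
    by rewrite iN' /e; congr (_ * _ ^+ _); ilia.
  have -> : ext v (i + 1) = v 0 ord_max * zeta ^+ e.+2.
    rewrite /ext ifF; last by ilia.
    by rewrite ifF; [rewrite /e; congr (_ * _ ^+ _); ilia|ilia].
  rewrite !exprS -[RHS](mulr0 (v 0 ord_max * zeta ^+ e)) -root; ring.
have fE v i : 1 <= i <= N.+1%:Z -> T (ext v) i = f v 0 (inord (absz i).-1).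
  move=> hi; rewrite mxE inordK; last by ilia.
  by congr (T _ _); ilia.
(* A kernel vector has residual zero; otherwise the system is solved for conj y. *)
have [[v v0 fv]|fsol] := linear_alternative fL.
  exists (transp m), (ext v); split.
  - exact: tri_class_transp.
  - exact: ext_ell2.
  - by move=> i hi; rewrite /ext ifT//; ilia.
  rewrite (_ : cutto _ _ = 0).
    rewrite -l2norm_sqr l2norm0 expr0n/=.
    have [j vj] : exists j, v 0 j != 0.
      apply/existsP; apply: contra_neqT v0; rewrite negb_exists => /forallP h.
      by apply/rowP => j; have := h j; rewrite negbK mxE => /eqP.
    rewrite mulr_gt0 ?exprn_gt0//.
    apply: lt_le_trans (nsq_le_qnorm (j%:Z + 1) (ext_ell2 v)).
    rewrite exprn_gt0// cabs_gt0 /ext ifF; last by ilia.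
    rewrite ifT; last by have := ltn_ord j; ilia.
    rewrite (_ : inord _ = j)//; apply: val_inj => /=; have := ltn_ord j => jN.
    by rewrite inordK; ilia.
  apply/funext => i; rewrite /cutto; case: ifP => // i1.
  have [iN|iN] := ltP N.+1%:Z i; first exact: Text.
  by rewrite -/T fE ?fv ?mxE//; ilia.
have [v fv] := fsol (\row_j (y (j%:Z + 1))^* ).
have conj_y0 i : ~~ (1 <= i <= N.+1%:Z) -> (y i)^* = 0.
  by move=> hi; rewrite yN// conjC0.
have TE i : 1 <= i -> T (ext v) i = (y i)^*.
  move=> i1; have [iN|iN] := ltP N.+1%:Z i; first by rewrite Text// conj_y0//; ilia.
  rewrite fE ?fv ?mxE ?inordK; [|by ilia|by ilia].
  by congr ((y _)^* ); ilia.
exists (transp m), (ext v); split.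
- exact: tri_class_transp.
- exact: ext_ell2.
- by move=> i hi; rewrite /ext ifT//; ilia.
have -> : qnorm (cutto (fun i => 1 <= i) (subscalar (triop (transp m)) lam (ext v)))
    = qnorm y.
  rewrite -!l2norm_sqr -(l2norm_conj y); congr (l2norm _ ^+ 2).
  apply/funext => i; rewrite /cutto; case: ifP => i1; first exact: TE.
  by rewrite conj_y0//; ilia.
set r := qnorm _ in hy.
(* The adjoint identity needs finite supports; the cut-off at M is invisible in the rows 1..N+1 that
   carry y. *)
pose M := N.+4.
pose u' := cutto (fun i => (`|i| < M)%N) (ext v).
have y_out i : (M <= `|i|)%N -> y i = 0 by rewrite /M => hi; rewrite yN//; ilia.
have [_ qy] : ell2 y /\ qnorm y = ssum M (nsq y).
  by apply: qnorm_finsupp => i hi; apply: y_out; ilia.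
have u'_out i : (M <= `|i|)%N -> (u' i)^* = 0.
  by move=> hi; rewrite /u' /cutto ifF ?conjC0//; ilia.
have adjE := @adjoint_identity R M (shiftmat m lam) y (fun i => (u' i)^* ) y_out u'_out.
(* As T u = conj y for u = [ext v], moving the operator from u to y expresses |y|^2 through the
   residual of y. *)
have qyE : qnorm y = ssum M (fun i => ip (triop (shiftmat m lam) y i) (u' i)^* ).
  rewrite qy adjE.
  apply: eq_bigr => j _; set i := _ - _.
  rewrite triop_adj.
  have -> : (fun i => (u' i)^*^* ) = u' by apply/funext => ?; rewrite conjCK.
  rewrite transp_shiftmat -subscalar_triop -/T.
  have [hi|hi] := boolP (1 <= i <= N.+1%:Z); last first.
    by rewrite /nsq yN// ip0l cabs0 expr0n.
  have -> : T u' i = T (ext v) i.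
    by rewrite /T !subscalarE /u' /cutto !ifT//; rewrite /M; ilia.
  by rewrite TE; [rewrite conjCK ipxx|ilia].
have ip_le (s t : C) (q : R) : 0 < q ->
    ip s t <= 2^-1 * (q * cabs s ^+ 2 + q^-1 * cabs t ^+ 2).
  move=> q0; have h1 : ip s t <= cabs s * cabs t.
    apply: le_trans (ler_norm _) _; apply: le_trans (cabs_re _) _.
    by rewrite cabsM cabs_conj.
  apply: le_trans h1 _; rewrite -subr_ge0.
  have -> : 2^-1 * (q * cabs s ^+ 2 + q^-1 * cabs t ^+ 2) - cabs s * cabs t =
      2^-1 * (q * (cabs s - q^-1 * cabs t) ^+ 2) by field; rewrite gt_eqF.
  by rewrite mulr_ge0// mulr_ge0 ?sqr_ge0// ltW.
(* With this weight |y|^2 <= (q r + eps'^2 |u|^2) / 2 for u = [ext v], while q r < |y|^2; hence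
   |y|^2 < eps'^2 |u|^2. *)
pose q := (eps' ^+ 2)^-1.
have q0 : 0 < q by rewrite invr_gt0 exprn_gt0.
have Dres : ell2 (subscalar (triop m) lam y) by exact: (tri_class_ell2 lam hK hm Dy).
have main : qnorm y <= 2^-1 * (q * r + q^-1 * qnorm (ext v)).
  rewrite {1}qyE.
  apply: (@le_trans _ _ (ssum M (fun i => 2^-1 * (q * nsq (cutto (fun i => 1 <= i)
     (subscalar (triop m) lam y)) i + q^-1 * nsq (ext v) i)))).
    apply: ler_sum => j _; set i := _ - _.
    have [i0|i1] := leP i 0.
      have -> : u' i = 0 by rewrite /u' /cutto /ext i0 if_same.
      have qi0 : 0 <= q^-1 by rewrite invr_ge0 ltW.
      rewrite conjC0 ip0r; apply: mulr_ge0 => //.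
      by rewrite addr_ge0// mulr_ge0 ?nsq_ge0// ltW.
    apply: le_trans (ip_le _ _ q q0) _; rewrite ler_pM2l ?invr_gt0//.
    apply: lerD; first by rewrite nsq_cutto ifT ?subscalar_triop//; ilia.
    rewrite ler_pM2l ?invr_gt0 ?exprn_gt0// cabs_conj /u' /cutto; case: ifP => // _.
    by rewrite cabs0 expr0n sqr_ge0.
  rewrite ssumZ ssumD !ssumZ ler_pM2l ?invr_gt0//; apply: lerD.
    by rewrite ler_pM2l//; apply: ssum_le_qnorm; exact: (qnorm_cutto _ Dres).1.
  by rewrite ler_pM2l ?invr_gt0 ?exprn_gt0//; apply: ssum_le_qnorm; exact: ext_ell2.
have qr : q * r < qnorm y by rewrite /q mulrC ltr_pdivrMr ?exprn_gt0// mulrC.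
by rewrite /q invrK in main; move: main qr; rewrite /q; lra.
Qed.

End Coburn.

(** * Finite sections of pseudoergodic operators *)

Section FiniteMatrices.
Variable R : realType.
Local Notation C := (Cplx R).

Definition emb (n : nat) (k : int) (v : 'cV[C]_n) : int -> C := fun i =>
  if k + 1 <= i then
    (if insub (absz (i - (k + 1))%R) is Some j then v j 0 else 0) else 0.

Lemma embE n k (v : 'cV[C]_n) (j : 'I_n) : emb k v (k + 1 + j%:Z) = v j 0.
Proof.
rewrite /emb ifT; last by ilia.
rewrite (_ : absz _ = j); last by ilia.
by rewrite valK.
Qed.

Lemma emb_out n k (v : 'cV[C]_n) i : ~~ (k + 1 <= i <= k + n%:Z) -> emb k v i = 0.
Proof.
move=> hi; rewrite /emb; case: ifP => // ki; rewrite insubF//; ilia.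
Qed.

Lemma emb_lin n k (c : C) (u v : 'cV[C]_n) :
  emb k (c *: u + v) = c *: emb k u + emb k v.
Proof.
apply/funext => i; change (emb k (c *: u + v) i = c * emb k u i + emb k v i).
rewrite /emb; case: ifP => _; last by rewrite mulr0 addr0.
by case: insub => [j|]; rewrite ?mxE// mulr0 addr0.
Qed.

Lemma qnorm_emb n k (v : 'cV[C]_n) :
  ell2 (emb k v) /\ qnorm (emb k v) = \sum_(j < n) cabs (v j 0) ^+ 2.
Proof.
have z : zsum (nsq (emb k v)) = (\sum_(j < n) cabs (v j 0) ^+ 2)%:E.
  rewrite (@zsum_window R (k + 1) n).
  - by congr (_%:E); apply: eq_bigr => j _; rewrite /nsq embE.
  - by move=> i; exact: nsq_ge0.
  - by move=> i hi; rewrite /nsq emb_out ?cabs0 ?expr0n//; ilia.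
have D : ell2 (emb k v) by rewrite /ell2/= -[sumsq _]/(zsum (nsq _)) z ltry.
by split=> //; apply: EFin_inj; rewrite -zsum_nsq.
Qed.

Lemma eucl_emb n k (v : 'cV[C]_n) : eucl v = l2norm (emb k v).
Proof. by rewrite /l2norm -/(qnorm _) (qnorm_emb k v).2. Qed.

Lemma hilbertian_eucl n : hilbertian setT (@eucl R n).
Proof.
have [_ _ [hZ hdef] hD hP] := hilbertian_ell2 R.
have De (v : 'cV[C]_n) : ell2 (emb 0 v) by exact: (qnorm_emb 0 v).1.
have e0 : emb 0 (0 : 'cV[C]_n) = 0.
  by have := emb_lin 0 (-1) (0 : 'cV[C]_n) 0; rewrite scaler0 addr0 scaleN1r addNr.
have eD (u v : 'cV[C]_n) : emb 0 (u + v) = emb 0 u + emb 0 v.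
  by have := emb_lin 0 1 u v; rewrite !scale1r.
have eZ (c : C) (v : 'cV[C]_n) : emb 0 (c *: v) = c *: emb 0 v.
  by have := emb_lin 0 c v 0; rewrite e0 !addr0.
split=> //.
- by move=> x; rewrite (eucl_emb 0) l2norm_ge0.
- split=> [c x _|x _]; rewrite !(eucl_emb 0); first by rewrite eZ hZ.
  move/hdef => /(_ (De x)) h; apply/colP => j.
  by rewrite -(embE 0) h mxE.
- by move=> x y _ _; rewrite !(eucl_emb 0) eD; exact: hD.
- move=> x y _ _; rewrite !(eucl_emb 0) -scaleN1r !eD eZ scaleN1r.
  exact: hP.
Qed.

Lemma linear_on_mx n (M : 'M[C]_n) : linear_on setT (mulmx M : 'cV[C]_n -> 'cV[C]_n).
Proof. by split=> // c x y _ _; rewrite mulmxDr scalemxAr. Qed.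

Lemma subscalar_mx n (M : 'M[C]_n) (lam : C) (v : 'cV[C]_n) :
  subscalar (mulmx M) lam v = (M - lam%:M) *m v.
Proof. by rewrite /subscalar mulmxBl mul_scalar_mx. Qed.

(** For a square matrix a lower bound already gives invertibility, so no second condition on the
    transpose appears. *)
Lemma spec_mxP n (M : 'M[C]_n) (eps : R) (lam : C) : 0 < eps ->
  spec_mx eps M lam <->
  exists v : 'cV[C]_n, eucl (subscalar (mulmx M) lam v) < eps * eucl v.
Proof.
move=> e0; have HE := hilbertian_eucl n.
have HM := linear_on_mx M.
have HS := linear_on_subscalar HE lam HM.
rewrite /spec_mx; split=> [/(spec_epsP HE (mulmx M) lam e0)|[v hv]]; last first.
  apply/(spec_epsP HE _ _ e0) => g; move: hv; apply/negP; rewrite -leNgt.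
  exact: (inv_bounded_lower HS.1 g).
move=> ng; apply: contrapT => /forallNP h; apply: ng.
have low (v : 'cV[C]_n) : [set: 'cV[C]_n] v ->
    eps * eucl v <= eucl (subscalar (mulmx M) lam v).
  by move=> _; rewrite leNgt; apply/negP; exact: h.
apply: (lower_inv_bounded HE e0 HS low).
have unit : M - lam%:M \in unitmx.
  rewrite -unitmx_tr -row_free_unit -kermx_eq0.
  apply/negPn/negP => /rowV0Pn[v vG v0].
  have := low v^T I; rewrite subscalar_mx.
  rewrite (_ : _ *m v^T = 0); last first.
    by apply: trmx_inj; rewrite trmx_mul trmxK trmx0; apply/sub_kermxP.
  have -> : eucl (0 : 'cV[C]_n) = 0.
    have [_ _ [hZ _] _ _] := HE; have := hZ 0 0 I.
    by rewrite scale0r cabs0 mul0r.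
  rewrite pmulr_rle0// => hle.
  have [_ hge [_ hdef] _ _] := HE.
  have /hdef : eucl v^T = 0 by apply/eqP; rewrite eq_le hle hge.
  move=> /(_ I) vT; case/negP: v0; apply/eqP; apply: trmx_inj.
  by rewrite vT trmx0.
move=> f _; exists (invmx (M - lam%:M) *m f) => //.
by rewrite subscalar_mx mulKVmx.
Qed.

Lemma sum_single_window (n : nat) (s c : int) (a : C) :
  (~~ (s <= c < s + n%:Z) -> a = 0) ->
  \sum_(j < n) (if s + j%:Z == c then a else 0) = a.
Proof.
have [hc _|hc /(_ isT) ->] := boolP (s <= c < s + n%:Z); last first.
  by rewrite big1// => j _; rewrite if_same.
have jb : (absz (c - s)%R < n)%N by ilia.
rewrite (bigD1 (Ordinal jb))//= big1 ?addr0.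
  by rewrite ifT//; ilia.
move=> j jn; case: eqP => // e; case/eqP: jn; apply: val_inj => /=; ilia.
Qed.

(** Reduces a row of a matrix product to three terms; F vanishes outside the window, so the end rows
    need no separate treatment. *)
Lemma band_sum (n : nat) (s r : int) (F : int -> C) :
  (forall c, ~~ (s <= c < s + n%:Z) -> F c = 0) ->
  (forall c, (1 < `|c - r|)%N -> F c = 0) ->
  \sum_(j < n) F (s + j%:Z) = F (r - 1) + F r + F (r + 1).
Proof.
move=> Fout Fband.
rewrite -[F (r - 1)](@sum_single_window n s (r - 1)); last exact: Fout.
rewrite -[F r](@sum_single_window n s r); last exact: Fout.
rewrite -[F (r + 1)](@sum_single_window n s (r + 1)); last exact: Fout.
rewrite -!big_split /=; apply: eq_bigr => j _; set i := s + j%:Z.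
have [->|i1] := eqVneq i (r - 1).
  rewrite ifF; last by ilia.
  by rewrite ifF ?addr0//; ilia.
have [->|i2] := eqVneq i r; first by rewrite ifF ?add0r ?addr0//; ilia.
have [->|i3] := eqVneq i (r + 1); first by rewrite !add0r.
by rewrite !addr0 Fband//; ilia.
Qed.

Lemma trimat_band (al be ga : int -> C) i j : (1 < `|j - i|)%N ->
  trimat al be ga i j = 0.
Proof.
move=> h; rewrite /trimat.
have /negbTE -> : i != j + 1 by ilia.
have /negbTE -> : i != j by ilia.
by have /negbTE -> : i != j - 1 by ilia.
Qed.

Lemma finsec_mul (al be ga : int -> C) n k (v : 'cV[C]_n) (i : 'I_n) :
  (finsec (trimat al be ga) n k *m v) i 0 =
  triop (trimat al be ga) (emb k v) (k + 1 + i%:Z).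
Proof.
rewrite mxE; set A := trimat _ _ _; set r := k + 1 + i%:Z.
rewrite (eq_bigr (fun j : 'I_n => A r (k + 1 + j%:Z) * emb k v (k + 1 + j%:Z))).
  rewrite (@band_sum n (k + 1) r (fun c => A r c * emb k v c))//.
    by move=> c hc; rewrite emb_out ?mulr0//; ilia.
  by move=> c hc; rewrite /A trimat_band ?mul0r//; ilia.
by move=> j _; rewrite embE mxE.
Qed.

Lemma tri_class_trimat (Sa Sb Sc : set C) (al be ga : int -> C) :
  (forall j, [/\ Sa (al j), Sb (be j) & Sc (ga j)]) ->
  tri_class Sa Sb Sc (trimat al be ga).
Proof.
move=> h j; have [h1 h2 h3] := h j; rewrite /trimat !eqxx.
have /negbTE -> : j != j + 1 by ilia.
have /negbTE -> : j - 1 != j + 1 by ilia.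
by have /negbTE -> : j - 1 != j by ilia.
Qed.

Lemma mxnorm_entry n (M : 'M[C]_n) (d : R) i j :
  (mxnorm M < d%:E)%E -> cabs (M i j) <= d.
Proof.
move=> h; have HE := hilbertian_eucl n.
have d0 : 0 <= d.
  by rewrite -lee_fin; apply: le_trans (ltW h); exact: opnorm_ge0 HE _.
have := (opnorm_leP HE (linear_on_mx M) d0).1 (ltW h) (delta_mx j 0) I.
have -> : eucl (delta_mx j 0 : 'cV[C]_n) = 1.
  rewrite /eucl (bigD1 j)//= big1 ?addr0.
    by rewrite mxE !eqxx cabs1 expr1n sqrtr1.
  by move=> l lj; rewrite mxE (negbTE lj) cabs0 expr0n.
rewrite mulr1; apply: le_trans.
rewrite -colE -[leLHS]ger0_norm ?cabs_ge0// -sqrtr_sqr /eucl ler_wsqrtr//.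
rewrite (bigD1 i)//= mxE lerDl; apply: sumr_ge0 => l _; exact: sqr_ge0.
Qed.

End FiniteMatrices.

Section Pseudoergodic.
Variable R : realType.
Local Notation C := (Cplx R).
Variables (Sa Sb Sc : set C) (al be ga : int -> C) (K : R).
Hypothesis hK : forall a : C, (Sa `|` Sb `|` Sc) a -> cabs a <= K.
Hypothesis A_pe : pseudoergodic Sa Sb Sc al be ga.
Let A := trimat al be ga.
Implicit Types (x y : int -> C).

Lemma class_bound_ge0 : 0 <= K.
Proof.
have [[h _ _] _] := (A_pe.1 0, A_pe.2).
by apply: le_trans (hK (or_introl (or_introl h))); exact: cabs_ge0.
Qed.

Lemma class_bound_sym (a : C) : (Sc `|` Sb `|` Sa) a -> cabs a <= K.
Proof. by move=> [[h|h]|h]; apply: hK; [right|left; right|left; left]. Qed.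

Lemma tri_class_A : tri_class Sa Sb Sc A.
Proof. exact: tri_class_trimat A_pe.1. Qed.

Lemma band_A : band_bound K A.
Proof. exact: tri_class_band_bound hK tri_class_A. Qed.

(** The vector is cut to n sites; the block of the admissible matrix around them recurs in A up to a
    small error, and the vector is moved there. The gap between e1 and eps pays for the cut and for
    the block error. *)
Lemma approx_transfer eps lam : 0 < eps ->
  approx_on (fun=> true) Sa Sb Sc eps lam -> exists y, almost_eigen A lam eps y.
Proof.
move=> e0 [m0 [x [hm0 Dx _ hx]]].
have [e1 /andP[e10 e1e] hx1] := sqr_gap e0 (qnorm_ge0 x) hx.
have p0 : 0 < (eps - e1) / 2 by rewrite divr_gt0// subr_gt0.
have [n n0 hn] := pen_small class_bound_ge0 p0.
have happ : approx_on (fun=> true) Sa Sb Sc e1 lam by exists m0, x.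
have [k [m [y [hm yk _ Dy hy]]]] := approx_on_localize hK n0 e10 p0 hn happ.
rewrite cutto_true in hy; set e2 := e1 + _ in hy.
have e20 : 0 < e2 by rewrite addr_gt0.
(* A tridiagonal error with entries bounded by d has norm at most 3 d. *)
have d0 : 0 < (eps - e2) / 3 by rewrite divr_gt0// /e2; lra.
set d := (eps - e2) / 3 in d0.
(* The sites k..k+n+1: the support of y and its two neighbours, that is, all rows that see y. *)
pose B : 'M[C]_n.+2 := \matrix_(i, j)
  if (`|i%:Z - j%:Z| <= 1)%N then m (k + i%:Z) (k + j%:Z) else 0.
have hB : tridiag_in Sa Sb Sc B.
  move=> i j; split; rewrite mxE.
  - move=> e; rewrite ifT; last by rewrite e; ilia.
    have [h _ _] := hm (k + j%:Z).
    by rewrite (_ : k + i%:Z = k + j%:Z + 1)// e; ilia.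
  - by move=> ->; rewrite subrr; have [_ h _] := hm (k + j%:Z).
  - move=> e; rewrite ifT; last by rewrite e; ilia.
    have [_ _ h] := hm (k + j%:Z).
    by rewrite (_ : k + i%:Z = k + j%:Z - 1)// e; ilia.
  - by move=> h; rewrite ifF//; ilia.
have [k' hk'] := A_pe.2 d n.+2 B d0 isT hB.
pose s := k' + 1 - k.
pose inw (i : int) := k <= i < k + n.+2%:Z.
pose D (i j : int) : C := if inw i && inw j then A (i + s) (j + s) - m i j else 0.
have Dentry (i j : int) : (`|i - j| <= 1)%N -> cabs (D i j) <= d.
  move=> ij; rewrite /D; case: ifP => [/andP[iw jw]|_]; last by rewrite cabs0 ltW.
  have ib : (absz (i - k)%R < n.+2)%N by move: iw; rewrite /inw; ilia.
  have jb : (absz (j - k)%R < n.+2)%N by move: jw; rewrite /inw; ilia.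
  have := mxnorm_entry (Ordinal ib) (Ordinal jb) hk'.
  have ie : k + (absz (i - k)%R)%:Z = i by move: iw; rewrite /inw; ilia.
  have je : k + (absz (j - k)%R)%:Z = j by move: jw; rewrite /inw; ilia.
  rewrite !mxE /= ifT; last by move: iw jw ij; rewrite /inw; ilia.
  rewrite ie je.
  have -> : k' + 1 + (absz (i - k)%R)%:Z = i + s by rewrite /s -[in RHS]ie; ilia.
  by have -> : k' + 1 + (absz (j - k)%R)%:Z = j + s by rewrite /s -[in RHS]je; ilia.
have hD : band_bound d D by move=> i; split; apply: Dentry; ilia.
pose m' i j := A (i + s) (j + s).
have m'E i j : (`|i - j| <= 1)%N -> m' i j * y j = m i j * y j + D i j * y j.
  move=> ij; rewrite /D; case: ifP => [_|/negbT h]; first by rewrite /m'; ring.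
  by rewrite yk ?mulr0 ?addr0//; move: h; rewrite /inw; ilia.
have resE : subscalar (triop m') lam y = subscalar (triop m) lam y + triop D y.
  apply/funext => i.
  change (subscalar (triop m') lam y i = subscalar (triop m) lam y i + triop D y i).
  by rewrite !subscalarE /triop !m'E; [ring|ilia..].
have Dres : ell2 (subscalar (triop m) lam y) by exact: (tri_class_ell2 lam hK hm Dy).
have lt1 : l2norm (subscalar (triop m') lam y) < eps * l2norm y.
  rewrite resE; apply: le_lt_trans (l2normD Dres (triop_qnorm hD Dy).1) _.
  rewrite lt_l2norm// in hy.
  apply: lt_le_trans (ltr_leD hy (triop_l2norm hD Dy)) _.
  by rewrite -mulrDl /d ler_wpM2r ?l2norm_ge0//; lra.
exists (fun i => y (i - s)); split; first by apply/(ell2_shift (- s)).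
rewrite (qnorm_shift (- s)) -[qnorm (subscalar _ _ _)](qnorm_shift s).
rewrite (_ : (fun i => _) = subscalar (triop m') lam y); first by rewrite lt_l2norm.
apply/funext => i; rewrite !subscalar_at /m' addrK -(triop_shift s).
by congr (triop _ _ _ - _); apply/funext => j; rewrite addrK.
Qed.

(** An approximate eigenvector of the transpose is as good as one of A: transposition exchanges the
    outer alphabets, and reflection of the line exchanges them back. *)
Lemma spec_approx eps lam : 0 < eps ->
  spec_l2 eps A lam <-> approx_on (fun=> true) Sa Sb Sc eps lam.
Proof.
move=> e0; split=> [/(spec_almost_eigen band_A e0)[[x [Dx hx]]|[x [Dx hx]]]|].
- by exists A, x; split=> //; exact: tri_class_A.
- apply: (approx_on_reflect 0 (W := fun=> true)).
  exists (transp A), x; split=> //; exact: tri_class_transp tri_class_A.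
- move=> /(approx_transfer e0)[y hy]; exact: almost_eigen_spec band_A e0 hy.
Qed.

(** A crude bound, used for sections of size one, where no localizing window fits: each outer
    diagonal adds at most K. *)
Lemma approx_on_whole_line (n : nat) (eps : R) lam : 0 < eps ->
  approx_on (fun i => 1 <= i <= n%:Z) Sa Sb Sc eps lam ->
  approx_on (fun=> true) Sa Sb Sc (eps + 2 * K) lam.
Proof.
have K0 := class_bound_ge0.
move=> e0 [m [x [hm Dx xW hx]]]; exists m, x; split=> //.
rewrite cutto_true; set W := (fun i : int => _) in xW hx.
have hb := tri_class_band_bound hK hm.
have Dres : ell2 (subscalar (triop m) lam x) by exact: (tri_class_ell2 lam hK hm Dx).
set r := cutto W _ in hx.
pose xl : int -> C := fun i => x (i - 1); pose xr : int -> C := fun i => x (i + 1).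
have Dxl : ell2 xl by apply/(ell2_shift (-1)).
have Dxr : ell2 xr by apply/(ell2_shift 1).
have pt i : nsq (subscalar (triop m) lam x) i <=
    nsq r i + (K ^+ 2 * nsq xl i + K ^+ 2 * nsq xr i) + K ^+ 2 * nsq xl i
    + K ^+ 2 * nsq xr i.
  have k2 := sqr_ge0 K.
  have t1 : 0 <= K ^+ 2 * nsq xl i by rewrite mulr_ge0// nsq_ge0.
  have t2 : 0 <= K ^+ 2 * nsq xr i by rewrite mulr_ge0// nsq_ge0.
  rewrite nsq_cutto; case: ifP => Wi; first lra.
  have [h1 _ h3] := hb i.
  have -> : nsq (subscalar (triop m) lam x) i =
      cabs (m i (i - 1) * xl i + m i (i + 1) * xr i) ^+ 2.
    rewrite /nsq (_ : subscalar (triop m) lam x i =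
      m i (i - 1) * xl i + m i (i + 1) * xr i)//.
    have nW : ~~ (1 <= i <= n%:Z) by move: Wi; rewrite /W => ->.
    by rewrite subscalarE (xW i nW) /xl /xr; ring.
  have hs : cabs (m i (i - 1) * xl i + m i (i + 1) * xr i) <=
      K * cabs (xl i) + K * cabs (xr i).
    apply: le_trans (cabsD _ _) _.
    by apply: lerD; rewrite cabsM ler_wpM2r ?cabs_ge0.
  have hs2 : cabs (m i (i - 1) * xl i + m i (i + 1) * xr i) ^+ 2 <=
      (K * cabs (xl i) + K * cabs (xr i)) ^+ 2.
    rewrite ler_sqr ?nnegrE ?cabs_ge0//.
    by rewrite addr_ge0// mulr_ge0// cabs_ge0.
  apply: le_trans hs2 _; rewrite /nsq.
  have := sqr_ge0 (K * cabs (xl i) - K * cabs (xr i)); lra.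
have zle : (zsum (nsq (subscalar (triop m) lam x)) <=
    (qnorm r + 4 * K ^+ 2 * qnorm x)%:E)%E.
  apply: le_trans (le_zsum pt) _.
  have k2 := sqr_ge0 K.
  have t1 i : 0 <= K ^+ 2 * nsq xl i by rewrite mulr_ge0// nsq_ge0.
  have t2 i : 0 <= K ^+ 2 * nsq xr i by rewrite mulr_ge0// nsq_ge0.
  have t3 i : 0 <= K ^+ 2 * nsq xl i + K ^+ 2 * nsq xr i by exact: addr_ge0.
  have t4 i : 0 <= nsq r i by exact: nsq_ge0.
  have t5 i : 0 <= nsq r i + (K ^+ 2 * nsq xl i + K ^+ 2 * nsq xr i) by exact: addr_ge0.
  have t6 i : 0 <= nsq r i + (K ^+ 2 * nsq xl i + K ^+ 2 * nsq xr i) +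
      K ^+ 2 * nsq xl i by exact: addr_ge0.
  have zl : zsum (fun i => K ^+ 2 * nsq xl i) = (K ^+ 2 * qnorm x)%:E.
    rewrite (zsumZ k2 (nsq_ge0 _)).
    by rewrite zsum_nsq// /xl (qnorm_shift (-1)).
  have zr : zsum (fun i => K ^+ 2 * nsq xr i) = (K ^+ 2 * qnorm x)%:E.
    rewrite (zsumZ k2 (nsq_ge0 _)).
    by rewrite zsum_nsq// /xr (qnorm_shift 1).
  rewrite (zsumD t6 t2) (zsumD t5 t1) (zsumD t4 t3) (zsumD t1 t2) zl zr.
  rewrite zsum_nsq; last exact: (qnorm_cutto W Dres).1.
  by rewrite -!EFinD lee_fin; lra.
have [_ h] := ell2_le_qnorm zle; apply: le_lt_trans h _.
have := mulr_ge0 (mulr_ge0 (ltW e0) K0) (qnorm_ge0 x); lra.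
Qed.

Lemma finsec_approx n k eps lam : 0 < eps ->
  spec_mx eps (finsec A n k) lam ->
  approx_on (fun i => 1 <= i <= n%:Z) Sa Sb Sc eps lam.
Proof.
move=> e0 /(spec_mxP _ _ e0)[v hv].
have [Dv qv] := qnorm_emb 0 v.
exists (fun i j => A (i + k) (j + k)), (emb 0 v); split=> //.
- exact: tri_class_shift tri_class_A.
- by move=> i hi; rewrite emb_out.
have embk (i : int) : emb 0 v i = emb k v (i + k).
  rewrite /emb (_ : (k + 1 <= i + k) = (0 + 1 <= i)); last by ilia.
  by rewrite (_ : i + k - (k + 1) = i - (0 + 1))//; ilia.
have -> : cutto (fun i => 1 <= i <= n%:Z)
    (subscalar (triop (fun i j => A (i + k) (j + k))) lam (emb 0 v)) =
    emb 0 (subscalar (mulmx (finsec A n k)) lam v).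
  apply/funext => i; rewrite /cutto; case: ifP => hi; last by rewrite emb_out ?hi.
  have ib : (absz (i - 1)%R < n)%N by ilia.
  have ie : i = 0 + 1 + (Ordinal ib : nat)%:Z by rewrite /=; ilia.
  rewrite [in RHS]ie embE [RHS]mxE finsec_mul [X in _ = _ + X]mxE mxE.
  rewrite subscalar_at (_ : emb 0 v = fun i => emb k v (i + k)); last exact/funext.
  rewrite triop_shift (_ : k + 1 + (Ordinal ib : nat)%:Z = i + k); last by rewrite /=; ilia.
  by rewrite -[v _ _](embE k) (_ : k + 1 + (Ordinal ib : nat)%:Z = i + k)//=; ilia.
by rewrite lt_l2norm// -!eucl_emb.
Qed.

End Pseudoergodic.

(** * Sections yield approximate eigenvectors on the whole line *)

Section NoPollution.
Variable R : realType.
Local Notation C := (Cplx R).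
Variables (Sa Sb Sc : set C) (al be ga : int -> C) (K : R).
Hypothesis hK : forall a : C, (Sa `|` Sb `|` Sc) a -> cabs a <= K.
Hypothesis A_pe : pseudoergodic Sa Sb Sc al be ga.
Let A := trimat al be ga.

Lemma conj_unit (t : C) : cabs t = 1 -> t^* = t^-1.
Proof.
move=> t1; have t0 : t != 0 by rewrite -cabs_eq0 t1 oner_neq0.
by apply: (mulfI t0); rewrite mulconjE t1 expr1n divff.
Qed.

Lemma cabs_exprz (t : C) (z : int) : cabs t = 1 -> cabs (t ^ z) = 1.
Proof.
move=> t1; case: z => n; first by rewrite -exprnP cabsX t1 expr1n.
by rewrite NegzE -exprnN cabsV cabsX t1 expr1n invr1.
Qed.

(** [emb (-1)] numbers coordinates from 0, so n - 1 and 0 name the last and the first. Keeping the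
    corners as separate summands also covers n <= 2. *)
Lemma persec_mul n k (t : C) (v : 'cV[C]_n) (i : 'I_n) :
  (persec al be ga t n k *m v) i 0 =
  triop A (emb k v) (k + 1 + i%:Z) +
  ((if i == 0 :> nat then t * al k * emb (-1) v (n%:Z - 1) else 0) +
   (if i.+1 == n then t^* * ga (k + n%:Z + 1) * emb (-1) v 0 else 0)).
Proof.
rewrite /persec mulmxDl mxE finsec_mul; congr (_ + _); rewrite mxE.
rewrite (eq_bigr (fun j : 'I_n =>
    (if 0 + j%:Z == n%:Z - 1 then
       (if i == 0 :> nat then t * al k * emb (-1) v (n%:Z - 1) else 0) else 0) +
    (if 0 + j%:Z == 0 then
       (if i.+1 == n then t^* * ga (k + n%:Z + 1) * emb (-1) v 0 else 0) else 0))).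
  have n0 := ltn_ord i; rewrite big_split /= !sum_single_window//; ilia.
move=> j _; rewrite mxE mulrDl.
have ej : v j 0 = emb (-1) v j%:Z by rewrite -(embE (-1)) addNr add0r.
congr (_ + _).
  have -> : (j.+1 == n) = (0 + j%:Z == n%:Z - 1) by ilia.
  case: (i == 0 :> nat) => /=; last by rewrite !mul0r if_same.
  by case: eqP => [e|_]; [rewrite mul1r ej -e add0r|rewrite !mul0r].
have -> : (j == 0 :> nat) = (0 + j%:Z == 0) by ilia.
case: (i.+1 == n) => /=; last by rewrite !mul0r if_same.
by case: eqP => [e|_]; [rewrite mul1r ej -e add0r|rewrite !mul0r].
Qed.

Lemma persec_approx n k (t : C) eps lam : (0 < n)%N -> cabs t = 1 -> 0 < eps ->
  spec_mx eps (persec al be ga t n k) lam ->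
  approx_on (fun=> true) Sa Sb Sc eps lam.
Proof.
move=> n0 t1 e0 /(spec_mxP _ _ e0)[v hv].
have t0 : t != 0 by rewrite -cabs_eq0 t1 oner_neq0.
have nz : n%:Z != 0 by ilia.
pose w := emb (-1) v.
(* The factor t^-1 per period gives X (-1) = t w (n - 1) and X n = conj t w 0, the contributions of
   the two corner entries. *)
pose X (i : int) : C := t ^ (- (i %/ n%:Z)%Z) * w (i %% n%:Z)%Z.
pose r (i : int) : int := k + 1 + (i %% n%:Z)%Z.
(* Row i copies row r i of A, so the period boundary meets the corner entries alpha_k and
   gamma_(k+n+1). *)
pose m (i j : int) : C := A (r i) (r i + (j - i)).
have divS (i : int) : ((i + n%:Z) %/ n%:Z)%Z = (i %/ n%:Z)%Z + 1.
  by rewrite divzDr ?dvdzz// divzz nz.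
have modS (i : int) : ((i + n%:Z) %% n%:Z)%Z = (i %% n%:Z)%Z.
  by rewrite modzDr.
have XS i : X (i + n%:Z) = t^-1 * X i.
  by rewrite /X divS modS opprD expfzDr// [t ^ -1]exprN1; ring.
have mE i : [/\ m i (i - 1) = al (r i - 1), m i i = be (r i) &
    m i (i + 1) = ga (r i + 1)].
  rewrite /m /A /trimat; split.
  - rewrite (_ : r i + (i - 1 - i) = r i - 1); last by ilia.
    by rewrite subrK eqxx.
  - rewrite subrr addr0 eqxx.
    by have /negbTE -> : r i != r i + 1 by ilia.
  - rewrite (_ : r i + (i + 1 - i) = r i + 1); last by ilia.
    have /negbTE -> : r i != r i + 1 + 1 by ilia.
    have /negbTE -> : r i != r i + 1 by ilia.
    by rewrite addrK eqxx.
have rS i : r (i + n%:Z) = r i by rewrite /r modS.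
have resS i : subscalar (triop m) lam X (i + n%:Z) =
    t^-1 * subscalar (triop m) lam X i.
  rewrite !subscalarE; have [-> -> ->] := mE (i + n%:Z); have [-> -> ->] := mE i.
  rewrite rS (_ : i + n%:Z - 1 = i - 1 + n%:Z); last by ilia.
  rewrite (_ : i + n%:Z + 1 = i + 1 + n%:Z); last by ilia.
  by rewrite !XS; ring.
have Xin (j : int) : 0 <= j < n%:Z -> X j = w j.
  move=> hj; rewrite /X (modz_small hj) divz_small; last by ilia.
  by rewrite oppr0 expr0z mul1r.
have wout (j : int) : ~~ (0 <= j < n%:Z) -> w j = 0.
  by move=> hj; rewrite /w emb_out//; ilia.
have wk (j : int) : emb k v (k + 1 + j) = w j.
  rewrite /w /emb (_ : (k + 1 <= k + 1 + j) = (-1 + 1 <= j)); last by ilia.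
  by rewrite (_ : k + 1 + j - (k + 1) = j - (-1 + 1))//; ilia.
have Xm1 : X (-1) = t * w (n%:Z - 1).
  have := XS (-1); rewrite (_ : -1 + n%:Z = n%:Z - 1); last by ilia.
  rewrite Xin; last by ilia.
  by move=> ->; rewrite mulrA divff// mul1r.
have Xn : X n%:Z = t^-1 * w 0.
  by have := XS 0; rewrite add0r (Xin 0)//; ilia.
have res_in (i : 'I_n) : subscalar (triop m) lam X i%:Z =
    subscalar (mulmx (persec al be ga t n k)) lam v i 0.
  rewrite [RHS]mxE persec_mul [X in _ = _ + X]mxE mxE.
  rewrite subscalarE /triop; have [-> -> ->] := mE i%:Z.
  have iN := ltn_ord i.
  have ri : r i%:Z = k + 1 + i%:Z by rewrite /r modz_small//; ilia.
  rewrite (Xin i%:Z) ?ri; last by ilia.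
  have vi : v i 0 = w i%:Z by rewrite -wk embE.
  rewrite vi -/w wk.
  rewrite (_ : k + 1 + i%:Z - 1 = k + 1 + (i%:Z - 1)); last by ilia.
  rewrite (_ : k + 1 + i%:Z + 1 = k + 1 + (i%:Z + 1)); last by ilia.
  rewrite !wk.
  have Ael : A (k + 1 + i%:Z) (k + 1 + (i%:Z - 1)) = al (k + 1 + (i%:Z - 1)).
    by rewrite /A /trimat ifT//; ilia.
  have Aeb : A (k + 1 + i%:Z) (k + 1 + i%:Z) = be (k + 1 + i%:Z).
    by rewrite /A /trimat eqxx ifF//; ilia.
  have Aec : A (k + 1 + i%:Z) (k + 1 + (i%:Z + 1)) = ga (k + 1 + (i%:Z + 1)).
    rewrite /A /trimat ifF; last by ilia.
    rewrite ifF; last by ilia.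
    by rewrite ifT//; ilia.
  rewrite Ael Aeb Aec.
  have eL : X (i%:Z - 1) = w (i%:Z - 1) +
      (if i == 0 :> nat then t * w (n%:Z - 1) else 0).
    case: eqP => i0.
      rewrite i0 (_ : 0%N%:Z - 1 = -1)//.
      by rewrite Xm1 (wout (-1)) ?add0r//; ilia.
    by rewrite addr0 Xin//; ilia.
  have eR : X (i%:Z + 1) = w (i%:Z + 1) + (if i.+1 == n then t^-1 * w 0 else 0).
    case: eqP => i1.
      rewrite (_ : i%:Z + 1 = n%:Z); last by ilia.
      by rewrite Xn (wout n%:Z) ?add0r//; ilia.
    by rewrite addr0 Xin//; ilia.
  rewrite eL eR (conj_unit t1).
  have [i0|i0] := eqVneq (i : nat) 0%N; have [i1|i1] := eqVneq i.+1 n;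
    rewrite ?addr0.
  - rewrite (_ : k + 1 + (i%:Z - 1) = k); last by ilia.
    by rewrite (_ : k + 1 + (i%:Z + 1) = k + n%:Z + 1); [ring|ilia].
  - by rewrite (_ : k + 1 + (i%:Z - 1) = k); [ring|ilia].
  - by rewrite (_ : k + 1 + (i%:Z + 1) = k + n%:Z + 1); [ring|ilia].
  - by ring.
have tz z : cabs (t ^ z) = 1 by exact: cabs_exprz.
have hm : tri_class Sa Sb Sc m.
  have mc i : [/\ Sa (m i (i - 1)), Sb (m i i) & Sc (m i (i + 1))].
    have [-> -> ->] := mE i.
    by split; [have [] := A_pe.1 (r i - 1)|have [] := A_pe.1 (r i)|
      have [] := A_pe.1 (r i + 1)].
  move=> j; split.
  - by have [h _ _] := mc (j + 1); move: h; rewrite addrK.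
  - by have [] := mc j.
  - by have [_ _ h] := mc (j - 1); move: h; rewrite subrK.
apply: (@periodic_approx R K (l2norm w) eps n Sa Sb Sc m X lam hK hm e0).
- move=> i; rewrite /X cabsM tz mul1r; apply: cabs_le_l2norm.
  exact: (qnorm_emb _ _).1.
- by move=> i; rewrite XS cabsM cabsV t1 invr1 mul1r.
- by move=> i; rewrite resS cabsM cabsV t1 invr1 mul1r.
have -> : \sum_(0 <= j < n) cabs (subscalar (triop m) lam X j%:Z) ^+ 2 =
    eucl (subscalar (mulmx (persec al be ga t n k)) lam v) ^+ 2.
  rewrite (eucl_emb 0) l2norm_sqr (qnorm_emb 0 _).2 big_mkord.
  by apply: eq_bigr => i _; rewrite res_in.
have -> : \sum_(0 <= j < n) cabs (X j%:Z) ^+ 2 = eucl v ^+ 2.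
  rewrite (eucl_emb 0) l2norm_sqr (qnorm_emb 0 _).2 big_mkord.
  apply: eq_bigr => i _; have iN := ltn_ord i.
  by rewrite Xin -?wk ?embE//; ilia.
have [_ ege _ _ _] := hilbertian_eucl R n.
rewrite -exprMn ltr_sqr// nnegrE ?ege// mulr_ge0 ?ege//; exact: ltW.
Qed.

(** The plane wave z^-i is a bounded exact solution for the Laurent operator (a, b, c), with modulus
    of period 1. *)
Lemma ellipse_approx (a b c lam : C) eps : Sa a -> Sb b -> Sc c -> 0 < eps ->
  ellipse a b c lam -> approx_on (fun=> true) Sa Sb Sc eps lam.
Proof.
move=> ha hb hc e0 [z z1 zl].
have z0 : z != 0 by rewrite -cabs_eq0 z1 oner_neq0.
pose m (i j : int) : C := if i == j + 1 then a else if i == j then b else c.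
have hm : tri_class Sa Sb Sc m.
  move=> j; rewrite /m !eqxx.
  have /negbTE -> : j != j + 1 by ilia.
  have /negbTE -> : j - 1 != j + 1 by ilia.
  by have /negbTE -> : j - 1 != j by ilia.
pose X (i : int) : C := z ^ (- i).
have X1 i : cabs (X i) = 1 by exact: cabs_exprz.
have res0 i : subscalar (triop m) lam X i = 0.
  rewrite subscalarE /m subrK !eqxx.
  have /negbTE -> : i != i + 1 by ilia.
  have /negbTE -> : i != i + 1 + 1 by ilia.
  have -> : X (i - 1) = X i * z by rewrite /X opprB addrC expfzDr// expr1z.
  have -> : X (i + 1) = X i * z^-1 by rewrite /X opprD expfzDr// exprN1.
  by rewrite -zl; ring.
apply: (@periodic_approx R K 1 eps 1 Sa Sb Sc m X lam hK hm e0).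
- by move=> i; rewrite X1.
- by move=> i; rewrite !X1.
- by move=> i; rewrite !res0.
rewrite !big_nat1 res0 X1 cabs0 expr0n/= expr1n mulr1 exprn_gt0//.
Qed.

(** The sequence zeta^j solves the transposed Laurent equation and decays to the right. *)
Definition decaying_root (a b c lam : C) : Prop :=
  exists2 zeta : C, cabs zeta < 1 & a * zeta ^+ 2 + (b - lam) * zeta + c = 0.

(** Which end gets opened is unknown, hence one root per orientation, possibly from different
    symbols. The cost p is spent twice, on localization and on the opposite half-line; its summand
    1/n keeps it positive when K = 0. *)
Lemma finsec_approx_line n k eps lam : (0 < n)%N -> 0 < eps ->
  (exists a b c, [/\ Sa a, Sb b, Sc c &
     ellipse a b c lam \/ decaying_root a b c lam]) ->
  (exists a b c, [/\ Sa a, Sb b, Sc c &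
     ellipse a b c lam \/ decaying_root c b a lam]) ->
  spec_mx eps (finsec A n k) lam ->
  approx_on (fun=> true) Sa Sb Sc
    (eps + (8 * K * sin (pi / (2 * n%:R)) + 2 * n%:R^-1)) lam.
Proof.
move=> n0 e0 [a [b [c [ha hb hc hE]]]] [a' [b' [c' [ha' hb' hc' hE']]]] hs.
have happ := finsec_approx A_pe e0 hs.
have K0 := class_bound_ge0 hK A_pe.
have hK' := class_bound_sym hK.
case: n n0 hs happ => // n _ hs happ.
have ni : 0 < n.+1%:R^-1 :> R by rewrite invr_gt0.
have sin0 : 0 <= sin (pi / (2 * n.+1%:R)) :> R.
  apply: sin_ge0_pi; rewrite divr_ge0 ?pi_ge0//= ler_pdivrMr// ler_pMr ?pi_gt0//.
  by rewrite -natrM ler1n.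
pose p := 4 * K * sin (pi / (2 * n.+1%:R)) + n.+1%:R^-1.
have p0 : 0 < p by rewrite ltr_wpDl// !mulr_ge0.
have -> : 8 * K * sin (pi / (2 * n.+1%:R)) + 2 * n.+1%:R^-1 = p + p.
  by rewrite /p; ring.
have ep : 0 < eps + p by rewrite addr_gt0.
have ep2 : 0 < eps + (p + p) by rewrite addr_gt0// addr_gt0.
case: hE => [hE|[zeta z1 hz]]; first exact: ellipse_approx hE.
case: hE' => [hE'|[zeta' z1' hz']]; first exact: ellipse_approx hE'.
have ltp : eps + p < eps + (p + p) by have := p0; lra.
(* At size one the sine equals 1, so the crude bound is affordable. *)
case: n => [|n] in hs happ ni sin0 p p0 ep ep2 ltp *.
  apply: (approx_on_le _ _ (approx_on_whole_line hK A_pe e0 happ)).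
    by rewrite addr_ge0 ?(ltW e0)// mulr_ge0.
  by rewrite /p mulr1 sin_pihalf; have := ni; lra.
have hp : 4 * K * sin (pi / (2 * (n.+1%:R + 1))) <= p.
  by rewrite /p natr1 lerDl ltW.
have [hR|hL] := half_line hK (ltn0Sn n) e0 p0 hp happ.
  apply: (glue_half_lines hK); first exact: approx_on_le (ltW ep) (ltW ltp) hR.
  exact: (half_line_reflect hK ha hb hc z1 hz ep ltp hR).
apply: (glue_half_lines hK).
  exact: (half_line_reflect hK' hc' hb' ha' z1' hz' ep ltp hL).
exact: approx_on_le (ltW ep) (ltW ltp) hL.
Qed.

End NoPollution.

(** * The penalty terms and the inclusions *)

Section Theta.
Variable R : realType.

Definition theta_fun (n : nat) (phi t : R) : R :=
  2 * sin (t / 2) * cos ((n%:R + 2^-1) * t) + phi * (1 - phi) * sin ((n%:R - 1) * t).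

(** The intermediate value theorem makes the set behind [theta] nonempty, so [xget] selects a
    root. *)
Lemma theta_spec (n : nat) (phi : R) : (0 < n)%N -> 0 < phi < 1 ->
  pi / (2 * n%:R + 1) <= theta n phi <= pi / (n%:R + 2) /\
  theta_fun n phi (theta n phi) = 0.
Proof.
move=> n0 /andP[phi0 phi1].
have nR : 1 <= n%:R :> R by rewrite ler1n.
have pi0 : 0 < pi :> R by exact: pi_gt0.
set a := pi / (2 * n%:R + 1); set b := pi / (n%:R + 2).
have a0 : 0 < a by rewrite divr_gt0//; lra.
have b0 : 0 < b by rewrite divr_gt0//; lra.
have ab : a <= b.
  rewrite /a /b ler_pM2l// lef_pV2 ?posrE; lra.
have q0 : 0 <= phi * (1 - phi) by rewrite mulr_ge0//; lra.
have fa : 0 <= theta_fun n phi a.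
  rewrite /theta_fun (_ : (n%:R + 2^-1) * a = pi / 2); last first.
    by rewrite /a; field; lra.
  rewrite cos_pihalf mulr0 add0r mulr_ge0//; apply: sin_ge0_pi.
  rewrite mulr_ge0 ?(ltW a0)//=; last by lra.
  rewrite /a mulrA ler_pdivrMr; [nra|lra].
(* With v = b / 2 the arguments are pi - 3 v and pi - 6 v, so the value is -2 cos (3 v) (sin v - phi
   (1 - phi) sin (3 v)); its sign follows from phi (1 - phi) <= 1/4 and sin (3 v) <= 3 sin v. *)
have fb : theta_fun n phi b <= 0.
  rewrite /theta_fun.
  have -> : (n%:R + 2^-1) * b = - (3 * (b / 2)) + pi by rewrite /b; field; lra.
  have -> : (n%:R - 1) * b = pi - 2 * (3 * (b / 2)) by rewrite /b; field; lra.
  set v := b / 2; rewrite cosDpi cosN.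
  have -> : pi - 2 * (3 * v) = - (2 * (3 * v)) + pi by ring.
  rewrite sinDpi sinN opprK.
  have -> : 2 * (3 * v) = 3 * v + 3 * v by ring.
  rewrite sinD.
  have s3 : sin (3 * v) = 3 * sin v - 4 * sin v ^+ 3.
    have -> : 3 * v = (v + v) + v by ring.
    have c2 : cos v ^+ 2 = 1 - sin v ^+ 2 by rewrite -(cos2Dsin2 v) addrK.
    rewrite sinD sinD cosD (_ : _ + _ = 3 * sin v * cos v ^+ 2 - sin v ^+ 3); last by ring.
    by rewrite c2; ring.
  have v0 : 0 <= v by rewrite /v ltW// divr_gt0.
  have v3 : 3 * v <= pi / 2.
    rewrite /v /b (_ : 3 * (pi / (n%:R + 2) / 2) = 3 * pi / 2 / (n%:R + 2)); last first.
      by field; lra.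
    by rewrite ler_pdivrMr; nra.
  have c0 : 0 <= cos (3 * v).
    by apply: cos_ge0_pihalf; apply/andP; split; lra.
  have sv0 : 0 <= sin v by apply: sin_ge0_pi; apply/andP; split; lra.
  have s30 : 0 <= sin (3 * v) by apply: sin_ge0_pi; apply/andP; split; lra.
  have q1 : phi * (1 - phi) <= 4^-1 by have := sqr_ge0 (phi - 2^-1); rewrite expr2; lra.
  have s3le : sin (3 * v) <= 3 * sin v.
    by rewrite s3 gerBl mulr_ge0// exprn_ge0.
  have h : phi * (1 - phi) * sin (3 * v) <= sin v.
    apply: le_trans (ler_wpM2r s30 q1) _; lra.
  have := mulr_ge0 c0 (_ : 0 <= sin v - phi * (1 - phi) * sin (3 * v)).
  by rewrite subr_ge0 => /(_ h); lra.
have cont : {within `[a, b], continuous (theta_fun n phi)}.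
  apply: continuous_subspaceT => t.
  have lin (k : R) : continuous (fun t : R => k * t).
    by move=> u; apply: cvgM; [exact: cvg_cst|exact: cvg_id].
  have half : continuous (fun t : R => t / 2).
    by move=> u; apply: cvgM; [exact: cvg_id|exact: cvg_cst].
  apply: cvgD.
    apply: cvgM.
      apply: cvgM; first exact: cvg_cst.
      by apply: (continuous_comp (half t)); exact: continuous_sin.
    by apply: (continuous_comp (lin _ t)); exact: continuous_cos.
  apply: cvgM; first exact: cvg_cst.
  by apply: (continuous_comp (lin _ t)); exact: continuous_sin.
have h0 : Num.min (theta_fun n phi a) (theta_fun n phi b) <= 0 <=
    Num.max (theta_fun n phi a) (theta_fun n phi b).
  by rewrite ge_min fb orbT le_max fa.
have [t tab ft] := IVT ab cont h0.
have := @xgetPex _ 0 [set t : R | pi / (2 * n%:R + 1) <= t <= pi / (n%:R + 2) /\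
    2 * sin (t / 2) * cos ((n%:R + 2^-1) * t)
      + phi * (1 - phi) * sin ((n%:R - 1) * t) = 0].
apply; exists t; split; last exact: ft.
by move: tab; rewrite in_itv.
Qed.

Variables (al be ga : int -> Cplx R).
Let Ma := supnorm al.
Let Mc := supnorm ga.
Hypotheses (Ma0 : 0 <= Ma) (Mc0 : 0 <= Mc).

Definition pen_term (n : nat) (phi : R) : R :=
  Num.sqrt (Ma ^+ 2 / phi + Mc ^+ 2 / (1 - phi)) * sin (theta n phi / 2).

Lemma sin_theta (n : nat) (phi : R) : (0 < n)%N -> 0 < phi < 1 ->
  [/\ 0 < theta n phi, theta n phi < pi &
    sin (pi / (2 * n%:R + 1) / 2) <= sin (theta n phi / 2)].
Proof.
move=> n0 hphi; have [/andP[h1 h2] _] := theta_spec n0 hphi.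
have nR : 1 <= n%:R :> R by rewrite ler1n.
have pi0 : 0 < pi :> R by exact: pi_gt0.
have a0 : 0 < pi / (2 * n%:R + 1) :> R by rewrite divr_gt0//; lra.
have bpi : pi / (n%:R + 2) < pi :> R by rewrite ltr_pdivrMr; [nra|lra].
split; [lra|lra|].
have [->//|ne] := eqVneq (theta n phi) (pi / (2 * n%:R + 1)).
apply: ltW; rewrite ltr_sin ?in_itv/=; [|by apply/andP; split; lra..].
have : pi / (2 * n%:R + 1) < theta n phi by rewrite lt_neqAle eq_sym ne.
lra.
Qed.

(** Uniform in phi, so the infimum in [pen] vanishes only for diagonal operators. *)
Lemma pen_term_ge n phi : (0 < n)%N -> 0 < phi < 1 ->
  Num.max Ma Mc * sin (pi / (2 * n%:R + 1) / 2) <= pen_term n phi.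
Proof.
move=> n0 hphi; have [t0 tpi hs] := sin_theta n0 hphi.
have /andP[phi0 phi1] := hphi.
have nR : 1 <= n%:R :> R by rewrite ler1n.
have pi0 : 0 < pi :> R by exact: pi_gt0.
have s0 : 0 <= sin (pi / (2 * n%:R + 1) / 2) :> R.
  apply: sin_ge0_pi; apply/andP; split.
    by rewrite !divr_ge0//; lra.
  by rewrite ler_pdivrMr// ler_pdivrMr; [nra|lra].
apply: ler_pM => //; first by rewrite le_max Ma0.
have aux (c : R) (u : R) : 0 <= c -> 0 < u < 1 -> c ^+ 2 <= c ^+ 2 / u.
  move=> c0 /andP[u0 u1]; rewrite ler_pdivlMr// ler_piMr ?sqr_ge0//; lra.
have h1 := aux Ma phi Ma0 hphi.
have h2 := aux Mc (1 - phi) Mc0 (_ : 0 < 1 - phi < 1).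
have {}h2 : Mc ^+ 2 <= Mc ^+ 2 / (1 - phi) by apply: h2; apply/andP; split; lra.
have m1 : 0 <= Ma ^+ 2 / phi by rewrite divr_ge0 ?sqr_ge0// ltW.
have m2 : 0 <= Mc ^+ 2 / (1 - phi) by rewrite divr_ge0 ?sqr_ge0//; lra.
rewrite ge_max; apply/andP; split.
  rewrite -[leLHS]ger0_norm// -sqrtr_sqr ler_wsqrtr//; lra.
rewrite -[leLHS]ger0_norm// -sqrtr_sqr ler_wsqrtr//; lra.
Qed.

Lemma pen_term_ge0 n phi : (0 < n)%N -> 0 < phi < 1 -> 0 <= pen_term n phi.
Proof.
move=> n0 hphi; have [t0 tpi _] := sin_theta n0 hphi.
rewrite mulr_ge0 ?sqrtr_ge0//; apply: sin_ge0_pi.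
by apply/andP; split; lra.
Qed.

Lemma penE n : pen al ga n = 2 * inf [set pen_term n phi | phi in [set phi : R | 0 < phi < 1]].
Proof. by []. Qed.

Lemma pen_has_inf n : (0 < n)%N ->
  has_inf [set pen_term n phi | phi in [set phi : R | 0 < phi < 1]].
Proof.
move=> n0; split.
  by exists (pen_term n 2^-1); exists 2^-1 => //=; apply/andP; split; lra.
by exists 0 => _ [phi hphi <-]; exact: pen_term_ge0.
Qed.

(** Replaces a minimizing phi; the excess d is paid from the gap between e and eps. *)
Lemma pen_adherent n d : (0 < n)%N -> 0 < d ->
  exists2 phi, 0 < phi < 1 & 2 * pen_term n phi < pen al ga n + d.
Proof.
move=> n0 d0; have d2 : 0 < d / 2 by rewrite divr_gt0.
have [_ [phi hphi <-] h] := inf_adherent d2 (pen_has_inf n0).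
by exists phi => //; rewrite penE; lra.
Qed.

Lemma pen_ge0 n : (0 < n)%N -> 0 <= pen al ga n.
Proof.
move=> n0; rewrite penE mulr_ge0//; apply: lb_le_inf; first by have [] := pen_has_inf n0.
by move=> _ [phi hphi <-]; exact: pen_term_ge0.
Qed.

Lemma pen_gt0 n : (0 < n)%N -> 0 < Num.max Ma Mc -> 0 < pen al ga n.
Proof.
move=> n0 M0; rewrite penE mulr_gt0//.
have nR : 1 <= n%:R :> R by rewrite ler1n.
have pi0 : 0 < pi :> R by exact: pi_gt0.
apply: (@lt_le_trans _ _ (Num.max Ma Mc * sin (pi / (2 * n%:R + 1) / 2))).
  rewrite mulr_gt0//; apply: sin_gt0_pi; apply/andP; split.
    by rewrite !divr_gt0//; lra.
  by rewrite ltr_pdivrMr// ltr_pdivrMr; [nra|lra].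
apply: lb_le_inf; first by have [] := pen_has_inf n0.
by move=> _ [phi hphi <-]; exact: pen_term_ge.
Qed.

(** The value at phi = 1/2, with theta at most pi / (n + 2). *)
Lemma pen_le n : (0 < n)%N ->
  pen al ga n <= Num.sqrt (2 * Ma ^+ 2 + 2 * Mc ^+ 2) * pi / (n%:R + 2).
Proof.
move=> n0; have hphi : 0 < (2^-1 : R) < 1 by apply/andP; split; lra.
have [/andP[_ h] _] := theta_spec n0 hphi.
have [t0 _ _] := sin_theta n0 hphi.
have hin : inf [set pen_term n phi | phi in [set phi : R | 0 < phi < 1]] <= pen_term n 2^-1.
  by apply: ge_inf; [have [] := pen_has_inf n0|exists 2^-1].
rewrite penE; apply: le_trans (ler_wpM2l _ hin) _ => //; rewrite /pen_term.
have -> : Ma ^+ 2 / 2^-1 + Mc ^+ 2 / (1 - 2^-1) = 2 * Ma ^+ 2 + 2 * Mc ^+ 2.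
  by field.
set S := Num.sqrt _.
have S0 : 0 <= S by exact: sqrtr_ge0.
have hs : sin (theta n (2^-1 : R) / 2) <= pi / (n%:R + 2) / 2.
  have t2 : 0 <= theta n (2^-1 : R) / 2 by apply: divr_ge0; [exact: ltW|].
  by apply: le_trans (sin_le_id t2) _; rewrite ler_pM2r ?invr_gt0.
apply: le_trans (_ : 2 * (S * (pi / (n%:R + 2) / 2)) <= _).
  by rewrite ler_pM2l// ler_wpM2l.
by rewrite le_eqVlt; apply/orP; left; apply/eqP; field; rewrite gt_eqF// ltr_wpDl.
Qed.

End Theta.

Section Inclusions.
Variable R : realType.
Local Notation C := (Cplx R).
Variables (Sa Sb Sc : set C) (al be ga : int -> C) (K : R).
Hypothesis hK : forall a : C, (Sa `|` Sb `|` Sc) a -> cabs a <= K.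
Hypothesis A_pe : pseudoergodic Sa Sb Sc al be ga.
Let A := trimat al be ga.
Let Ma := supnorm al.
Let Mc := supnorm ga.

Lemma supnorm_al j : cabs (al j) <= Ma.
Proof.
apply: ub_le_sup; last by exists j.
by exists K => _ [i _ <-]; apply: hK; left; left; have [] := A_pe.1 i.
Qed.

Lemma supnorm_ga j : cabs (ga j) <= Mc.
Proof.
apply: ub_le_sup; last by exists j.
by exists K => _ [i _ <-]; apply: hK; right; have [] := A_pe.1 i.
Qed.

Lemma supnorm_al_ge0 : 0 <= Ma.
Proof. by apply: le_trans (supnorm_al 0); exact: cabs_ge0. Qed.

Lemma supnorm_ga_ge0 : 0 <= Mc.
Proof. by apply: le_trans (supnorm_ga 0); exact: cabs_ge0. Qed.

Lemma trimat_sub i : A i (i - 1) = al (i - 1).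
Proof. by rewrite /A /trimat subrK eqxx. Qed.

Lemma trimat_super i : A i (i + 1) = ga (i + 1).
Proof.
rewrite /A /trimat.
have /negbTE -> : i != i + 1 + 1 by ilia.
have /negbTE -> : i != i + 1 by ilia.
by rewrite addrK eqxx.
Qed.

Lemma spec_vector eps lam : 0 < eps -> spec_l2 eps A lam ->
  exists x e, [/\ 0 < e < eps, ell2 x &
    qnorm (subscalar (triop A) lam x) < e ^+ 2 * qnorm x].
Proof.
move=> e0 /(spec_approx hK A_pe lam e0)/(approx_transfer hK A_pe e0)[x [Dx hx]].
by have [e he hxe] := sqr_gap e0 (qnorm_ge0 x) hx; exists x, e.
Qed.

Lemma res_window m (lam : C) (x : int -> C) (w : int -> R) (k i : int) :
  subscalar (triop m) lam (fun i => ofR (w (i - k)) * x i) i =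
  ofR (w (i - k)) * subscalar (triop m) lam x i +
  (m i (i - 1) * ofR (w (i - 1 - k) - w (i - k)) * x (i - 1) +
   m i (i + 1) * ofR (w (i + 1 - k) - w (i - k)) * x (i + 1)).
Proof. by rewrite !subscalarE !ofRB; ring. Qed.

Lemma nu_on_ltP n k (a : int -> int -> C) (e : R) : (0 < n)%N ->
  nu_on (supported n k) a < e ->
  exists x, [/\ supported n k x, ell2 x & qnorm (triop a x) < e ^+ 2 * qnorm x].
Proof.
move=> n0 h.
(* The infimum of an empty set is 0 by default; a unit vector at site k + 1 rules this out. *)
have S0 : [set l2norm (triop a x) | x in [set x | supported n k x /\ l2norm x = 1]] !=set0.
  pose x : int -> C := fun i => if i == k + 1 then 1 else 0.
  exists (l2norm (triop a x)), x => //; split.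
    move=> i hi; rewrite /x; case: eqP => // e1.
    by exfalso; apply: hi; rewrite e1; apply/andP; split; ilia.
  rewrite /l2norm (_ : sumsq x = 1%:E) ?sqrtr1//.
  rewrite -(@zsum_single R (k + 1) 1)//; apply: eq_zsum => i.
  by rewrite /x; case: eqP => _; rewrite ?cabs1 ?cabs0 ?expr1n ?expr0n.
have hi : has_inf [set l2norm (triop a x) | x in [set x | supported n k x /\ l2norm x = 1]].
  by split=> //; exists 0 => _ [x _ <-]; exact: l2norm_ge0.
have d0 : 0 < e - nu_on (supported n k) a by rewrite subr_gt0.
have [_ [x [sx nx] <-] hx] := inf_adherent d0 hi.
rewrite -/(nu_on _ _) addrC subrK in hx.
exists x; split=> //.
  have [Dx _] : ell2 x /\ qnorm x = ssum (absz k + n)%N (nsq x).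
    apply: qnorm_finsupp => i hi2; apply: sx => /andP[h1 h2]; ilia.
  exact: Dx.
rewrite -!l2norm_sqr nx expr1n mulr1 ltr_sqr ?nnegrE ?l2norm_ge0//.
by apply: le_trans (ltW hx); exact: l2norm_ge0.
Qed.

Lemma nu_on_lt n k (a : int -> int -> C) (e : R) x : 0 < e ->
  supported n k x -> ell2 x -> ell2 (triop a x) ->
  qnorm (triop a x) < e ^+ 2 * qnorm x -> nu_on (supported n k) a < e.
Proof.
move=> e0 sx Dx Dax h.
have lx0 : 0 < l2norm x.
  rewrite lt_neqAle l2norm_ge0 andbT eq_sym; apply/eqP => l0.
  move: h; rewrite -[qnorm x]l2norm_sqr l0 expr0n mulr0.
  by apply/negP; rewrite -leNgt qnorm_ge0.
rewrite lt_l2norm// in h.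
have [_ _ [hZ _] _ _] := hilbertian_ell2 R.
pose c : C := ofR (l2norm x)^-1.
have cc : cabs c = (l2norm x)^-1 by rewrite cabs_ofR ger0_norm// invr_ge0 ltW.
apply: (@le_lt_trans _ _ (l2norm (triop a (c *: x)))).
  apply: ge_inf; first by exists 0 => _ [y _ <-]; exact: l2norm_ge0.
  exists (c *: x) => //; split.
    by move=> i hi; change (c * x i = 0); rewrite sx ?mulr0.
  by rewrite hZ// cc mulVf// gt_eqF.
have -> : triop a (c *: x) = c *: triop a x.
  have := triop_lin a c x 0; rewrite addr0 => ->.
  have -> : triop a 0 = 0.
    have := triop_lin a (-1) 0 0; rewrite scaler0 add0r => ->.
    by rewrite scaleN1r addNr.
  by rewrite addr0.
by rewrite hZ// cc mulrC ltr_pdivrMr.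
Qed.

Lemma nu_on_ge0 E (a : int -> int -> C) : 0 <= nu_on E a.
Proof.
rewrite /nu_on; set S := [set _ | _ in _].
have [->|/set0P S0] := eqVneq S set0; first by rewrite inf0.
by apply: lb_le_inf => // _ [z _ <-]; exact: l2norm_ge0.
Qed.

Lemma mu_has_lbound n (a : int -> int -> C) :
  has_lbound [set Num.min (nu_on (supported n k) a)
    (nu_on (supported n k) (transp a)) | k in [set: int]].
Proof. by exists 0 => _ [j _ <-]; rewrite le_min !nu_on_ge0. Qed.

Lemma pen2_ge0 n : 0 <= pen2 al ga n.
Proof.
rewrite /pen2 !mulr_ge0 ?addr_ge0 ?supnorm_al_ge0 ?supnorm_ga_ge0//.
have n1 : 0 < n%:R + 1 :> R by rewrite ltr_wpDl.
apply: sin_ge0_pi; rewrite divr_ge0 ?pi_ge0 ?mulr_ge0 ?(ltW n1)//=.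
rewrite ler_pdivrMr ?mulr_gt0// ler_pMr ?pi_gt0//.
by have : 0 <= n%:R :> R by []; lra.
Qed.

(** By pseudoergodicity A itself has the approximate eigenvector, so the first term of the minimum
    is the small one. *)
Lemma spec_gamma_set n eps lam : (0 < n)%N -> 0 < eps ->
  spec_l2 eps A lam -> gamma_set n A (eps + pen2 al ga n) lam.
Proof.
move=> n0 e0 /(spec_vector e0)[x [e [/andP[e10 e1e] Dx hx]]].
pose p := pen2 al ga n + (eps - e).
have p0 : 0 < p by rewrite ltr_wpDl ?pen2_ge0// subr_gt0.
have hMa i : cabs (A i (i - 1)) <= Ma by rewrite trimat_sub supnorm_al.
have hMc i : cabs (A i (i + 1)) <= Mc by rewrite trimat_super supnorm_ga.
have hp : 2 * (Ma + Mc) * sin (pi / (2 * (n%:R + 1))) <= p.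
  by rewrite /p -/(pen2 al ga n) lerDl subr_ge0 ltW.
have Dr : ell2 (subscalar (triop A) lam x).
  exact: (linear_on_sub lam (band_A hK A_pe)).1.
have [k [y [yk _ Dy hy]]] := @localize R Ma Mc p e n A (fun=> true) x lam n0 e10
  p0 hMa hMc hp (fun i => ltac:(by [])) Dx Dr hx.
have Dry : ell2 (subscalar (triop A) lam y).
  exact: (linear_on_sub lam (band_A hK A_pe)).1.
rewrite cutto_true subscalar_triop in hy; rewrite subscalar_triop in Dry.
have -> : eps + pen2 al ga n = e + p by rewrite /p; ring.
rewrite /gamma_set /= /mu.
apply: (@le_lt_trans _ _ (Num.min (nu_on (supported n k) (shiftmat A lam))
   (nu_on (supported n k) (transp (shiftmat A lam))))).
  apply: ge_inf; last by exists k.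
  exact: mu_has_lbound.
rewrite gt_min; apply/orP; left.
apply: (nu_on_lt _ _ Dy Dry hy); first by rewrite addr_gt0.
by move=> i hi; apply: yk; apply/negP.
Qed.

Lemma gamma_set_spec n e lam : (0 < n)%N -> 0 < e ->
  gamma_set n A e lam -> spec_l2 e A lam.
Proof.
move=> n0 e0; rewrite /gamma_set /= /mu => h.
have hinf : has_inf [set Num.min (nu_on (supported n k) (shiftmat A lam))
   (nu_on (supported n k) (transp (shiftmat A lam))) | k in [set: int]].
  split; last exact: mu_has_lbound.
  by exists (Num.min (nu_on (supported n 0) (shiftmat A lam))
   (nu_on (supported n 0) (transp (shiftmat A lam)))), 0.
have d0 : 0 < e - mu n (shiftmat A lam) by rewrite subr_gt0.
have [_ [k _ <-] hk] := inf_adherent d0 hinf.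
rewrite -/(mu _ _) addrC subrK gt_min in hk.
apply/(spec_approx hK A_pe lam e0).
case/orP: hk => /(nu_on_ltP n0)[x [_ Dx hx]].
  exists A, x; split=> //; first exact: tri_class_A A_pe.
  by rewrite cutto_true subscalar_triop.
apply: (approx_on_reflect 0 (W := fun=> true)).
exists (transp A), x; split=> //; first exact: tri_class_transp (tri_class_A A_pe).
by rewrite cutto_true subscalar_triop -transp_shiftmat.
Qed.

Lemma emb_window n k (w : int -> R) (x : int -> C) :
  (forall z, ~~ (1 <= z <= n%:Z) -> w z = 0) ->
  emb k (\col_(j < n) (ofR (w (j%:Z + 1)) * x (k + 1 + j%:Z))) =
  fun i => ofR (w (i - k)) * x i.
Proof.
move=> w0; apply/funext => i.
have [hi|hi] := boolP (k + 1 <= i <= k + n%:Z); last first.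
  by rewrite emb_out// w0 ?mul0r//; ilia.
have jb : (absz (i - (k + 1))%R < n)%N by ilia.
have e : k + 1 + (Ordinal jb : nat)%:Z = i by rewrite /=; ilia.
rewrite -{1}e embE mxE e.
by rewrite (_ : (Ordinal jb : nat)%:Z + 1 = i - k)//; move: e => /=; ilia.
Qed.

Lemma eucl_sqr n (v : 'cV[C]_n) : eucl v ^+ 2 = \sum_(j < n) cabs (v j 0) ^+ 2.
Proof. by rewrite (eucl_emb 0) l2norm_sqr (qnorm_emb 0 v).2. Qed.

(** Rows outside the section are discarded, so each end lacks one of the two one-sided increments.
    The remaining phi-weighted energy belongs to the second difference with mixed conditions w_0 =
    (1 - phi) w_1 and w_(n+1) = phi w_n, with eigenvalue 4 sin^2 (theta / 2). *)
Lemma spec_union_finsec n eps lam : (0 < n)%N -> 0 < eps ->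
  spec_l2 eps A lam -> union_spec (finsec A n) (eps + pen al ga n) lam.
Proof.
case: n => // n _ e0 /(spec_vector e0)[x [e [/andP[e10 e1e] Dx hx]]].
have d0 : 0 < (eps - e) / 2 by rewrite divr_gt0// subr_gt0.
have [phi hphi hpen] := pen_adherent al ga (ltn0Sn n) d0.
have /andP[phi0 phi1] := hphi; have phi1' : 0 < 1 - phi by rewrite subr_gt0.
pose p := 2 * pen_term al ga n.+1 phi + (eps - e) / 2.
have pt0 : 0 <= pen_term al ga n.+1 phi.
  exact: pen_term_ge0.
have p0 : 0 < p by rewrite ltr_wpDl// mulr_ge0.
have [_ teq] := theta_spec (ltn0Sn n) hphi.
have [t0 tpi _] := sin_theta (ltn0Sn n) hphi.
set t := theta n.+1 phi in teq t0 tpi.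
pose kap := 4 * sin (t / 2) ^+ 2.
(* Satisfies the left boundary condition for every t; the right one is the equation that defines
   theta. *)
pose wn (j : nat) : R := sin (j%:R * t) - (1 - phi) * sin ((j%:R - 1) * t).
have wrec j : wn j + wn j.+2 = (2 - kap) * wn j.+1.
  rewrite /kap -cos_half /wn.
  have h1 := sin_addB (j.+1%:R * t) t; have h2 := sin_addB (j%:R * t) t.
  have e1 : j.+1%:R * t - t = j%:R * t by rewrite -natr1; ring.
  have e2 : j.+1%:R * t + t = j.+2%:R * t by rewrite -!natr1; ring.
  have e3 : j%:R * t - t = (j%:R - 1) * t by ring.
  have e4 : j%:R * t + t = (j.+2%:R - 1) * t by rewrite -!natr1; ring.
  have e5 : (j.+1%:R - 1) * t = j%:R * t by rewrite -natr1; ring.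
  rewrite e1 e2 in h1; rewrite e3 e4 in h2; rewrite e5.
  move: h1 h2; set s1 := sin (j%:R * t) => h1 h2.
  have -> : sin (j.+2%:R * t) = 2 * cos t * sin (j.+1%:R * t) - s1 by rewrite -h1; ring.
  have -> : sin ((j.+2%:R - 1) * t) = 2 * cos t * s1 - sin ((j%:R - 1) * t).
    by rewrite -h2; ring.
  ring.
have w1 : wn 1%N = sin t by rewrite /wn subrr mul0r sin0 mulr0 subr0 mul1r.
have w0 : wn 0%N = (1 - phi) * wn 1%N.
  rewrite w1 /wn mul0r sin0 (_ : (0%:R - 1) * t = - t); last by rewrite mulr0n; ring.
  by rewrite sinN; ring.
have wN : wn n.+2 = phi * wn n.+1.
  have h : sin (n.+2%:R * t) - sin (n.+1%:R * t) =
      2 * sin (t / 2) * cos ((n.+1%:R + 2^-1) * t).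
    have -> : n.+2%:R * t = (n.+1%:R + 2^-1) * t + t / 2 by rewrite -(natr1 n.+1); field.
    have -> : n.+1%:R * t = (n.+1%:R + 2^-1) * t - t / 2 by ring.
    by rewrite sinD sinB; ring.
  move: teq; rewrite /theta_fun -h /wn.
  have -> : (n.+2%:R - 1) * t = n.+1%:R * t by rewrite -(natr1 n.+1); ring.
  move: (sin _) (sin (n.+1%:R * t)) (sin ((n.+1%:R - 1) * t)) => a b c h2.
  apply/eqP; rewrite -subr_eq0; apply/eqP; rewrite -h2; ring.
(* The actual window is zero outside the section, where wn takes its mixed boundary values. *)
pose w (z : int) : R := if 1 <= z <= n.+1%:Z then wn (absz z) else 0.
have wE (j : nat) : (0 < j <= n.+1)%N -> w j%:Z = wn j.
  by move=> hj; rewrite /w ifT//; ilia.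
have wout z : ~~ (1 <= z <= n.+1%:Z) -> w z = 0.
  by rewrite /w => /negbTE ->.
pose u (j : 'I_n.+1) : R := w (j%:Z + 1).
pose d (j : 'I_n.+1) : R := w j%:Z - w (j%:Z + 1).
pose f (j : 'I_n.+1) : R := w (j%:Z + 2) - w (j%:Z + 1).
pose I := \sum_(j < n) (wn j.+2 - wn j.+1) ^+ 2.
have Sd : \sum_(j < n.+1) d j ^+ 2 = wn 1%N ^+ 2 + I.
  rewrite big_ord_recl; congr (_ + _).
    by rewrite /d /= wout// sub0r sqrrN add0r (wE 1%N).
  apply: eq_bigr => j _; rewrite /d lift0.
  rewrite (_ : j.+1%:Z + 1 = j.+2%:Z); last by ilia.
  have jn := ltn_ord j.
  by rewrite !wE; [rewrite -sqrrN opprB|ilia|ilia].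
have Sf : \sum_(j < n.+1) f j ^+ 2 = I + wn n.+1 ^+ 2.
  rewrite big_ord_recr /=; congr (_ + _); last first.
    rewrite /f /= (_ : n%:Z + 1 = n.+1%:Z); last by ilia.
    by rewrite wE ?leqnn// wout ?sub0r ?sqrrN//; ilia.
  apply: eq_bigr => j _; rewrite /f /=.
  rewrite (_ : j%:Z + 1 = j.+1%:Z); last by ilia.
  rewrite (_ : j%:Z + 2 = j.+2%:Z); last by ilia.
  by rewrite !wE//; have := ltn_ord j; ilia.
have Su : \sum_(j < n.+1) u j ^+ 2 = \sum_(j < n.+1) wn j.+1 ^+ 2.
  apply: eq_bigr => j _; rewrite /u (_ : j%:Z + 1 = j.+1%:Z); last by ilia.
  by rewrite wE//; have := ltn_ord j; ilia.
set S := \sum_(j < n.+1) u j ^+ 2 in Su.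
have bal : phi * (\sum_(j < n.+1) d j ^+ 2) + (1 - phi) * (\sum_(j < n.+1) f j ^+ 2) = kap * S.
  have := @sum_by_parts R n.+1 wn kap (fun j _ => wrec j).
  rewrite -Su big_ord_recl big_ord_recr /= Sd Sf.
  rewrite (_ : \sum_(i < n) _ = I) //.
  rewrite wN w0; lra.
(* From Cauchy-Schwarz with weights: (Ma a + Mc b)^2 <= P2 (phi a^2 + (1 - phi) b^2). *)
pose P2 := Ma ^+ 2 / phi + Mc ^+ 2 / (1 - phi).
have P20 : 0 <= P2 by rewrite addr_ge0// divr_ge0 ?sqr_ge0// ltW.
pose v (k : int) : 'cV[C]_n.+1 := \col_j (ofR (w (j%:Z + 1)) * x (k + 1 + j%:Z)).
pose rho (k : int) (j : 'I_n.+1) : R :=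
  cabs (subscalar (mulmx (finsec A n.+1 k)) lam (v k) j 0).
have rowE k (j : 'I_n.+1) : subscalar (mulmx (finsec A n.+1 k)) lam (v k) j 0 =
    subscalar (triop A) lam (fun i => ofR (w (i - k)) * x i) (k + 1 + j%:Z).
  rewrite mxE finsec_mul [X in _ + X = _]mxE mxE subscalar_at.
  by rewrite -(embE k) /v emb_window.
have [k hk] : exists k, \sum_(j < n.+1) rho k j ^+ 2 <
    (e + p) ^+ 2 * \sum_(j < n.+1) u j ^+ 2 * cabs (x (k + (1 + j%:Z))) ^+ 2.
  apply: (@window_average R n.+1 u d f (fun j => 1 + j%:Z)
    (fun j => j%:Z) (fun j => j%:Z + 2)
    (fun i => cabs (subscalar (triop A) lam x i)) (fun i => cabs (x i)) rho Ma Mc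
    (P2 * phi) (P2 * (1 - phi)) e p
    (qnorm (subscalar (triop A) lam x)) (qnorm x)) => //.
  - move=> k j; rewrite cabs_ge0 /= /rho rowE res_window.
    rewrite trimat_sub trimat_super.
    rewrite (_ : k + 1 + j%:Z - k = j%:Z + 1); last by ilia.
    rewrite (_ : k + 1 + j%:Z - 1 - k = j%:Z); last by ilia.
    rewrite (_ : k + 1 + j%:Z + 1 - k = j%:Z + 2); last by ilia.
    rewrite (_ : k + 1 + j%:Z - 1 = k + j%:Z); last by ilia.
    rewrite (_ : k + 1 + j%:Z + 1 = k + (j%:Z + 2)); last by ilia.
    rewrite (_ : k + (1 + j%:Z) = k + 1 + j%:Z); last by ilia.
    rewrite -/(u j) -/(d j) -/(f j).
    apply: le_trans (cabsD _ _) _; rewrite cabsM cabs_ofR lerD2l.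
    apply: le_trans (cabsD _ _) _; rewrite !cabsM !cabs_ofR.
    apply: lerD; rewrite ler_wpM2r ?cabs_ge0// ler_wpM2r//.
      exact: supnorm_al.
    exact: supnorm_ga.
  - by rewrite mulr_ge0// ltW.
  - by rewrite mulr_ge0// ltW.
  - move=> a b; rewrite -subr_ge0.
    have -> : P2 * phi * a ^+ 2 + P2 * (1 - phi) * b ^+ 2 - (Ma * a + Mc * b) ^+ 2 =
       (Ma * b * (1 - phi) - Mc * a * phi) ^+ 2 / (phi * (1 - phi)).
      by rewrite /P2; field; rewrite !gt_eqF.
    by rewrite divr_ge0 ?sqr_ge0// mulr_ge0// ltW.
  - have factor (X Y : R) : P2 * phi * X + P2 * (1 - phi) * Y =
        P2 * (phi * X + (1 - phi) * Y) by ring.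
    rewrite factor bal -/S.
    have S0 : 0 <= S by apply: sumr_ge0 => j _; exact: sqr_ge0.
    have -> : P2 * (kap * S) = P2 * kap * S by ring.
    apply: ler_wpM2r => //.
    apply: (@le_trans _ _ ((2 * pen_term al ga n.+1 phi) ^+ 2)).
      rewrite /pen_term -/t -/Ma -/Mc -/P2 !exprMn sqr_sqrtr// /kap.
      by rewrite le_eqVlt; apply/orP; left; apply/eqP; ring.
    have lep : 2 * pen_term al ga n.+1 phi <= p by rewrite /p lerDl ltW.
    by rewrite ler_sqr ?nnegrE ?(ltW p0)// mulr_ge0.
  - rewrite -/S Su big_ord_recl ltr_pwDl//.
      by rewrite w1 exprn_gt0// sin_gt0_pi// t0.
    by apply: sumr_ge0 => j _; exact: sqr_ge0.
  - by move=> i; exact: cabs_ge0.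
  - by move=> i; exact: cabs_ge0.
  - apply: zsum_nsq; exact: (linear_on_sub lam (band_A hK A_pe)).1.
  - exact: zsum_nsq.
have eple : e + p <= eps + pen al ga n.+1 by rewrite /p; lra.
have ep0 : 0 < e + p by rewrite addr_gt0.
exists k => //; apply/spec_mxP; first exact: lt_le_trans eple.
exists (v k); have [_ ege _ _ _] := hilbertian_eucl R n.+1.
apply: (@lt_le_trans _ _ ((e + p) * eucl (v k))); last by rewrite ler_wpM2r ?ege.
rewrite -ltr_sqr ?nnegrE ?ege ?mulr_ge0 ?ege ?(ltW ep0)//.
rewrite exprMn !eucl_sqr; apply: lt_le_trans hk _.
rewrite ler_wpM2l ?sqr_ge0//; apply: ler_sum => j _.
by rewrite mxE cabsM cabs_ofR exprMn real_normK ?num_real// addrA.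
Qed.

End Inclusions.

Section PeriodicInclusion.
Variable R : realType.
Local Notation C := (Cplx R).
Variables (Sa Sb Sc : set C) (al be ga : int -> C) (K : R).
Hypothesis hK : forall a : C, (Sa `|` Sb `|` Sc) a -> cabs a <= K.
Hypothesis A_pe : pseudoergodic Sa Sb Sc al be ga.
Let A := trimat al be ga.
Let Ma := supnorm al.
Let Mc := supnorm ga.

(** A period of n + 1 sites carries the sine window of n sites and one zero. *)
Lemma pen1_pen2 n : pen1 al ga n.+1 = pen2 al ga n.
Proof. by rewrite /pen1 /pen2 natr1. Qed.

(* The window vanishes at both ends of the period, so one corner entry drops out
   and the other contributes the missing increment |w_1 - w_0|. *)
Lemma spec_union_persec n (t : C) eps lam : (1 < n)%N -> cabs t = 1 -> 0 < eps ->
  spec_l2 eps A lam ->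
  union_spec (persec al be ga t n) (eps + pen1 al ga n) lam.
Proof.
case: n => // N N0 t1 e0 /(spec_vector hK A_pe e0)[x [e [/andP[e10 e1e] Dx hx]]].
have {}N0 : (0 < N)%N by [].
rewrite pen1_pen2.
pose p := pen2 al ga N + (eps - e).
have q0 : 0 <= pen2 al ga N by exact: (pen2_ge0 hK A_pe).
have p0 : 0 < p by rewrite ltr_wpDl// subr_gt0.
have Ma0 : 0 <= Ma by exact: (supnorm_al_ge0 hK A_pe).
have Mc0 : 0 <= Mc by exact: (supnorm_ga_ge0 hK A_pe).
pose w := @swin R N.
have wout (z : int) : ~~ (1 <= z <= N%:Z) -> w z = 0 by exact: swin_out.
have wE (j : nat) : (j <= N.+1)%N -> w j%:Z = sinw N j by exact: swinE.
pose u (j : 'I_N.+1) : R := w (j%:Z + 1).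
pose d (j : 'I_N.+1) : R := w j%:Z - w (j%:Z + 1).
(* In the last row the right neighbour is the first site of the period: the increment is w 1 - 0,
   and [s2] points back to that site. *)
pose f (j : 'I_N.+1) : R := if j.+1 == N.+1 then w 1 else w (j%:Z + 2) - w (j%:Z + 1).
pose s2 (j : 'I_N.+1) : int := if j.+1 == N.+1 then 1 else j%:Z + 2.
set kap := 4 * sin (pi / (2 * (N%:R + 1))) ^+ 2 : R.
have S0 := @sum_swin_gt0 R N N0.
have Su : \sum_(j < N.+1) u j ^+ 2 = \sum_(j < N.+2) swin N j%:Z ^+ 2.
  rewrite [RHS]big_ord_recl [X in X ^+ 2 + _](@swin_out R N)// expr0n add0r.
  by apply: eq_bigr => j _; rewrite /u /w lift0; congr (swin N _ ^+ 2); ilia.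
have [sd se] := sum_swin_diff R N.
have Sd : \sum_(j < N.+1) d j ^+ 2 = kap * \sum_(j < N.+1) u j ^+ 2.
  rewrite Su -[kap * _]sd [RHS]big_ord_recl [X in (X - _) ^+ 2 + _](@swin_out R N)//.
  rewrite [X in (_ - X) ^+ 2 + _](@swin_out R N)// subrr expr0n add0r.
  apply: eq_bigr => j _; rewrite /d /w lift0.
  by congr ((swin N _ - swin N _) ^+ 2); ilia.
have Sf : \sum_(j < N.+1) f j ^+ 2 = kap * \sum_(j < N.+1) u j ^+ 2.
  rewrite Su -[kap * _]se [RHS]big_ord_recl [X in (_ - X) ^+ 2 + _](@swin_out R N)//.
  rewrite big_ord_recr [in RHS]big_ord_recr.
  rewrite [X in _ = _ + (_ + (X - _) ^+ 2)](@swin_out R N); last by rewrite lift0 /=; ilia.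
  rewrite [X in _ = _ + (_ + (_ - X) ^+ 2)](@swin_out R N); last by rewrite lift0 /=; ilia.
  rewrite subrr expr0n /= addr0 subr0 addrC; congr (_ + _).
    by rewrite /f eqxx.
  apply: eq_bigr => j _; rewrite /f ifF /w; last by have := ltn_ord j; rewrite /=; ilia.
  by congr ((swin N _ - swin N _) ^+ 2); rewrite /= /bump /=; ilia.
pose v (k : int) : 'cV[C]_N.+1 := \col_j (ofR (w (j%:Z + 1)) * x (k + 1 + j%:Z)).
have embv k : emb k (v k) = fun i => ofR (w (i - k)) * x i.
  by apply: emb_window => z hz; apply: wout; ilia.
pose rho (k : int) (j : 'I_N.+1) : R :=
  cabs (subscalar (mulmx (persec al be ga t N.+1 k)) lam (v k) j 0).
have rowE k (j : 'I_N.+1) :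
    subscalar (mulmx (persec al be ga t N.+1 k)) lam (v k) j 0 =
    subscalar (triop A) lam (fun i => ofR (w (i - k)) * x i) (k + 1 + j%:Z) +
    (if j.+1 == N.+1 then t^* * ga (k + N.+1%:Z + 1) * (ofR (w 1) * x (k + 1)) else 0).
  rewrite mxE persec_mul [X in _ + X = _]mxE mxE subscalar_at embv.
  have -> : emb (-1) (v k) (N.+1%:Z - 1) = 0.
    rewrite (_ : N.+1%:Z - 1 = -1 + 1 + (@ord_max N : nat)%:Z); last by rewrite /=; ilia.
    rewrite embE mxE wout ?mul0r//= ; ilia.
  have -> : emb (-1) (v k) 0 = ofR (w 1) * x (k + 1).
    rewrite (_ : 0 = -1 + 1 + (@ord0 N : nat)%:Z) // embE mxE add0r addr0.
    by [].
  rewrite mulr0 if_same add0r -(embE k) embv addrAC; congr (_ - _ + _).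
have [k hk] : exists k, \sum_(j < N.+1) rho k j ^+ 2 <
    (e + p) ^+ 2 * \sum_(j < N.+1) u j ^+ 2 * cabs (x (k + (1 + j%:Z))) ^+ 2.
  apply: (@window_average R N.+1 u d f (fun j => 1 + j%:Z)
    (fun j => j%:Z) s2
    (fun i => cabs (subscalar (triop A) lam x i)) (fun i => cabs (x i)) rho Ma Mc
    ((Ma + Mc) * Ma) ((Ma + Mc) * Mc) e p
    (qnorm (subscalar (triop A) lam x)) (qnorm x)) => //.
  - move=> k j; rewrite cabs_ge0 /= /rho rowE res_window.
    rewrite /A trimat_sub trimat_super.
    rewrite (_ : k + 1 + j%:Z - k = j%:Z + 1); last by ilia.
    rewrite (_ : k + 1 + j%:Z - 1 - k = j%:Z); last by ilia.
    rewrite (_ : k + 1 + j%:Z + 1 - k = j%:Z + 2); last by ilia.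
    rewrite (_ : k + 1 + j%:Z - 1 = k + j%:Z); last by ilia.
    rewrite (_ : k + 1 + j%:Z + 1 = k + (j%:Z + 2)); last by ilia.
    rewrite (_ : k + (1 + j%:Z) = k + 1 + j%:Z); last by ilia.
    rewrite -/(u j) -/(d j) -!addrA.
    apply: le_trans (cabsD _ _) _; rewrite cabsM cabs_ofR lerD2l.
    apply: le_trans (cabsD _ _) _; apply: lerD.
      rewrite !cabsM !cabs_ofR ler_wpM2r ?cabs_ge0// ler_wpM2r//.
      exact: (supnorm_al hK A_pe).
    rewrite /f /s2; case: eqP => jN.
      have e1 : w (j%:Z + 2) = 0 by apply: wout; ilia.
      have e2 : u j = 0 by apply: wout; ilia.
      rewrite e1 e2 subr0 ofR0 mulr0 mul0r add0r !cabsM cabs_conj t1 mul1r.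
      rewrite cabs_ofR mulrA ler_wpM2r ?cabs_ge0// ler_wpM2r//.
      exact: (supnorm_ga hK A_pe).
    rewrite addr0 !cabsM !cabs_ofR ler_wpM2r ?cabs_ge0// ler_wpM2r//.
    exact: (supnorm_ga hK A_pe).
  - by rewrite mulr_ge0// addr_ge0.
  - by rewrite mulr_ge0// addr_ge0.
  - move=> a b; have := mulr_ge0 (mulr_ge0 Ma0 Mc0) (sqr_ge0 (a - b)).
    by rewrite !expr2; lra.
  - rewrite Sd Sf; set S := \sum_(j < N.+1) u j ^+ 2.
    have S0' : 0 <= S by apply: sumr_ge0 => j _; exact: sqr_ge0.
    have lep : pen2 al ga N <= p by rewrite /p lerDl subr_ge0 ltW.
    have h : pen2 al ga N ^+ 2 <= p ^+ 2 by rewrite ler_sqr ?nnegrE ?(ltW p0).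
    have := ler_wpM2r S0' h; rewrite /pen2 -/Ma -/Mc /kap; lra.
  - by rewrite Su.
  - by move=> i; exact: cabs_ge0.
  - by move=> i; exact: cabs_ge0.
  - apply: zsum_nsq; exact: (linear_on_sub lam (band_A hK A_pe)).1.
  - exact: zsum_nsq.
have epE : eps + pen2 al ga N = e + p by rewrite /p; ring.
have ep0 : 0 < e + p by rewrite addr_gt0.
exists k => //; rewrite epE; apply/spec_mxP => //.
exists (v k); have [_ ege _ _ _] := hilbertian_eucl R N.+1.
rewrite -ltr_sqr ?nnegrE ?ege ?mulr_ge0 ?ege ?(ltW ep0)//.
rewrite exprMn !eucl_sqr; apply: lt_le_trans hk _.
rewrite ler_wpM2l ?sqr_ge0//; apply: ler_sum => j _.
by rewrite mxE cabsM cabs_ofR exprMn real_normK ?num_real// addrA.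
Qed.

End PeriodicInclusion.

Lemma conjC_B (F : numClosedFieldType) (a b : F) : (a - b)^* = a^* - b^*.
Proof. exact: rmorphB. Qed.

Lemma conjC_V (F : numClosedFieldType) (a : F) : (a^-1)^* = (a^* )^-1.
Proof. exact: fmorphV. Qed.

Lemma conj_ofR (R : realType) (r : R) : (ofR r)^* = ofR r.
Proof. by apply/eqP; rewrite eq_complex /= oppr0 !eqxx. Qed.

(** * Ellipses in the plane *)

Section PlaneTopology.
Variable R : realType.
Local Notation C := (Cplx R).

(** Balls of [Cplx] have radii in C, whose positive elements are real; this passes to radii in R. *)
Lemma nbhs_cabsP (z : C) (S : set C) :
  nbhs z S <-> exists2 e : R, 0 < e & forall y, cabs (z - y) < e -> S y.
Proof.
rewrite nbhs_ballP; split=> [[e /= e0 he]|[e e0 he]].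
  have er : ofR (complex.Re e) = e by apply: RRe_real; rewrite gtr0_real.
  exists (complex.Re e); first by rewrite -ltcR; move: e0; rewrite -{1}er.
  move=> y zy; apply: he; rewrite -ball_normE /ball_ /= cabsE -er.
  by rewrite /ofR ltcR.
exists (ofR e); first by rewrite /= /ofR (ltcR 0 e).
move=> y; rewrite -ball_normE /ball_ /= cabsE /ofR ltcR => zy.
exact: he.
Qed.

Lemma closure_cabs (S : set C) z (e : R) : 0 < e -> closure S z ->
  exists2 s, S s & cabs (z - s) < e.
Proof.
move=> e0 /(_ [set y | cabs (z - y) < e])[].
  by apply/nbhs_cabsP; exists e.
by move=> s [Ss zs]; exists s.
Qed.

Lemma lipschitz_continuous (f : C -> R) (L : R) : 0 < L ->
  (forall z y, `|f z - f y| <= L * cabs (z - y)) -> continuous f.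
Proof.
move=> L0 hf z S /nbhs_ballP[e /= e0 he].
apply/nbhs_cabsP; exists (e / L); first by rewrite divr_gt0.
move=> y zy /=; apply: he; rewrite -ball_normE /ball_ /=.
by apply: le_lt_trans (hf z y) _; rewrite mulrC -ltr_pdivlMr.
Qed.

Lemma cabs_dist (z y : C) : `|cabs z - cabs y| <= cabs (z - y).
Proof.
rewrite ler_norml; apply/andP; split.
  have := cabsD (y - z) z; rewrite subrK cabs_distC; lra.
by have := cabsD (z - y) y; rewrite subrK; lra.
Qed.

Lemma continuous_cabs : continuous (@cabs R).
Proof.
by apply: (@lipschitz_continuous _ 1) => // z y; rewrite mul1r; exact: cabs_dist.
Qed.

Lemma compact_cabs_bound (S : set C) : compact S ->
  exists2 K : R, 0 <= K & forall z, S z -> cabs z <= K.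
Proof.
move=> cS; have [->|/set0P S0] := eqVneq S set0; first by exists 0.
have [|m mS hm] := compact_EVT_max S0 cS (f := @cabs R).
  exact: continuous_subspaceT continuous_cabs.
exists (cabs m); first exact: cabs_ge0.
by move=> z Sz; apply: hm; rewrite inE.
Qed.

Lemma maxabs_attained (S : set C) : compact S -> S !=set0 ->
  exists2 z, S z & cabs z = maxabs S.
Proof.
move=> cS S0; have [|m mS hm] := compact_EVT_max S0 cS (f := @cabs R).
  exact: continuous_subspaceT continuous_cabs.
rewrite inE in mS; exists m => //; apply/eqP; rewrite eq_le; apply/andP; split.
  apply: ub_le_sup; last by exists m.
  by exists (cabs m) => _ [z Sz <-]; apply: hm; rewrite inE.
apply: ge_sup; first by exists (cabs m), m.
by move=> _ [z Sz <-]; apply: hm; rewrite inE.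
Qed.

Lemma minabs_attained (S : set C) : compact S -> S !=set0 ->
  exists2 z, S z & cabs z = minabs S.
Proof.
move=> cS S0; have [|m mS hm] := compact_EVT_min S0 cS (f := @cabs R).
  exact: continuous_subspaceT continuous_cabs.
rewrite inE in mS; exists m => //; apply/eqP; rewrite eq_le; apply/andP; split.
  apply: lb_le_inf; first by exists (cabs m), m.
  by move=> _ [z Sz <-]; apply: hm; rewrite inE.
apply: ge_inf; last by exists m.
by exists (cabs m) => _ [z Sz <-]; apply: hm; rewrite inE.
Qed.

Lemma bounded_cluster (z_ : nat -> C) (B : R) : (forall n, cabs (z_ n) <= B) ->
  exists z, forall (e : R) (N : nat), 0 < e ->
    exists2 n, (N <= n)%N & cabs (z - z_ n) < e.
Proof.
move=> zB; pose g (p : R * R) : C := (p.1 +i* p.2)%C.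
have cg : continuous g.
  move=> [a b] S /nbhs_cabsP[e e0 he].
  have e2 : 0 < e / 2 by rewrite divr_gt0.
  exists (ball a (e / 2), ball b (e / 2)).
    by split => /=; exact: nbhsx_ballx.
  move=> [c d] /= [hc hd]; apply: he; apply: le_lt_trans (cabs_le_reim _) _ => /=.
  move: hc hd; rewrite -!ball_normE /ball_ /= => hc hd; lra.
pose S := g @` (`[- B, B] `*` `[- B, B]).
have cS : compact S.
  apply: continuous_compact; first exact: continuous_subspaceT.
  by apply: compact_setX; exact: segment_compact.
have Sz n : S (z_ n).
  exists (complex.Re (z_ n), complex.Im (z_ n)); last by rewrite /g; case: (z_ n).
  have h1 := cabs_re (z_ n); have h2 := cabs_im (z_ n); have h3 := zB n.
  by split; rewrite /= in_itv /= -ler_norml; apply: le_trans h3.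
have [|z [_ cz]] := cS (z_ @ \oo) _; first by exists 0%N => // n _; exact: Sz.
exists z => e N e0.
have F1 : (z_ @ \oo) [set z_ n | n in [set n | (N <= n)%N]].
  by exists N => // n Nn; exists n.
have N1 : nbhs z [set y | cabs (z - y) < e] by apply/nbhs_cabsP; exists e.
have [_ [[n /= Nn <-] zn]] := cz _ _ F1 N1.
by exists n.
Qed.

Lemma bounded_set_cabs (S : set C) (B : R) : (forall z, S z -> cabs z <= B) ->
  bounded_set S.
Proof.
move=> SB; exists (ofR B); split; first by apply/complex_realP; exists B.
move=> M BM z Sz /=; apply: le_trans (ltW BM).
by rewrite cabsE /ofR lecR; exact: SB.
Qed.

End PlaneTopology.

Section Ellipse.
Variable R : realType.
Local Notation C := (Cplx R).

Lemma ellipse_sym (a b c : C) : ellipse a b c = ellipse c b a.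
Proof.
have half (a' c' : C) : ellipse a' b c' `<=` ellipse c' b a'.
  move=> _ [z z1 <-]; exists z^-1; first by rewrite /= cabsV z1 invr1.
  by rewrite invrK; ring.
by apply/seteqP; split; exact: half.
Qed.

(* Points inside the ellipse with |a| < |c| are characterized by
   H z < |c|^2 - |a|^2, where H z = |conj c (z - b) - a conj (z - b)|. *)
Lemma enclosed_ellipse (a b c lam : C) : cabs a < cabs c ->
  cabs (c^* * (lam - b) - a * (lam - b)^* ) < cabs c ^+ 2 - cabs a ^+ 2 ->
  enclosed (ellipse a b c) lam.
Proof.
move=> ac; set D := cabs c ^+ 2 - cabs a ^+ 2.
pose H (z : C) : R := cabs (c^* * (z - b) - a * (z - b)^* ).
rewrite -/(H lam) => lamD.
have D0 : 0 < D.
  by rewrite subr_gt0 ltr_sqr ?nnegrE ?cabs_ge0.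
have cD : ofR D != 0 :> C by rewrite -cabs_eq0 cabs_ofR normr_eq0 gt_eqF.
have ofRD' : ofR D = c * c^* - a * a^* by rewrite /D ofRB !mulconjE.
(* Inverse of the real-affine map u -> u c + b + conj u a, which takes the unit circle to the
   ellipse. *)
pose U (z : C) := (ofR D)^-1 * (c^* * (z - b) - a * (z - b)^* ).
have UH z : cabs (U z) = D^-1 * H z.
  by rewrite /U cabsM cabsV cabs_ofR gtr0_norm.
have Uz z : z = U z * c + b + (U z)^* * a.
  have cU : (U z)^* = (ofR D)^-1 * (c * (z - b)^* - a^* * (z - b)).
    rewrite /U conjC_M conjC_V conj_ofR; congr (_ * _).
    by move: (z - b) => y; rewrite conjC_B !conjC_M !conjCK.
  rewrite cU /U.
  have -> : (ofR D)^-1 * (c^* * (z - b) - a * (z - b)^* ) * c + b +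
     (ofR D)^-1 * (c * (z - b)^* - a^* * (z - b)) * a =
     (ofR D)^-1 * (c * c^* - a * a^* ) * (z - b) + b by ring.
  by rewrite -ofRD' mulVf// mul1r subrK.
have KH z : ellipse a b c z <-> H z = D.
  split=> [[s s1 <-]|hz].
    have s0 : s != 0 by rewrite -cabs_eq0 s1 oner_neq0.
    rewrite /H (_ : s * a + b + s^-1 * c - b = s * a + s^-1 * c); last by ring.
    rewrite -(conj_unit s1) conjC_D !conjC_M conjCK.
    rewrite (_ : _ - _ = s^* * ofR D); last by rewrite ofRD'; ring.
    by rewrite cabsM cabs_conj s1 mul1r cabs_ofR gtr0_norm.
  have U1 : cabs (U z) = 1 by rewrite UH hz mulVf// gt_eqF.
  exists (U z)^*; first by rewrite /= cabs_conj.
  rewrite [RHS]Uz -(conj_unit (_ : cabs (U z)^* = 1)) ?cabs_conj// conjCK.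
  by ring.
have cH : continuous H.
  have ac0 : 0 < cabs c + cabs a.
    by have := cabs_ge0 a; lra.
  apply: (@lipschitz_continuous _ _ (cabs c + cabs a)) => // z y.
  apply: le_trans (cabs_dist _ _) _.
  rewrite (_ : _ - _ - (_ - _) = c^* * (z - y) - a * ((z - b)^* - (y - b)^* )); last by ring.
  rewrite -conjC_B (_ : z - b - (y - b) = z - y); last by ring.
  apply: le_trans (cabsB _ _) _.
  by rewrite !cabsM !cabs_conj mulrDl.
split; first by move/KH; lra.
set B := connected_component _ _.
have lB : (~` ellipse a b c) lam by move/KH; lra.
(* On a connected set avoiding the ellipse, the continuous H cannot cross the value D. *)
have HB z : B z -> H z < D.
  move=> Bz; rewrite ltNge; apply/negP => zD.
  have cB : connected (H @` B).
    apply: connected_continuous_connected; first exact: component_connected.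
    exact: continuous_subspaceT.
  have /connected_intervalP := cB; move=> /(_ (H lam) (H z)) h.
  have [|||y By yD] := h _ _ D.
  - by exists lam => //; exact: connected_component_refl.
  - by exists z.
  - by rewrite (ltW lamD) zD.
  have := connected_component_sub By; move=> /(_ _); apply.
  exact/KH.
apply: (@bounded_set_cabs _ _ (cabs c + cabs b + cabs a)) => z /HB hz.
have U1 : cabs (U z) <= 1.
  by rewrite UH mulrC ler_pdivrMr// mul1r ltW.
rewrite [z in cabs z]Uz; apply: le_trans (cabsD _ _) _; apply: lerD.
  apply: le_trans (cabsD _ _) _; rewrite lerD2r cabsM.
  by rewrite ler_piMl ?cabs_ge0.
by rewrite cabsM cabs_conj ler_piMl ?cabs_ge0.
Qed.

Lemma quadratic_roots (w a c : C) : c != 0 ->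
  exists s1 s2, w = c * (s1 + s2) /\ a = c * (s1 * s2).
Proof.
move=> c0; pose d := sqrtC (w ^+ 2 - 4 * c * a).
have dd : d ^+ 2 = w ^+ 2 - 4 * c * a by exact: sqrtCK.
exists ((w + d) / (2 * c)), ((w - d) / (2 * c)).
split; first by field; rewrite ?c0 ?pnatr_eq0.
have -> : (w + d) / (2 * c) * ((w - d) / (2 * c)) = (w ^+ 2 - d ^+ 2) / (4 * c ^+ 2).
  by field; rewrite ?c0 ?pnatr_eq0.
by rewrite dd; field; rewrite ?c0 ?pnatr_eq0.
Qed.

(** Off the ellipse and without a decaying root, both zeros of the reciprocal polynomial c s^2 - w s
    + a lie in the open unit disc. Vieta then gives |a| < |c| and the criterion for lam to be
    enclosed. *)
Lemma not_enclosed_root (a b c lam : C) : ~ enclosed (ellipse a b c) lam ->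
  ellipse a b c lam \/ decaying_root a b c lam.
Proof.
move=> nenc; apply: contrapT => /not_orP[nE nR].
have c0 : c != 0.
  apply/eqP => c0; apply: nR; exists 0; first by rewrite cabs0.
  by rewrite c0 expr0n /= !mulr0 !addr0.
pose w := lam - b.
have root_lt1 s : c * s ^+ 2 - w * s + a = 0 -> cabs s < 1.
  move=> hs; rewrite ltNge; apply/negP => s1.
  have s0 : s != 0 by rewrite -cabs_gt0; apply: lt_le_trans s1.
  have [e1|ne1] := eqVneq (cabs s) 1.
    apply: nE; exists s^-1; first by rewrite /= cabsV e1 invr1.
    rewrite invrK; apply/eqP; rewrite -subr_eq0; apply/eqP.
    have -> : s^-1 * a + b + s * c - lam = s^-1 * (c * s ^+ 2 - w * s + a).
      by rewrite /w; field.
    by rewrite hs mulr0.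
  apply: nR; exists s^-1.
    rewrite cabsV invf_lt1; last by apply: lt_le_trans s1.
    by rewrite lt_neqAle eq_sym ne1.
  have -> : a * s^-1 ^+ 2 + (b - lam) * s^-1 + c =
      s^-1 ^+ 2 * (c * s ^+ 2 - w * s + a) by rewrite /w; field.
  by rewrite hs mulr0.
have [s1 [s2 [ew ea]]] := quadratic_roots w a c0.
have h1 : cabs s1 < 1 by apply: root_lt1; rewrite ew ea; ring.
have h2 : cabs s2 < 1 by apply: root_lt1; rewrite ew ea; ring.
have cc0 : 0 < cabs c by rewrite cabs_gt0.
have p1 := cabs_ge0 s1; have p2 := cabs_ge0 s2.
apply: nenc; apply: enclosed_ellipse.
  by rewrite ea cabsM cabsM gtr_pMr//; nra.
rewrite -/w.
have -> : c^* * w - a * w^* = ofR (cabs c ^+ 2) *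
   (s1 * (1 - ofR (cabs s2 ^+ 2)) + s2 * (1 - ofR (cabs s1 ^+ 2))).
  rewrite -!mulconjE ew ea !conjC_M !conjC_D; ring.
rewrite cabsM cabs_ofR ger0_norm ?sqr_ge0//.
have -> : cabs c ^+ 2 - cabs a ^+ 2 =
    cabs c ^+ 2 * (1 - (cabs s1 * cabs s2) ^+ 2) by rewrite ea !cabsM; ring.
rewrite ltr_pM2l ?exprn_gt0//.
apply: le_lt_trans (cabsD _ _) _.
have e (s : C) : cabs s < 1 -> cabs (1 - ofR (cabs s ^+ 2)) = 1 - cabs s ^+ 2.
  move=> s1'; rewrite -ofR1 -ofRB cabs_ofR ger0_norm// subr_ge0.
  by rewrite expr_le1 ?cabs_ge0// ltW.
rewrite !cabsM !e//; move: (cabs s1) (cabs s2) h1 h2 p1 p2 => r1 r2 h1 h2 p1 p2.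
(* The difference of the two sides factors as (1 - r1) (1 - r2) (1 - r1 r2). *)
have q1 : 0 < (1 - r1) * (1 - r2) by rewrite mulr_gt0// subr_gt0.
have q2 : 0 < 1 - r1 * r2 by nra.
have := mulr_gt0 q1 q2; lra.
Qed.

(** The product c / a of the two roots has modulus at most 1, so they cannot both lie outside the
    closed unit disc. *)
Lemma root_of_cabs_le (a b c lam : C) : cabs c <= cabs a ->
  ellipse a b c lam \/ decaying_root a b c lam.
Proof.
move=> ca; apply: contrapT => /not_orP[nE nR].
have a0 : a != 0.
  apply/eqP => a0; apply: nR; exists 0; first by rewrite cabs0.
  have : cabs c <= 0 by rewrite -(cabs0 R) -a0.
  move=> c0; have /eqP -> : c == 0 by rewrite -cabs_eq0 eq_le c0 cabs_ge0.
  by rewrite expr0n /= !mulr0 !addr0.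
have [s1 [s2 [ew ec]]] := quadratic_roots (lam - b) c a0.
have root_gt1 s : a * s ^+ 2 - (lam - b) * s + c = 0 -> 1 < cabs s.
  move=> hs; rewrite ltNge; apply/negP => s1'.
  have [e1|ne1] := eqVneq (cabs s) 1; last first.
    apply: nR; exists s; first by rewrite lt_neqAle ne1.
    by rewrite -[RHS]hs; ring.
  have s0 : s != 0 by rewrite -cabs_eq0 e1 oner_neq0.
  apply: nE; exists s => //.
  apply/eqP; rewrite -subr_eq0; apply/eqP.
  have -> : s * a + b + s^-1 * c - lam = s^-1 * (a * s ^+ 2 - (lam - b) * s + c).
    by field.
  by rewrite hs mulr0.
have h1 : 1 < cabs s1 by apply: root_gt1; rewrite ew ec; ring.
have h2 : 1 < cabs s2 by apply: root_gt1; rewrite ew ec; ring.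
have ca0 : 0 < cabs a by rewrite cabs_gt0.
move: ca; rewrite ec !cabsM ger_pMr//; nra.
Qed.

End Ellipse.

(** * Hausdorff convergence *)

Section Hausdorff.
Variable R : realType.
Local Notation C := (Cplx R).

(** A supremum over the empty set is -oo; a point of T keeps the distance nonnegative. *)
Lemma hausdorff_cvgP (S : nat -> set C) (T : set C) : T !=set0 ->
  (forall r : R, 0 < r -> exists N, forall n, (N <= n)%N ->
     (forall s, S n s -> exists2 t, T t & cabs (s - t) <= r) /\
     (forall t, T t -> exists2 s, S n s & cabs (t - s) <= r)) ->
  hausdorff_cvg S T.
Proof.
move=> [t0 Tt0] h.
have le_dist (S' T' : set C) (r : R) s : (exists2 t, T' t & cabs (s - t) <= r) ->
    (dist_to s T' <= r%:E)%E.
  move=> [t T't st]; apply: (@le_trans _ _ (cabs (s - t))%:E); last by rewrite lee_fin.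
  by apply: ereal_inf_lbound; exists t.
have bnd r : 0 < r -> exists N, forall n, (N <= n)%N ->
    (0 <= hausdorff_dist (S n) T <= r%:E)%E.
  move=> r0; have [N hN] := h r r0; exists N => n Nn.
  have [h1 h2] := hN n Nn; apply/andP; split.
    rewrite /hausdorff_dist le_max; apply/orP; right.
    apply: (@le_trans _ _ (dist_to t0 (S n))).
      by apply: le_ereal_inf_tmp => _ [s _ <-]; rewrite lee_fin cabs_ge0.
    by apply: ereal_sup_ubound; exists t0.
  rewrite /hausdorff_dist ge_max; apply/andP; split.
    by apply: ge_ereal_sup => _ [s Ss <-]; apply: (le_dist T) => //; exact: h1.
  by apply: ge_ereal_sup => _ [t Tt <-]; apply: (le_dist T) => //; exact: h2.
rewrite /hausdorff_cvg; apply/fine_cvgP; split.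
  have [N hN] := bnd 1 ltr01; exists N => // n Nn.
  have /andP[a b] := hN n Nn.
  by rewrite ge0_fin_numE//; apply: le_lt_trans b (ltry _).
apply/cvgrPdist_le => e e0; have [N hN] := bnd e e0.
exists N => // n Nn; have /andP[a b] := hN n Nn.
have fn : hausdorff_dist (S n) T \is a fin_num.
  by rewrite ge0_fin_numE//; apply: le_lt_trans b (ltry _).
rewrite sub0r normrN ger0_norm ?fine_ge0//=.
by rewrite -lee_fin fineK.
Qed.

Lemma spec_mx_le n (M : 'M[C]_n) e e' : e <= e' -> spec_mx e M `<=` spec_mx e' M.
Proof. by move=> ee z h; apply: (lt_le_trans h); rewrite lee_fin. Qed.

Lemma spec_l2_le (m : int -> int -> C) (e e' : R) : e <= e' ->
  spec_l2 e m `<=` spec_l2 e' m.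
Proof. by move=> ee z h; apply: (lt_le_trans h); rewrite lee_fin. Qed.

Lemma Spec_mxP n (M : 'M[C]_n) e lam : 0 <= e ->
  Spec_mx e M lam <-> forall e', e < e' -> spec_mx e' M lam.
Proof.
move=> e0; have HE := hilbertian_eucl R n.
rewrite /Spec_mx (Spec_epsP HE _ _ e0); split=> h e' ee'.
  by apply/(spec_epsP HE); [exact: le_lt_trans ee'|exact: h].
by apply/(spec_epsP HE); [exact: le_lt_trans ee'|exact: h].
Qed.

Lemma Spec_l2P (m : int -> int -> C) e lam : 0 <= e ->
  Spec_l2 e m lam <-> forall e', e < e' -> spec_l2 e' m lam.
Proof.
move=> e0; have HE := hilbertian_ell2 R.
rewrite /Spec_l2 (Spec_epsP HE _ _ e0); split=> h e' ee'.
  by apply/(spec_epsP HE); [exact: le_lt_trans ee'|exact: h].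
by apply/(spec_epsP HE); [exact: le_lt_trans ee'|exact: h].
Qed.

(** The level eta' is chosen before M, hence works for all sections of one size at once. *)
Lemma spec_mx_improve n (Mb eta r : R) : 0 < eta -> 0 < r -> 0 < Mb ->
  exists2 eta', eta < eta' & forall (M : 'M[C]_n) lam,
    (forall v, eucl (subscalar (mulmx M) lam v) <= Mb * eucl v) ->
    spec_mx eta' M lam -> exists2 mu, cabs (lam - mu) <= r & spec_mx eta M mu.
Proof.
move=> e0 r0 M0; have HE := hilbertian_eucl R n.
have [eta' [ee h]] := inv_bounded_improve HE e0 r0 M0; exists eta' => // M lam hM.
move=> /(spec_epsP HE); move=> /(_ (lt_trans e0 ee)) ng.
apply: contrapT => nmu; apply: ng; apply: h => //.
  exact: linear_on_mx.
move=> mu lmu; apply: contrapT => ng; apply: nmu; exists mu => //.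
exact/(spec_epsP HE).
Qed.

(** Crude in n; what matters is that the bound is uniform over the position of the section. *)
Lemma eucl_mul_bound n (M : 'M[C]_n) (b : R) (v : 'cV[C]_n) : 0 <= b ->
  (forall i j, cabs (M i j) <= b) -> eucl (M *m v) <= n%:R * (n%:R * b) * eucl v.
Proof.
move=> b0 hM; have [_ ege _ _ _] := hilbertian_eucl R n.
have ev j : cabs (v j 0) <= eucl v.
  by rewrite (eucl_emb 0) -(embE 0); apply: cabs_le_l2norm; exact: (qnorm_emb 0 v).1.
have row i : cabs ((M *m v) i 0) <= n%:R * b * eucl v.
  rewrite mxE; apply: le_trans (cabs_sum _ _ _) _.
  apply: (@le_trans _ _ (\sum_(j < n) b * eucl v)).
    by apply: ler_sum => j _; rewrite cabsM; apply: ler_pM; rewrite ?cabs_ge0.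
  by rewrite sumr_const card_ord -[leLHS]mulr_natl mulrA.
have nn : 0 <= n%:R :> R by [].
have c0 : 0 <= n%:R * b * eucl v by rewrite !mulr_ge0 ?ege.
rewrite -ler_sqr ?nnegrE ?ege//; last by rewrite !mulr_ge0 ?ege.
rewrite eucl_sqr; apply: (@le_trans _ _ (\sum_(j < n) (n%:R * b * eucl v) ^+ 2)).
  by apply: ler_sum => j _; rewrite ler_sqr ?nnegrE ?cabs_ge0.
rewrite sumr_const card_ord -[leLHS]mulr_natl.
have -> : (n%:R * (n%:R * b) * eucl v) ^+ 2 = n%:R ^+ 2 * (n%:R * b * eucl v) ^+ 2.
  by ring.
apply: ler_wpM2r; first exact: sqr_ge0.
case: n {M v hM ege ev row nn c0} => [|n]; first by rewrite expr0n.
by rewrite expr2 ler_peMl// ler1n.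
Qed.

End Hausdorff.

Section HausdorffLimits.
Variable R : realType.
Local Notation C := (Cplx R).
Variables (Sa Sb Sc : set C) (al be ga : int -> C) (K : R).
Hypothesis hK : forall a : C, (Sa `|` Sb `|` Sc) a -> cabs a <= K.
Hypothesis A_pe : pseudoergodic Sa Sb Sc al be ga.
Let A := trimat al be ga.
Let bA : band_bound K A := band_A hK A_pe.

Lemma spec_l2_lipschitz e (d : R) lam mu : 0 < e -> 0 <= d ->
  cabs (lam - mu) <= d -> spec_l2 e A lam -> spec_l2 (e + d) A mu.
Proof.
move=> e0 d0 lm hs; have HE := hilbertian_ell2 R.
have ed : 0 < e + d by rewrite ltr_wpDr.
apply/(spec_epsP HE) => // g.
have HT := linear_on_triop bA.
have low := inv_bounded_lower (linear_on_sub mu bA).1 g.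
have low2 := lower_bound_shift HE HT (_ : cabs (mu - lam) <= d) low.
move: hs => /(spec_approx hK A_pe lam e0)/(approx_transfer hK A_pe e0)[x [Dx]].
rewrite lt_l2norm//; apply/negP; rewrite -leNgt.
rewrite -{1}[e](addrK d); apply: low2 => //.
by rewrite cabs_distC.
Qed.

Lemma spec_l2_bound e lam : 0 < e -> spec_l2 e A lam -> cabs lam <= 3 * K + e.
Proof.
move=> e0 /(spec_approx hK A_pe lam e0)/(approx_transfer hK A_pe e0)[x [Dx]].
rewrite lt_l2norm// => hx.
have [_ _ [hZ _] _ _] := hilbertian_ell2 R.
have h1 := triop_l2norm bA Dx.
have Dr := (linear_on_sub lam bA).1 _ Dx.
have DT := (triop_qnorm bA Dx).1.
have e1 : lam *: x = triop A x + (-1) *: subscalar (triop A) lam x.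
  apply/funext => i; change (lam * x i = triop A x i +
    -1 * (triop A x i - lam * x i)).
  by ring.
have Dr' : ell2 ((-1) *: subscalar (triop A) lam x).
  by have := ell2_lin (-1) Dr (ell2_0 R); rewrite addr0.
have h2 := l2normD DT Dr'.
rewrite -e1 !hZ// cabsN cabs1 mul1r in h2.
have x0 : 0 < l2norm x.
  rewrite -(pmulr_rgt0 _ e0); apply: le_lt_trans hx; exact: l2norm_ge0.
by rewrite -(ler_pM2r x0); apply: le_trans h2 _; rewrite mulrDl lerD// ltW.
Qed.

Lemma spec_dense e r lam : 0 < e -> 0 < r -> Spec_l2 e A lam ->
  exists2 mu, spec_l2 e A mu & cabs (lam - mu) <= r.
Proof.
move=> e0 r0; have HE := hilbertian_ell2 R.
pose Mb := 3 * (K + cabs lam) + 1.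
have K0 : 0 <= K by exact: band_bound_ge0 bA.
have M0 : 0 < Mb by have := cabs_ge0 lam; rewrite /Mb; lra.
have [eta' [ee h]] := inv_bounded_improve HE e0 r0 M0.
move=> /(Spec_epsP HE _ _ (ltW e0))/(_ _ ee) ng.
apply: contrapT => nmu; apply: ng; apply: h.
- exact: linear_on_triop bA.
- move=> x Dx; rewrite subscalar_triop.
  apply: le_trans (triop_l2norm (band_bound_shift lam bA) Dx) _.
  by rewrite ler_wpM2r ?l2norm_ge0// lerDl.
- move=> mu lmu; apply: contrapT => ng; apply: nmu; exists mu => //.
  exact/(spec_epsP HE).
Qed.

(** Otherwise bounded points of spec_(e+1/(n+1)) stay at distance r from Spec_e, while any cluster
    point of them lies in Spec_e, by the Lipschitz dependence of the level on lam. *)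
Lemma Spec_upper_semicontinuous e r : 0 <= e -> 0 < r ->
  exists2 d, 0 < d & forall lam, spec_l2 (e + d) A lam ->
    exists2 s, Spec_l2 e A s & cabs (lam - s) < r.
Proof.
move=> e0 r0; apply: contrapT => nd.
have hn n : exists lam, spec_l2 (e + n.+1%:R^-1) A lam /\
    forall s, Spec_l2 e A s -> r <= cabs (lam - s).
  apply: contrapT => h; apply: nd; exists n.+1%:R^-1; first by rewrite invr_gt0.
  move=> lam hlam; apply: contrapT => hs; apply: h; exists lam; split=> // s Ss.
  by rewrite leNgt; apply/negP => ls; apply: hs; exists s.
have [z_ hz] := choice hn.
have zB n : cabs (z_ n) <= 3 * K + (e + 1).
  have [h _] := hz n; apply: spec_l2_bound; first by rewrite ltr_wpDl.
  by apply: spec_l2_le h; rewrite lerD2l invf_le1// ler1n.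
have [z cz] := bounded_cluster zB.
have Sz : Spec_l2 e A z.
  apply/Spec_l2P => // e' ee'; pose d := (e' - e) / 2.
  have d0 : 0 < d by rewrite divr_gt0// subr_gt0.
  have [n Nn zn] := cz d (Num.truncn d^-1) d0.
  have nd1 : n.+1%:R^-1 <= d.
    rewrite invf_ple ?posrE//; apply: le_trans (ltW (truncnS_gt _)) _.
    by rewrite ler_nat.
  have [h _] := hz n.
  have -> : e' = (e + d) + d by rewrite /d; lra.
  apply: (@spec_l2_lipschitz _ _ (z_ n)) => //; last 1 first.
  - by apply: spec_l2_le h; rewrite lerD2l.
  - by rewrite ltr_wpDl.
  - exact: ltW.
  - by rewrite cabs_distC ltW.
have [n _ zn] := cz r 0%N r0.
have [_ /(_ z Sz)] := hz n; rewrite cabs_distC.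
by move=> /(lt_le_trans zn); rewrite ltxx.
Qed.

Lemma const_over_n_small (c d : R) : 0 <= c -> 0 < d ->
  exists N, forall n, (N <= n)%N -> c / n%:R <= d.
Proof.
move=> c0 d0; exists (Num.truncn (c / d)).+1 => n Nn.
have n0 : 0 < n%:R :> R by rewrite ltr0n; apply: leq_trans Nn.
rewrite ler_pdivrMr// mulrC -ler_pdivrMr//.
by apply: le_trans (ltW (truncnS_gt _)) _; rewrite ler_nat.
Qed.

(** c / n collects all penalties; rho absorbs closures and the density argument. Sizes start at 2,
    as the periodic window needs a site for its zero. *)
Lemma cvg_Spec (S : nat -> set C) e (c : R) : 0 <= e -> 0 <= c ->
  Spec_l2 e A !=set0 ->
  (forall n s rho, (1 < n)%N -> S n s -> 0 < rho ->
     exists2 s', spec_l2 (e + c / n%:R) A s' & cabs (s - s') <= rho) ->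
  (forall n t rho, (1 < n)%N -> Spec_l2 e A t -> 0 < rho ->
     exists2 s, S n s & cabs (t - s) <= rho) ->
  hausdorff_cvg S (Spec_l2 e A).
Proof.
move=> e0 c0 T0 up lo; apply: hausdorff_cvgP => // r r0.
have r2 : 0 < r / 2 by rewrite divr_gt0.
have [d d0 hd] := Spec_upper_semicontinuous e0 r2.
have [N hN] := const_over_n_small c0 d0.
exists (maxn N 2) => n; rewrite geq_max => /andP[Nn n1]; split=> [s Ss|t Tt].
  have [s' hs' ss'] := up n s _ n1 Ss r2.
  have [|t Tt st] := hd s'.
    by apply: spec_l2_le hs'; rewrite lerD2l hN.
  exists t => //; rewrite (_ : s - t = (s - s') + (s' - t)); last by rewrite addrA subrK.
  by apply: le_trans (cabsD _ _) _; lra.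
exact: lo.
Qed.

Lemma cvg_spec (S : nat -> set C) e (c : R) : 0 < e -> 0 <= c ->
  Spec_l2 e A !=set0 ->
  (forall n s rho, (1 < n)%N -> S n s -> 0 < rho ->
     exists2 s', spec_l2 (e + c / n%:R) A s' & cabs (s - s') <= rho) ->
  (forall n t, (1 < n)%N -> spec_l2 e A t -> S n t) ->
  hausdorff_cvg S (spec_l2 e A).
Proof.
move=> e0 c0 [t0 T0] up lo; apply: hausdorff_cvgP.
  by have [mu hmu _] := spec_dense e0 ltr01 T0; exists mu.
move=> r r0.
have r2 : 0 < r / 3 by rewrite divr_gt0.
have [d d0 hd] := Spec_upper_semicontinuous (ltW e0) r2.
have [N hN] := const_over_n_small c0 d0.
exists (maxn N 2) => n; rewrite geq_max => /andP[Nn n1]; split=> [s Ss|t Tt].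
  have [s' hs' ss'] := up n s _ n1 Ss r2.
  have [|t Tt st] := hd s'.
    by apply: spec_l2_le hs'; rewrite lerD2l hN.
  (* Semicontinuity lands in the closed pseudospectrum; density moves on to the open one. *)
  have [mu hmu tmu] := spec_dense e0 r2 Tt.
  exists mu => //.
  rewrite (_ : s - mu = (s - s') + ((s' - t) + (t - mu))); last by ring.
  apply: le_trans (cabsD _ _) _; have := cabsD (s' - t) (t - mu); lra.
by exists t; [exact: lo|rewrite subrr cabs0 ltW].
Qed.

Lemma union_Spec_upper n (M : int -> 'M[C]_n) (e q : R) s rho :
  (0 < n)%N -> 0 <= e -> 0 <= q ->
  (forall e' k, 0 < e' -> spec_mx e' (M k) `<=` spec_l2 (e' + q) A) ->
  union_Spec M e s -> 0 < rho ->
  exists2 s', spec_l2 (e + (n%:R^-1 + q)) A s' & cabs (s - s') <= rho.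
Proof.
move=> n0 e0 q0 hM hs rho0.
have ni : 0 < n%:R^-1 :> R by rewrite invr_gt0 ltr0n.
have [s' [k _ hk] ss'] := closure_cabs rho0 hs.
exists s'; last exact: ltW.
rewrite addrA; apply: (hM _ k); first by rewrite ltr_wpDl.
by apply: (Spec_mxP (M k) s' e0).1 => //; rewrite ltrDl.
Qed.

(** t lies in spec of some M k at any level above e + P, but k depends on the level. The uniform
    improvement starts from one fixed level eta' and moves t by at most rho. At e + P = 0 the
    operator is diagonal and t is near some beta_i. *)
Lemma union_Spec_lower n (M : int -> 'M[C]_n) (e P b : R) t rho :
  (0 < n)%N -> 0 <= e -> 0 <= P -> 0 <= b ->
  (forall k i j, cabs (M k i j) <= b) ->
  (forall e', 0 < e' -> spec_l2 e' A `<=` union_spec M (e' + P)) ->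
  (P = 0 -> (forall j, al j = 0 /\ ga j = 0) /\
     forall k i j, M k i j = if i == j then be (k + 1 + i%:Z) else 0) ->
  Spec_l2 e A t -> 0 < rho ->
  exists2 s, union_Spec M (e + P) s & cabs (t - s) <= rho.
Proof.
move=> n0 e0 P0 b0 hb hM hP ht rho0.
have HE := hilbertian_eucl R n.
have [_ ege [eZ _] eD _] := HE.
have eP0 : 0 <= e + P by rewrite addr_ge0.
have [eP|eP] := eqVneq (e + P) 0; last first.
  have eP' : 0 < e + P by rewrite lt_neqAle eq_sym eP.
  pose Mb := n%:R * (n%:R * b) + cabs t + 1.
  have M0 : 0 < Mb by rewrite ltr_wpDl// addr_ge0 ?cabs_ge0// !mulr_ge0.
  have [eta' ee h] := @spec_mx_improve R n Mb (e + P) rho eP' rho0 M0.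
  have e1 : 0 < e + (eta' - (e + P)) by rewrite ltr_wpDl// subr_gt0.
  have [|k _ hk] := hM _ e1 t _.
    by apply: (Spec_l2P A t e0).1 => //; rewrite ltrDl subr_gt0.
  rewrite (_ : _ + _ + P = eta') in hk; last by ring.
  have [|mu tmu hmu] := h (M k) t _ hk.
    move=> v; rewrite /subscalar -scaleNr.
    apply: le_trans (eD _ _ I I) _; rewrite eZ// cabsN /Mb.
    have := @eucl_mul_bound R n (M k) b v b0 (hb k); have := ege v; lra.
  exists mu => //; apply: subset_closure; exists k => //.
  by apply/Spec_mxP => // e' ee'; apply: spec_mx_le hmu; exact: ltW.
have [ez Pz] : e = 0 /\ P = 0 by split; lra.
have [alga Mdiag] := hP Pz.
have : spec_l2 rho A t by apply: (Spec_l2P A t e0).1 => //; rewrite ez.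
move=> /(spec_approx hK A_pe t rho0)/(approx_transfer hK A_pe rho0)[x [Dx hx]].
have [i hi] : exists i, cabs (be i - t) < rho.
  apply: contrapT => /forallNP hn; move: hx; apply/negP; rewrite -leNgt.
  have Dr := (linear_on_sub t bA).1 _ Dx.
  rewrite -lee_fin EFinM -!zsum_nsq// -(zsumZ (sqr_ge0 rho) (nsq_ge0 x)).
  apply: le_zsum => i; rewrite /nsq subscalarE.
  rewrite trimat_sub trimat_super (alga _).1 (alga _).2.
  have -> : trimat al be ga i i = be i.
    by rewrite /trimat eqxx; have /negbTE -> : i != i + 1 by ilia.
  rewrite (_ : _ - t * x i = (be i - t) * x i); last by ring.
  rewrite cabsM exprMn ler_wpM2r ?sqr_ge0// ler_sqr ?nnegrE ?cabs_ge0 ?(ltW rho0)//.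
  by rewrite leNgt; apply/negP; exact: hn.
exists (be i); last by rewrite cabs_distC ltW.
(* The section at i - 1 begins with row i, so beta_i is its first diagonal entry. *)
rewrite eP; apply: subset_closure; exists (i - 1) => //.
apply/Spec_mxP => // e' e'0; apply/spec_mxP => //.
pose j0 := Ordinal n0; exists (delta_mx j0 0).
rewrite (_ : subscalar _ _ _ = 0).
  rewrite (_ : eucl (delta_mx j0 0 : 'cV[C]_n) = 1) ?mulr1.
    by have := eZ 0 0 I; rewrite scale0r cabs0 mul0r => ->.
  rewrite /eucl (bigD1 j0)//= big1 ?addr0.
    by rewrite mxE !eqxx cabs1 expr1n sqrtr1.
  by move=> l lj; rewrite mxE (negbTE lj) cabs0 expr0n.
apply/colP => l; rewrite /subscalar -colE !mxE Mdiag andbT.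
case: eqP => [->|_]; last by rewrite mulr0 subrr.
by rewrite addr0 subrK mulr1 subrr.
Qed.

End HausdorffLimits.

Section Convergence.
Variable R : realType.
Local Notation C := (Cplx R).
Variables (Sa Sb Sc : set C) (al be ga : int -> C) (K : R).
Hypothesis hK : forall a : C, (Sa `|` Sb `|` Sc) a -> cabs a <= K.
Hypothesis A_pe : pseudoergodic Sa Sb Sc al be ga.
Let A := trimat al be ga.
Let Ma := supnorm al.
Let Mc := supnorm ga.
Let K0 : 0 <= K := class_bound_ge0 hK A_pe.
Let Ma0 : 0 <= Ma := supnorm_al_ge0 hK A_pe.
Let Mc0 : 0 <= Mc := supnorm_ga_ge0 hK A_pe.

Lemma sin_half_le (n : nat) (c : R) : (0 < n)%N -> 0 <= c ->
  2 * c * sin (pi / (2 * n%:R)) <= c * pi / n%:R.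
Proof.
move=> n0 c0; have nR : 0 < n%:R :> R by rewrite ltr0n.
have t0 : 0 <= pi / (2 * n%:R) :> R by rewrite divr_ge0 ?pi_ge0// mulr_ge0// ltW.
have := ler_wpM2l (mulr_ge0 (ler0n R 2) c0) (sin_le_id t0) => /le_trans; apply.
by rewrite le_eqVlt; apply/orP; left; apply/eqP; field; rewrite gt_eqF.
Qed.

Lemma pen1_le n : (0 < n)%N -> pen1 al ga n <= (Ma + Mc) * pi / n%:R.
Proof. by move=> n0; apply: sin_half_le => //; exact: addr_ge0. Qed.

Lemma pen2_le n : (0 < n)%N -> pen2 al ga n <= (Ma + Mc) * pi / n%:R.
Proof.
move=> n0; rewrite -pen1_pen2; apply: le_trans (pen1_le _) _ => //.
apply: ler_wpM2l; first exact: mulr_ge0 (addr_ge0 Ma0 Mc0) (pi_ge0 R).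
by rewrite lef_pV2 ?posrE ?ltr0n// ler_nat.
Qed.

Definition pen_const : R := Num.sqrt (2 * Ma ^+ 2 + 2 * Mc ^+ 2) * pi.

Lemma pen_const_ge0 : 0 <= pen_const.
Proof. by rewrite mulr_ge0 ?sqrtr_ge0 ?pi_ge0. Qed.

Lemma pen_le_const n : (0 < n)%N -> pen al ga n <= pen_const / n%:R.
Proof.
move=> n0; apply: le_trans (pen_le al ga n0) _.
apply: ler_wpM2l; first exact: pen_const_ge0.
by rewrite lef_pV2 ?posrE ?ltr0n// ?ltr_wpDl// ?ltr0n// lerDl.
Qed.

Lemma Spec_nonempty e : Sa !=set0 -> Sb !=set0 -> Sc !=set0 -> 0 <= e ->
  Spec_l2 e A !=set0.
Proof.
move=> [a ha] [b hb] [c hc] e0; exists (1 * a + b + 1^-1 * c).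
apply/Spec_l2P => // e' ee'; have e'0 : 0 < e' by exact: le_lt_trans ee'.
apply/(spec_approx hK A_pe _ e'0).
by apply: (ellipse_approx hK ha hb hc e'0); exists 1 => //; exact: cabs1.
Qed.

Lemma cvg_Gamma_set e : 0 <= e -> Spec_l2 e A !=set0 ->
  hausdorff_cvg (fun n => Gamma_set n A (e + pen2 al ga n)) (Spec_l2 e A).
Proof.
move=> e0 T0; have c0 : 0 <= (Ma + Mc) * pi by exact: mulr_ge0 (addr_ge0 Ma0 Mc0) (pi_ge0 R).
apply: (cvg_Spec hK A_pe (c := (Ma + Mc) * pi + 1)) => //.
- by rewrite addr_ge0.
- move=> n s rho n1 hs rho0; exists s; last by rewrite subrr cabs0 ltW.
  have n0 : (0 < n)%N by exact: ltnW.
  have ni : 0 < n%:R^-1 :> R by rewrite invr_gt0 ltr0n.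
  have p2 := pen2_ge0 hK A_pe n.
  apply: (@spec_l2_le _ _ (e + pen2 al ga n + n%:R^-1)).
    by rewrite mulrDl mul1r addrA lerD2r lerD2l; exact: pen2_le.
  apply: (gamma_set_spec hK A_pe n0); first by rewrite ltr_wpDl// addr_ge0.
  by apply: le_lt_trans hs _; rewrite ltrDl.
move=> n t rho n1 ht rho0; exists t; last by rewrite subrr cabs0 ltW.
apply/ler_addgt0Pr => d d0; apply: ltW; rewrite addrAC.
apply: (spec_gamma_set hK A_pe); [exact: ltnW|by rewrite ltr_wpDl|].
by apply: (Spec_l2P A t e0).1 => //; rewrite ltrDl.
Qed.

Lemma cvg_gamma_set e : 0 < e -> Spec_l2 e A !=set0 ->
  hausdorff_cvg (fun n => gamma_set n A (e + pen2 al ga n)) (spec_l2 e A).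
Proof.
move=> e0 T0; have c0 : 0 <= (Ma + Mc) * pi by exact: mulr_ge0 (addr_ge0 Ma0 Mc0) (pi_ge0 R).
apply: (cvg_spec hK A_pe (c := (Ma + Mc) * pi)) => //.
- move=> n s rho n1 hs rho0; exists s; last by rewrite subrr cabs0 ltW.
  have n0 : (0 < n)%N by exact: ltnW.
  apply: (@spec_l2_le _ _ (e + pen2 al ga n)); first by rewrite lerD2l pen2_le.
  apply: (gamma_set_spec hK A_pe n0) hs.
  by rewrite ltr_wpDr// (pen2_ge0 hK A_pe).
by move=> n t n1 ht; apply: (spec_gamma_set hK A_pe) => //; exact: ltnW.
Qed.

(** Common to the pi and tau methods: P is the penalty of the method, cq / n the possible pollution;
    P n = 0 has to force diagonal matrices. *)
Lemma cvg_union (M : forall n, int -> 'M[C]_n) (P : nat -> R) (cP cq b : R) :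
  0 <= cP -> 0 <= cq -> 0 <= b ->
  (forall n, (1 < n)%N -> 0 <= P n <= cP / n%:R) ->
  (forall n k i j, cabs (M n k i j) <= b) ->
  (forall n e k, (1 < n)%N -> 0 < e ->
     spec_mx e (M n k) `<=` spec_l2 (e + cq / n%:R) A) ->
  (forall n e, (1 < n)%N -> 0 < e ->
     spec_l2 e A `<=` union_spec (M n) (e + P n)) ->
  (forall n, (1 < n)%N -> P n = 0 -> (forall j, al j = 0 /\ ga j = 0) /\
     forall k i j, M n k i j = if i == j then be (k + 1 + i%:Z) else 0) ->
  (forall e, 0 <= e -> Spec_l2 e A !=set0) ->
  (forall e, 0 <= e ->
     hausdorff_cvg (fun n => union_Spec (M n) (e + P n)) (Spec_l2 e A)) /\
  (forall e, 0 < e ->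
     hausdorff_cvg (fun n => union_spec (M n) (e + P n)) (spec_l2 e A)).
Proof.
move=> cP0 cq0 b0 hP hb up lo hdiag T0; split=> e e0.
  apply: (cvg_Spec hK A_pe (c := cP + (1 + cq))) => //.
  - by rewrite !addr_ge0.
  - exact: T0.
  - move=> n s rho n1 hs rho0; have /andP[P0 P1] := hP n n1.
    have eP : 0 <= e + P n by rewrite addr_ge0.
    have q0 : 0 <= cq / n%:R by rewrite divr_ge0.
    have [s' hs' ss'] := union_Spec_upper (ltnW n1) eP q0
      (fun e' k e'0 => up n e' k n1 e'0) hs rho0.
    exists s' => //; apply: spec_l2_le hs'.
    by rewrite !mulrDl mul1r; lra.
  - move=> n t rho n1 ht rho0; have /andP[P0 P1] := hP n n1.
    apply: (union_Spec_lower hK A_pe (ltnW n1) e0 P0 b0 (hb n) _ _ ht rho0).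
      by move=> e' e'0; exact: lo.
    exact: hdiag.
apply: (cvg_spec hK A_pe (c := cP + cq)) => //.
- by rewrite addr_ge0.
- exact/T0/ltW.
- move=> n s rho n1 [k _ hs] rho0; have /andP[P0 P1] := hP n n1.
  exists s; last by rewrite subrr cabs0 ltW.
  apply: spec_l2_le (up n _ k n1 _ _ hs); last by rewrite ltr_wpDr.
  by rewrite mulrDl; lra.
- by move=> n t n1 ht; exact: lo.
Qed.

Lemma finsec_entry n k (i j : 'I_n) : cabs (finsec A n k i j) <= K.
Proof.
have [ha hb hc] : [/\ forall j, cabs (al j) <= K, forall j, cabs (be j) <= K &
    forall j, cabs (ga j) <= K].
  split=> l; apply: hK; have [h1 h2 h3] := A_pe.1 l.
  - by left; left.
  - by left; right.
  - by right.
rewrite mxE /A /trimat; do 3!case: ifP => _ //.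
by rewrite cabs0.
Qed.

Lemma persec_entry (t : C) n k (i j : 'I_n) : cabs t = 1 ->
  cabs (persec al be ga t n k i j) <= 3 * K.
Proof.
move=> t1; rewrite mxE mxE.
have h0 := finsec_entry k i j; rewrite mxE in h0.
have bK (x : C) (c : bool) : cabs x <= K -> cabs (c%:R * x) <= K.
  by case: c => h; rewrite ?mul1r// mul0r cabs0.
have hal l : cabs (t * al l) <= K.
  by rewrite cabsM t1 mul1r; apply: hK; left; left; have [] := A_pe.1 l.
have hga l : cabs (t^* * ga l) <= K.
  by rewrite cabsM cabs_conj t1 mul1r; apply: hK; right; have [] := A_pe.1 l.
rewrite mxE [3 * K](_ : _ = K + (K + K)); last by ring.
apply: le_trans (cabsD _ _) (lerD h0 _).
exact: le_trans (cabsD _ _) (lerD (bK _ _ (hal _)) (bK _ _ (hga _))).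
Qed.

Lemma finsec_diag n k (i j : 'I_n) : (forall l, al l = 0 /\ ga l = 0) ->
  finsec A n k i j = if i == j then be (k + 1 + i%:Z) else 0.
Proof.
move=> h; rewrite mxE /A /trimat.
have [->|ij] := eqVneq i j.
  by rewrite eqxx ifF//; ilia.
have nij : (i : nat) != j by apply: contra ij => /eqP/val_inj ->.
case: eqP => _; first by have [] := h (k + 1 + j%:Z).
rewrite ifF; last by apply/negP => /eqP e; case/eqP: nij; ilia.
by case: eqP => _ //; have [] := h (k + 1 + j%:Z).
Qed.

Lemma zero_of_supnorm : Ma = 0 -> Mc = 0 -> forall l, al l = 0 /\ ga l = 0.
Proof.
move=> a0 c0 l; have h1 := supnorm_al hK A_pe l; have h2 := supnorm_ga hK A_pe l.
rewrite -/Ma a0 in h1; rewrite -/Mc c0 in h2.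
by split; apply/eqP; rewrite -cabs_eq0 eq_le cabs_ge0 andbT.
Qed.

Lemma persec_spec n k (t : C) e : (0 < n)%N -> cabs t = 1 -> 0 < e ->
  spec_mx e (persec al be ga t n k) `<=` spec_l2 e A.
Proof.
move=> n0 t1 e0 z hz; apply/(spec_approx hK A_pe z e0).
exact: (persec_approx hK A_pe n0 t1 e0 hz).
Qed.

Lemma cvg_persec (t : C) : cabs t = 1 ->
  (forall e, 0 <= e -> Spec_l2 e A !=set0) ->
  (forall e, 0 <= e -> hausdorff_cvg
     (fun n => union_Spec (persec al be ga t n) (e + pen1 al ga n)) (Spec_l2 e A)) /\
  (forall e, 0 < e -> hausdorff_cvg
     (fun n => union_spec (persec al be ga t n) (e + pen1 al ga n)) (spec_l2 e A)).
Proof.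
move=> t1 T0; have c0 : 0 <= (Ma + Mc) * pi by exact: mulr_ge0 (addr_ge0 Ma0 Mc0) (pi_ge0 R).
apply: (@cvg_union (persec al be ga t) _ ((Ma + Mc) * pi) 0 (3 * K)) => //.
- by rewrite mulr_ge0.
- move=> n n1; have n0 := ltnW n1; rewrite pen1_le// andbT.
  by case: n n1 n0 => // n _ _; rewrite pen1_pen2; exact: (pen2_ge0 hK A_pe).
- by move=> n k i j; exact: persec_entry.
- by move=> n e k n1 e0; rewrite mul0r addr0; apply: persec_spec => //; exact: ltnW.
- move=> n e n1 e0 z; exact: (spec_union_persec hK A_pe).
move=> n n1 P0; have n0 := ltnW n1; have nR : 1 < n%:R :> R by rewrite ltr1n.
have s0 : 0 < sin (pi / (2 * n%:R)) :> R.
  apply: sin_gt0_pi; rewrite divr_gt0 ?pi_gt0 ?mulr_gt0 ?ltr0n//=.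
  by rewrite ltr_pdivrMr ?mulr_gt0 ?ltr0n// ltr_pMr ?pi_gt0//; lra.
have MM : Ma + Mc = 0.
  move: P0; rewrite /pen1 -/Ma -/Mc => /eqP; rewrite !mulf_eq0 pnatr_eq0 /= (gt_eqF s0) orbF.
  by move/eqP.
have h0 : forall l, al l = 0 /\ ga l = 0.
  move/eqP: MM; rewrite paddr_eq0// => /andP[/eqP a0 /eqP c0'].
  exact: zero_of_supnorm.
split=> // k i j; rewrite mxE [X in _ + X]mxE.
have [-> _] := h0 k; have [_ ->] := h0 (k + n%:Z + 1).
by rewrite !mulr0 !addr0; exact: finsec_diag.
Qed.

(** Bounds n times the excess in [finsec_approx_line], since 8 K sin (pi / (2 n)) <= 4 K pi / n. *)
Definition tau_const : R := 4 * K * pi + 2.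

Lemma tau_const_ge0 : 0 <= tau_const.
Proof. by rewrite addr_ge0// !mulr_ge0// pi_ge0. Qed.

(** All that (a) or (b) has to supply: a decaying solution for each half-line, unless lam lies on an
    ellipse. *)
Definition both_roots (lam : C) : Prop :=
  (exists a b c, [/\ Sa a, Sb b, Sc c & ellipse a b c lam \/ decaying_root a b c lam]) /\
  (exists a b c, [/\ Sa a, Sb b, Sc c & ellipse a b c lam \/ decaying_root c b a lam]).

Lemma finsec_spec n k e : (forall lam, both_roots lam) -> (0 < n)%N -> 0 < e ->
  spec_mx e (finsec A n k) `<=` spec_l2 (e + tau_const / n%:R) A.
Proof.
move=> hroots n0 e0 z hz; have [h1 h2] := hroots z.
have nR : 0 < n%:R :> R by rewrite ltr0n.
apply/(spec_approx hK A_pe); first by rewrite ltr_wpDr// divr_ge0 ?tau_const_ge0.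
have q0 : 0 <= sin (pi / (2 * n%:R)) :> R.
  apply: sin_ge0_pi; rewrite divr_ge0 ?pi_ge0 ?mulr_ge0//=.
  rewrite ler_pdivrMr ?mulr_gt0// ler_pMr ?pi_gt0//.
  by rewrite -natrM ler1n muln_gt0.
apply: approx_on_le (finsec_approx_line hK A_pe n0 e0 h1 h2 hz).
  by rewrite !addr_ge0 ?(ltW e0)// !mulr_ge0.
rewrite lerD2l /tau_const [X in _ <= X]mulrDl lerD2r.
have := @sin_half_le n (4 * K) n0 (mulr_ge0 (ler0n R 4) K0).
by rewrite [2 * (4 * K)](_ : _ = 8 * K); last by ring.
Qed.

Lemma cvg_finsec : (forall lam, both_roots lam) ->
  (forall e, 0 <= e -> Spec_l2 e A !=set0) ->
  (forall e, 0 <= e -> hausdorff_cvg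
     (fun n => union_Spec (finsec A n) (e + pen al ga n)) (Spec_l2 e A)) /\
  (forall e, 0 < e -> hausdorff_cvg
     (fun n => union_spec (finsec A n) (e + pen al ga n)) (spec_l2 e A)).
Proof.
move=> hroots T0.
apply: (@cvg_union (finsec A) _ pen_const tau_const K) => //.
- exact: pen_const_ge0.
- exact: tau_const_ge0.
- by move=> n n1; rewrite pen_ge0 ?pen_le_const// ltnW.
- by move=> n k i j; exact: finsec_entry.
- by move=> n e k n1 e0; apply: finsec_spec => //; exact: ltnW.
- move=> n e n1 e0 z; apply: (spec_union_finsec hK A_pe) => //; exact: ltnW.
move=> n n1 P0; have n0 := ltnW n1.
have M0 : Num.max Ma Mc <= 0.
  by rewrite leNgt; apply/negP => /(pen_gt0 Ma0 Mc0 n0); rewrite P0 ltxx.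
move: M0; rewrite ge_max => /andP[a0 c0].
have h0 : forall l, al l = 0 /\ ga l = 0.
  by apply: zero_of_supnorm; apply/eqP; rewrite eq_le ?a0 ?c0 ?Ma0 ?Mc0.
by split=> // k i j; exact: finsec_diag.
Qed.

Lemma null_sequence (c : R) : 0 < c ->
  [/\ forall n : nat, 0 < c / n.+1%:R & c / n.+1%:R @[n --> \oo] --> (0 : R)].
Proof.
move=> c0; split=> [n|]; first by rewrite divr_gt0.
rewrite -[X in _ --> X](mulr0 c); apply: cvgM; first exact: cvg_cst.
exact: cvg_harmonic.
Qed.

Lemma persec_no_pollution (t : C) : cabs t = 1 -> no_pollution (persec al be ga t) A.
Proof.
move=> t1; have [h1 h2] := null_sequence (@ltr01 R).
exists (fun n => 1 / n.+1%:R); split=> // e e0 n k n0 z hz.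
by apply: spec_l2_le (persec_spec n0 t1 e0 hz); rewrite lerDl ltW.
Qed.

Lemma finsec_no_pollution : (forall lam, both_roots lam) ->
  no_pollution (finsec A) A.
Proof.
move=> hroots; have c0 : 0 < 2 * (tau_const + 1).
  by rewrite mulr_gt0// ltr_wpDl// tau_const_ge0.
have [h1 h2] := null_sequence c0.
(* The sequence must be positive at n = 0 too; n + 1 <= 2 n accounts for the factor 2. *)
exists (fun n => 2 * (tau_const + 1) / n.+1%:R); split=> // e e0 n k n0 z hz.
apply: spec_l2_le (finsec_spec hroots n0 e0 hz); rewrite lerD2l.
have nR : 1 <= n%:R :> R by rewrite ler1n.
have t0 := tau_const_ge0.
rewrite ler_pdivrMr; last by lra.
rewrite mulrAC ler_pdivlMr; last by rewrite ltr0n.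
rewrite -natr1; nra.
Qed.

End Convergence.

Theorem theorem8p3 (R : realType) (Sa Sb Sc : set (Cplx R))
    (al be ga : int -> Cplx R)
    (Sa0 : Sa !=set0) (Sb0 : Sb !=set0) (Sc0 : Sc !=set0)
    (Sa_compact : compact Sa) (Sb_compact : compact Sb)
    (Sc_compact : compact Sc)
    (A_pe : pseudoergodic Sa Sb Sc al be ga) :
  let A := trimat al be ga in
  let cond_a := minabs Sc <= maxabs Sa /\ minabs Sa <= maxabs Sc in
  let cond_b := ellipse_cap Sa Sb Sc = set0 in
  [/\ forall t : Cplx R, cabs t = 1 -> no_pollution (persec al be ga t) A,
      cond_a \/ cond_b -> no_pollution (finsec A) A,
      (forall eps : R, 0 <= eps ->
         hausdorff_cvg (fun n => Gamma_set n A (eps + pen2 al ga n))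
                       (Spec_l2 eps A)) /\
      (forall eps : R, 0 < eps ->
         hausdorff_cvg (fun n => gamma_set n A (eps + pen2 al ga n))
                       (spec_l2 eps A)),
      forall t : Cplx R, cabs t = 1 ->
      (forall eps : R, 0 <= eps ->
         hausdorff_cvg
           (fun n => union_Spec (persec al be ga t n) (eps + pen1 al ga n))
           (Spec_l2 eps A)) /\
      (forall eps : R, 0 < eps ->
         hausdorff_cvg
           (fun n => union_spec (persec al be ga t n) (eps + pen1 al ga n))
           (spec_l2 eps A))
    & cond_a \/ cond_b ->
      (forall eps : R, 0 <= eps ->
         hausdorff_cvg
           (fun n => union_Spec (finsec A n) (eps + pen al ga n))
           (Spec_l2 eps A)) /\
      (forall eps : R, 0 < eps ->
         hausdorff_cvg
           (fun n => union_spec (finsec A n) (eps + pen al ga n))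
           (spec_l2 eps A))].
Proof.
move=> A cond_a cond_b.
have [Ka Ka0 hKa] := compact_cabs_bound Sa_compact.
have [Kb Kb0 hKb] := compact_cabs_bound Sb_compact.
have [Kc Kc0 hKc] := compact_cabs_bound Sc_compact.
have hK (a : Cplx R) : (Sa `|` Sb `|` Sc) a -> cabs a <= Ka + Kb + Kc.
  by move=> [[/hKa|/hKb]|/hKc] h; lra.
have T0 e : 0 <= e -> Spec_l2 e A !=set0 by exact: (Spec_nonempty hK A_pe).
have roots : cond_a \/ cond_b -> forall lam, both_roots Sa Sb Sc lam.
  move=> [[h1 h2] lam|hcap lam].
    (* Condition (a) yields one symbol with |c| <= |a| and one with |a| <= |c|, and b is
       arbitrary. *)
    have [c hc ec] := minabs_attained Sc_compact Sc0.
    have [a ha ea] := maxabs_attained Sa_compact Sa0.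
    have [a' ha' ea'] := minabs_attained Sa_compact Sa0.
    have [c' hc' ec'] := maxabs_attained Sc_compact Sc0.
    have [b hb] := Sb0; split.
      exists a, b, c; split=> //; apply: root_of_cabs_le.
      by rewrite ec ea.
    exists a', b, c'; split=> //; rewrite ellipse_sym; apply: root_of_cabs_le.
    by rewrite ea' ec'.
  have [a [b [c [ha hb hc nenc]]]] : exists a b c, [/\ Sa a, Sb b, Sc c &
      ~ enclosed (ellipse a b c) lam].
    apply: contrapT => h; suff : ellipse_cap Sa Sb Sc lam by rewrite [ellipse_cap _ _ _]hcap.
    move=> a b c ha hb hc; apply: contrapT => ne.
    by apply: h; exists a, b, c.
  (* Exchanging a and c does not change the ellipse, so one symbol serves both orientations. *)
  split; exists a, b, c; split=> //; first exact: not_enclosed_root.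
  by rewrite ellipse_sym; apply: not_enclosed_root; rewrite ellipse_sym.
split.
- by move=> t t1; exact: (persec_no_pollution hK A_pe t1).
- by move=> /roots; exact: (finsec_no_pollution hK A_pe).
- split=> e e0; first exact: (cvg_Gamma_set hK A_pe e0 (T0 e e0)).
  exact: (cvg_gamma_set hK A_pe e0 (T0 e (ltW e0))).
- by move=> t t1; exact: (cvg_persec hK A_pe t1 T0).
- by move=> /roots h; exact: (cvg_finsec hK A_pe h T0).
Qed.
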